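(* Let $X=\Gamma\backslash G$ be a $6$-dimensional nilmanifold that is not a torus, endowed with a left-invariant complex structure $J$. Then there is no left-invariant Hermitian metric on $(X,J)$ whose associated $(1,1)$-form $\omega$ satisfies the following property (where $n=\dim_{\mathbb{C}}X=3$): $\omega^{n-2}=\omega$ is the $(n-2,n-2)$-component, i.e. the $(1,1)$-component, of a $d$-closed $(2n-4)$-form, i.e. of a $d$-closed $2$-form, on $X$.
   Context: A nilmanifold is a compact quotient $X=\Gamma\backslash G$ of a connected simply-connected nilpotent real Lie group $G$ by a co-compact discrete subgroup $\Gamma$; it is a torus exactly when $G$ is abelian. A complex structure or metric on $X$ is left-invariant if it is induced by a left-invariant one on $G$. Type decomposition of forms is with respect to $J$. *)

(* Defs.v *)
From HB Require Import structures.
From mathcomp Require Import all_boot all_order all_algebra generic_quotient.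
From mathcomp Require Import all_classical all_reals all_analysis.
From mathcomp Require Import complex.

Set Implicit Arguments.
Unset Strict Implicit.
Unset Printing Implicit Defensive.

Import Order.TTheory GRing.Theory Num.Theory numFieldNormedType.Exports.

Local Open Scope classical_set_scope.
Local Open Scope ring_scope.
Local Open Scope quotient_scope.

Fixpoint Ck_on (R : realType) (V W : normedModType R) (k : nat)
    (U : set V) (f : V -> W) : Prop :=
  if k is k'.+1 then
    (forall x, U x -> differentiable f x) /\
    (forall v : V, Ck_on k' U (fun x => 'D_v f x))
  else forall x, U x -> {for x, continuous f}.

Definition smooth_near (R : realType) (V W : normedModType R)
    (f : V -> W) (x : V) : Prop :=
  exists2 U : set V, open_nbhs x U & forall k, Ck_on k U f.

(* [chart_map] is a homeomorphism from the open set [chart_dom] onto an open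
   subset of R^n, with inverse [chart_inv]; both functions are total and their
   values elsewhere are irrelevant. *)
Record chart (R : realType) (n : nat) (M : topologicalType) := Chart {
  chart_dom : set M;
  chart_map :> M -> 'rV[R]_n;
  chart_inv : 'rV[R]_n -> M;
  open_chart_dom : open chart_dom;
  open_chart_img : open (chart_map @` chart_dom);
  chart_mapK : forall p, chart_dom p -> chart_inv (chart_map p) = p;
  chart_map_cts : forall p, chart_dom p -> {for p, continuous chart_map};
  chart_inv_cts : forall p, chart_dom p ->
    {for chart_map p, continuous chart_inv}
}.

HB.mixin Record isLieGroup (R : realType) (n : nat) (G : Type)
    of Topological G & Group G := {
  atlas : set (chart R n G);
  atlas_cover : forall p : G, exists2 c, atlas c & chart_dom c p;
  atlas_compat : forall c d p, atlas c -> atlas d ->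
    chart_dom c p -> chart_dom d p ->
    smooth_near (fun x => d (chart_inv c x)) (c p);
  lie_hausdorff : hausdorff_space G;
  lie_mul_cts : continuous (fun pq : G * G => (pq.1 * pq.2)%g);
  lie_inv_cts : continuous (fun p : G => (p^-1)%g);
  lie_mul_smooth : forall (c1 c2 d : chart R n G) (p q : G),
    atlas c1 -> atlas c2 -> atlas d ->
    chart_dom c1 p -> chart_dom c2 q -> chart_dom d (p * q)%g ->
    smooth_near (fun x : 'rV[R]_n * 'rV[R]_n =>
                   d (chart_inv c1 x.1 * chart_inv c2 x.2)%g) (c1 p, c2 q);
  lie_inv_smooth : forall (c d : chart R n G) (p : G),
    atlas c -> atlas d -> chart_dom c p -> chart_dom d (p^-1)%g ->
    smooth_near (fun x => d ((chart_inv c x)^-1)%g) (c p)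
}.

#[short(type="lieGroupType")]
HB.structure Definition LieGroup (R : realType) (n : nat) :=
  {G of isLieGroup R n G & Topological G & Group G}.

Definition lsmul (G : groupType) (g : G) : G -> G := fun p => (g * p)%g.

Fixpoint upper_central (G : groupType) (k : nat) : set G :=
  if k is k'.+1 then [set x | forall y, upper_central k' [~ x, y]%g]
  else [set 1%g].

Definition nilpotent_group (G : groupType) : Prop :=
  exists k, upper_central k = [set: G].

(* Every loop is null-homotopic relative to its base point. *)
Definition loops_contractible (R : realType) (T : topologicalType) : Prop :=
  forall gam : R -> T,
    {within `[0, 1], continuous gam} -> gam 0 = gam 1 ->
    exists H : R * R -> T,
      [/\ {within `[0, 1] `*` `[0, 1], continuous H},
          {in `[0, 1], forall s, H (s, 0) = gam s},
          {in `[0, 1], forall s, H (s, 1) = gam 0} &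
          {in `[0, 1], forall t, H (0, t) = gam 0 /\ H (1, t) = gam 0}].

Record subgroup (G : groupType) := Subgroup {
  subgroup_set :> set G;
  subgroup1 : subgroup_set 1%g;
  subgroupM : forall x y,
    subgroup_set x -> subgroup_set y -> subgroup_set (x * y)%g;
  subgroupV : forall x, subgroup_set x -> subgroup_set (x^-1)%g
}.

Section LeftQuotient.
Variables (G : groupType) (Gam : subgroup G).

(* p and q are in the same orbit of Gam, i.e. Gam p = Gam q. *)
Definition orbit_rel : rel G := fun p q => `[< subgroup_set Gam (q * p^-1)%g >].

Lemma orbit_rel_refl : reflexive orbit_rel.
Proof. by move=> p; apply/asboolP; rewrite mulgV; exact: subgroup1. Qed.

Lemma orbit_rel_sym : symmetric orbit_rel.
Proof.
have sub p q : orbit_rel p q -> orbit_rel q p.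
  move=> /asboolP /subgroupV; rewrite invgM invgK => h; exact/asboolP.
by move=> p q; apply/idP/idP; exact: sub.
Qed.

Lemma orbit_rel_trans : transitive orbit_rel.
Proof.
move=> q p r /asboolP pq /asboolP qr; apply/asboolP.
by have := subgroupM qr pq; rewrite mulgA mulgVK.
Qed.

Definition orbit_equiv : equiv_rel G :=
  EquivRel orbit_rel orbit_rel_refl orbit_rel_sym orbit_rel_trans.

End LeftQuotient.

Definition left_quotient (G : groupType) (Gam : subgroup G) : Type :=
  {eq_quot (orbit_equiv Gam)}.

Definition lq_proj (G : groupType) (Gam : subgroup G) (p : G) :
  left_quotient Gam := \pi_({eq_quot (orbit_equiv Gam)}) p.

Definition discrete_subgroup (R : realType) (n : nat) (G : lieGroupType R n)
    (Gam : subgroup G) : Prop :=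
  exists2 U : set G, open U & U `&` Gam = [set 1%g].

Definition cocompact_subgroup (R : realType) (n : nat) (G : lieGroupType R n)
    (Gam : subgroup G) : Prop :=
  compact [set: quotient_topology {eq_quot (orbit_equiv Gam)}].

(* [S f p] means that f is smooth on a neighbourhood of p. *)
Definition smooth_structure (R : realType) (M : Type) :=
  (M -> R) -> M -> Prop.

Definition lie_smooth (R : realType) (n : nat) (G : lieGroupType R n) :
    smooth_structure R G :=
  fun f p => forall c : chart R n G, atlas c -> chart_dom c p ->
    smooth_near (fun x => f (chart_inv c x) : R^o) (c p).

(* For a discrete subgroup Gam, G -> Gam \ G is a covering map, and this is the
   structure making it a local diffeomorphism. *)
Definition quotient_smooth (R : realType) (n : nat) (G : lieGroupType R n)
    (Gam : subgroup G) : smooth_structure R (left_quotient Gam) :=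
  fun f x => forall p, lq_proj Gam p = x ->
    lie_smooth (fun q => f (lq_proj Gam q)) p.

Notation tvec R M := ((M -> R) -> R^o).

Section Tensors.
Variables (R : realType) (M : Type) (S : smooth_structure R M).
Implicit Types (p : M) (u v w : tvec R M).
Local Open Scope complex_scope.

(* T_p M: derivations of the algebra of germs at p. A derivation is represented
   by a function defined on all f : M -> R that vanishes where f is not smooth
   near p, so that equal derivations are equal functions; it depends only on
   the germ of f by the Leibniz rule applied to indicator functions. *)
Definition tangent p v : Prop :=
  [/\ forall f, ~ S f p -> v f = 0,
      forall (a : R) f g, S f p -> S g p ->
        v (fun x => a * f x + g x) = a * v f + v g &
      forall f g, S f p -> S g p ->
        v (fun x => f x * g x) = v f * g p + f p * v g].

Definition vector_field (X : M -> tvec R M) : Prop :=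
  (forall p, tangent p (X p)) /\
  (forall f p, S f p -> S (fun q => X q f) p).

Definition lie_bracket (X Y : M -> tvec R M) : M -> tvec R M := fun p f =>
  if `[< S f p >] then X p (fun q => Y q f) - Y p (fun q => X q f) else 0.

Definition smooth_endo (J : M -> tvec R M -> tvec R M) : Prop :=
  [/\ forall p u, tangent p u -> tangent p (J p u),
      forall p (a : R) u v, tangent p u -> tangent p v ->
        J p (a *: u + v) = a *: J p u + J p v &
      forall X, vector_field X -> vector_field (fun p => J p (X p))].

Definition nijenhuis (J : M -> tvec R M -> tvec R M) (X Y : M -> tvec R M) p :
    tvec R M :=
  let JX q := J q (X q) in let JY q := J q (Y q) in
  lie_bracket JX JY p - J p (lie_bracket JX Y p) - J p (lie_bracket X JY p)
    - lie_bracket X Y p.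

Definition complex_structure (J : M -> tvec R M -> tvec R M) : Prop :=
  [/\ smooth_endo J,
      forall p u, tangent p u -> J p (J p u) = - u &
      forall X Y p, vector_field X -> vector_field Y -> nijenhuis J X Y p = 0].

Definition riemannian_metric (h : M -> tvec R M -> tvec R M -> R) : Prop :=
  [/\ forall p (a : R) u v w, tangent p u -> tangent p v -> tangent p w ->
        h p (a *: u + v) w = a * h p u w + h p v w,
      forall p u v, tangent p u -> tangent p v -> h p u v = h p v u,
      forall p u, tangent p u -> u <> 0 -> 0 < h p u u &
      forall X Y p, vector_field X -> vector_field Y ->
        S (fun q => h q (X q) (Y q)) p].

Definition hermitian_metric (J : M -> tvec R M -> tvec R M)
    (h : M -> tvec R M -> tvec R M -> R) : Prop :=
  riemannian_metric h /\
  (forall p u v, tangent p u -> tangent p v -> h p (J p u) (J p v) = h p u v).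

Definition form2 (alpha : M -> tvec R M -> tvec R M -> R[i]) : Prop :=
  [/\ forall p (a : R) u v w, tangent p u -> tangent p v -> tangent p w ->
        alpha p (a *: u + v) w = a%:C * alpha p u w + alpha p v w,
      forall p u v, tangent p u -> tangent p v -> alpha p u v = - alpha p v u &
      forall X Y p, vector_field X -> vector_field Y ->
        S (fun q => complex.Re (alpha q (X q) (Y q))) p /\
        S (fun q => complex.Im (alpha q (X q) (Y q))) p].

Definition derivC v (F : M -> R[i]) : R[i] :=
  v (fun q => complex.Re (F q)) +i* v (fun q => complex.Im (F q)).

(* The invariant (Koszul) formula for (d alpha)(X, Y, Z). *)
Definition d2 (alpha : M -> tvec R M -> tvec R M -> R[i])
    (X Y Z : M -> tvec R M) p : R[i] :=
  derivC (X p) (fun q => alpha q (Y q) (Z q))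
  - derivC (Y p) (fun q => alpha q (X q) (Z q))
  + derivC (Z p) (fun q => alpha q (X q) (Y q))
  - alpha p (lie_bracket X Y p) (Z p)
  + alpha p (lie_bracket X Z p) (Y p)
  - alpha p (lie_bracket Y Z p) (X p).

Definition closed2 (alpha : M -> tvec R M -> tvec R M -> R[i]) : Prop :=
  forall X Y Z p, vector_field X -> vector_field Y -> vector_field Z ->
    d2 alpha X Y Z p = 0.

(* alpha (u + i u', v + i v') for the C-bilinear extension of alpha. *)
Definition extC (alpha : M -> tvec R M -> tvec R M -> R[i]) p
    (u u' v v' : tvec R M) : R[i] :=
  alpha p u v - alpha p u' v' + (0 +i* 1) * (alpha p u' v + alpha p u v').

(* The vectors of type (1,0) are the u - i J u, those of type (0,1) the
   u + i J u; a (p,q)-form vanishes unless it is evaluated at p vectors of type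
   (1,0) and q of type (0,1). *)
Definition type20 (J : M -> tvec R M -> tvec R M)
    (alpha : M -> tvec R M -> tvec R M -> R[i]) : Prop :=
  forall p u v, tangent p u -> tangent p v ->
    extC alpha p u (J p u) v (- J p v) = 0 /\
    extC alpha p u (J p u) v (J p v) = 0.

Definition type11 (J : M -> tvec R M -> tvec R M)
    (alpha : M -> tvec R M -> tvec R M -> R[i]) : Prop :=
  forall p u v, tangent p u -> tangent p v ->
    extC alpha p u (- J p u) v (- J p v) = 0 /\
    extC alpha p u (J p u) v (J p v) = 0.

Definition type02 (J : M -> tvec R M -> tvec R M)
    (alpha : M -> tvec R M -> tvec R M -> R[i]) : Prop :=
  forall p u v, tangent p u -> tangent p v ->
    extC alpha p u (- J p u) v (- J p v) = 0 /\
    extC alpha p u (- J p u) v (J p v) = 0.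

Definition is_component11 (J : M -> tvec R M -> tvec R M)
    (alpha beta : M -> tvec R M -> tvec R M -> R[i]) : Prop :=
  exists alpha20 alpha02 : M -> tvec R M -> tvec R M -> R[i],
    [/\ form2 alpha20 /\ type20 J alpha20,
        form2 beta /\ type11 J beta,
        form2 alpha02 /\ type02 J alpha02 &
        forall p u v, tangent p u -> tangent p v ->
          alpha p u v = alpha20 p u v + beta p u v + alpha02 p u v].

Definition fundamental_form (J : M -> tvec R M -> tvec R M)
    (h : M -> tvec R M -> tvec R M -> R) : M -> tvec R M -> tvec R M -> R[i] :=
  fun p u v => (h p (J p u) v)%:C.

End Tensors.

(* Differential of F : M -> N. When F is a local diffeomorphism, f o F is smooth
   near p iff f is smooth near F p, so tangent vectors at p are sent to tangent
   vectors at F p without further normalization. *)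
Definition pushforward (R : realType) (M N : Type) (F : M -> N)
    (v : tvec R M) : tvec R N := fun f => v (fun p => f (F p)).

Section LeftInvariant.
Variables (R : realType) (n : nat) (G : lieGroupType R n) (Gam : subgroup G).

Definition left_invariant_endo (J : G -> tvec R G -> tvec R G) : Prop :=
  forall g p u, tangent (@lie_smooth R n G) p u ->
    J (g * p)%g (pushforward (lsmul g) u) = pushforward (lsmul g) (J p u).

Definition left_invariant_metric (h : G -> tvec R G -> tvec R G -> R) : Prop :=
  forall g p u v,
    tangent (@lie_smooth R n G) p u -> tangent (@lie_smooth R n G) p v ->
    h (g * p)%g (pushforward (lsmul g) u) (pushforward (lsmul g) v) = h p u v.

Definition left_invariant_complex_structure
    (J : left_quotient Gam -> tvec R (left_quotient Gam) ->
         tvec R (left_quotient Gam)) : Prop :=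
  complex_structure (@quotient_smooth R n G Gam) J /\
  exists JG : G -> tvec R G -> tvec R G,
    [/\ complex_structure (@lie_smooth R n G) JG,
        left_invariant_endo JG &
        forall p u, tangent (@lie_smooth R n G) p u ->
          J (lq_proj Gam p) (pushforward (lq_proj Gam) u) =
          pushforward (lq_proj Gam) (JG p u)].

Definition left_invariant_hermitian_metric
    (J : left_quotient Gam -> tvec R (left_quotient Gam) ->
         tvec R (left_quotient Gam))
    (h : left_quotient Gam -> tvec R (left_quotient Gam) ->
         tvec R (left_quotient Gam) -> R) : Prop :=
  hermitian_metric (@quotient_smooth R n G Gam) J h /\
  exists hG : G -> tvec R G -> tvec R G -> R,
    [/\ riemannian_metric (@lie_smooth R n G) hG,
        left_invariant_metric hG &
        forall p u v,
          tangent (@lie_smooth R n G) p u -> tangent (@lie_smooth R n G) p v ->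
          h (lq_proj Gam p) (pushforward (lq_proj Gam) u)
            (pushforward (lq_proj Gam) v) = hG p u v].

End LeftInvariant.

(* Main.v *)
Require Import Defs.
From HB Require Import structures.
From mathcomp Require Import all_boot all_order all_algebra generic_quotient.
From mathcomp Require Import all_classical all_reals all_analysis.
From mathcomp Require Import complex.
From mathcomp Require Import ring lra.

(** Write Omega for the closed 2-form and omega for its (1,1)-component. On a
    pair of the form v, J v the components of type (2,0) and (0,2) vanish, so
    Omega (v, J v) = omega (v, J v) = h (v, v), a positive constant for a
    nonzero left-invariant field v. The contradiction is that closedness makes
    such a constant a sum of derivatives, along left-invariant fields, of
    functions on the compact quotient, and that such a sum averages to zero.

    The algebra takes place in the six-dimensional nilpotent Lie algebra g of G
    ([complex_nilpotent_dichotomy]). Choose a nonzero central bracket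
    z = [y, w]. If J z is central too, then d Omega (J z, y, w) = 0 expresses
    Omega (z, J z) by derivatives, since the brackets of J z with y and w
    vanish. Otherwise A = ad (J z) is a nonzero nilpotent derivation that
    commutes with J, because J is integrable and z is central. In complex
    dimension 3 nilpotency forces A o A = 0 and A [u, J u] = 0 for some u with
    v = A u nonzero. The relations d Omega (J z, v, J u) = 0 and
    d Omega (J z, u, J v) = 0 add up to 2 Omega (v, J v) = derivatives
    + Omega (J z, A [u, J u]), and the last term is zero.

    Averaging ([no_constant_divergence]) replaces the integral over the
    nilmanifold. If a sum of derivatives X_i f_i were a constant C > 0, then by
    compactness of the quotient, for a small t > 0 the differences
    f_i (p g_i) - f_i (p) would add up to at least t C / 2 for every p in G,
    where g_i is a point at time t on a curve of velocity X_i. The f_i are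
    bounded and G is nilpotent, hence amenable, so this is impossible: averaging
    over the powers of one g_i after another makes the differences small, at the
    expense of commutators further down the upper central series
    ([nilpotent_no_drift]).

    The link with the given data is a part of Lie theory. By Hadamard's lemma
    the derivations at a point of G are the directional derivatives
    ([derivation_components]), so every tangent space is identified with R^6 by
    left translation. The commutator of left-invariant fields defines the
    bracket, and minus the bracket is the derivative of the adjoint action
    ([derive_Ad]). Differentiating iterated commutators in G shows that
    g is nilpotent ([nilpotent_bracket]); and if the bracket is zero, then the
    adjoint action and the commutators of G are locally constant, so that the
    connected group G is commutative ([abelian_of_bracket0]). *)

Set Implicit Arguments.
Unset Strict Implicit.
Unset Printing Implicit Defensive.

Import Order.TTheory GRing.Theory Num.Theory numFieldNormedType.Exports.

Local Open Scope classical_set_scope.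
Local Open Scope ring_scope.

(** * Differential calculus *)

Section Differentials.
Context {R : realType}.
Implicit Types V W : normedModType R.

Lemma diff_eps V W (f : V -> W) (x : V) : differentiable f x ->
  forall e : R, 0 < e ->
  \forall h \near (0 : V), `|f (h + x) - f x - 'd f x h| <= e * `|h|.
Proof.
move=> /diff_locally /eqaddoP df e e0; have := df e e0.
by apply: filterS => h /=; rewrite !fctE /= opprD addrA.
Qed.

(** Differentiability by an explicit bound, the form in which integrals produce
    it. *)
Lemma is_diff_eps V W (f : V -> W) (x : V) (L : {linear V -> W}) :
  continuous L ->
  (forall e : R, 0 < e ->
    \forall h \near (0 : V), `|f (h + x) - f x - L h| <= e * `|h|) ->
  is_diff x f L.
Proof.
move=> cL fL.
have E : f \o shift x = cst (f x) + L +o_ 0 id.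
  apply/eqaddoP => e e0; have := fL e e0.
  by apply: filterS => h /=; rewrite !fctE /= opprD addrA.
have H := diff_unique cL E.
apply: DiffDef => //; apply/diff_locallyP; rewrite H; split => //.
Qed.

Lemma differentiable_near_eq V W (f g : V -> W) (x : V) :
  {near x, f =1 g} -> differentiable f x -> differentiable g x.
Proof.
move=> fg df.
suff : is_diff x g ('d f x) by [].
apply: is_diff_eps => [|e e0]; first exact: diff_continuous.
have H := diff_eps df e0.
have fgx : f x = g x by exact: nbhs_singleton fg.
have fg' : \forall h \near (0 : V), f (h + x) = g (h + x).
  have cs : (fun h : V => h + x) @ (0 : V) --> x.
    by rewrite -[X in _ --> X]add0r; apply: cvgD; [exact: cvg_id|exact: cvg_cst].
  exact: (cs _ fg).
by near=> h; rewrite -fgx -(near fg' h)//; near: h; exact: H.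
Unshelve. all: by end_near. Qed.

End Differentials.

Section Smoothness.
Context {R : realType}.
Implicit Types V W : normedModType R.

Lemma Ck_onW V W k (U : set V) (f : V -> W) : Ck_on k.+1 U f -> Ck_on k U f.
Proof.
elim: k f => [|k IH] f [df Df]; first by move=> x Ux; exact/differentiable_continuous/df.
by split => // v; exact/IH/Df.
Qed.

Lemma Ck_on_subset V W k (U U' : set V) (f : V -> W) :
  U' `<=` U -> Ck_on k U f -> Ck_on k U' f.
Proof.
move=> sub; elim: k f => [|k IH] f /=; first by move=> cf x /sub; exact: cf.
by move=> [df Df]; split => [x /sub /df //|v]; exact/IH/Df.
Qed.

(** A derivative only sees the germ of a function, so on an open set a function
    may be replaced by a formula valid there. All closure properties of
    [Ck_on] rest on this: the derivative of a sum, product or composite is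
    rewritten by the usual rule, which holds on that open set only. *)
Lemma Ck_on_eq V W k (U : set V) (f g : V -> W) : open U ->
  (forall x, U x -> f x = g x) -> Ck_on k U f -> Ck_on k U g.
Proof.
move=> oU; elim: k f g => [|k IH] f g fg.
  move=> cf x Ux; have cfx : f @ x --> f x := cf x Ux.
  suff : g @ x --> f x by rewrite fg.
  apply: cvg_trans cfx; apply: near_eq_cvg.
  by apply: filterS (open_nbhs_nbhs (conj oU Ux)) => y Uy; rewrite fg.
move=> [df Df]; have nfg x : U x -> {near x, f =1 g}.
  by move=> Ux; apply: filterS (open_nbhs_nbhs (conj oU Ux)) => y /fg.
split => [x Ux|v]; first exact: differentiable_near_eq (nfg x Ux) (df x Ux).
by apply: IH (Df v) => x Ux; apply: near_eq_derive; exact: nfg.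
Qed.

Lemma Ck_on_cst V W k (U : set V) (w : W) : Ck_on k U (fun _ => w).
Proof.
elim: k w => [|k IH] w; first by move=> x _; exact: cst_continuous.
split => [x _|v]; first exact: differentiable_cst.
have -> : (fun x => 'D_v (fun _ : V => w) x) = (fun _ : V => 0 : W).
  by apply/funext => x; exact: derive_cst.
exact: IH.
Qed.

Lemma Ck_on_lin V W W' k (U : set V) (L : {linear W -> W'}) (f : V -> W) :
  open U -> continuous L -> Ck_on k U f -> Ck_on k U (L \o f).
Proof.
move=> oU cL; elim: k f => [|k IH] f.
  by move=> cf x Ux; apply: continuous_comp; [exact: cf|exact: cL].
move=> [df Df]; have dLf x : U x -> differentiable (L \o f) x.
  move=> Ux; apply: differentiable_comp; first exact: df.
  exact: linear_differentiable.
split=> // v; apply: Ck_on_eq (IH _ (Df v)) => // x Ux /=.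
rewrite (deriveE _ (df _ Ux)) (deriveE _ (dLf _ Ux)).
rewrite (@diff_comp _ _ _ _ f L) /= ?diff_lin //; first exact: df.
exact: linear_differentiable.
Qed.

Lemma Ck_onD V W k (U : set V) (f g : V -> W) : open U ->
  Ck_on k U f -> Ck_on k U g -> Ck_on k U (fun x => f x + g x).
Proof.
move=> oU; elim: k f g => [|k IH] f g.
  by move=> cf cg x Ux; apply: continuousD; [exact: cf|exact: cg].
move=> [df Df] [dg Dg]; split => [x Ux|v].
  by apply: (@differentiableD _ _ _ f g); [exact: df|exact: dg].
apply: Ck_on_eq (IH _ _ (Df v) (Dg v)) => // x Ux.
by rewrite -[RHS]/('D_v (f + g) x) deriveD //; apply: diff_derivable;
  [exact: df|exact: dg].
Qed.

Lemma Ck_on_sum V W k (U : set V) (I : finType) (f : I -> V -> W) : open U ->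
  (forall i, Ck_on k U (f i)) -> Ck_on k U (fun x => \sum_i f i x).
Proof.
move=> oU Hf; elim: (index_enum I) => [|i s IH].
  by apply: Ck_on_eq (Ck_on_cst k U (0 : W)) => // x _; rewrite big_nil.
by apply: Ck_on_eq (Ck_onD oU (Hf i) IH) => // x _; rewrite big_cons.
Qed.

Section Scale.
Context {W : normedModType R}.
Let scale_op (a : R^o) (w : W) : W := a *: w.

Let scale_bilinear :
  bilinear_for
    (GRing.Scale.Law.clone _ _ *:%R _) (GRing.Scale.Law.clone _ _ *:%R _)
    scale_op.
Proof.
split=> [u'|u] a x y /=; rewrite /scale_op.
- by rewrite scalerDl scalerA.
- by rewrite scalerDr !scalerA mulrC.
Qed.

Lemma is_diff_scale V (a : V -> R^o) (b : V -> W) x : differentiable a x ->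
  differentiable b x ->
  is_diff x (fun z => a z *: b z) (fun v => a x *: 'd b x v + 'd a x v *: b x).
Proof.
move=> da db; pose bM := bilinear_isBilinear.Build R R^o W W _ _ scale_op scale_bilinear.
pose B : {bilinear R^o -> W -> W} := HB.pack scale_op bM.
have cB : continuous (fun p : R^o * W => B p.1 p.2) by exact: scale_continuous.
have dp : differentiable (fun z => (a z, b z)) x by exact: differentiable_pair.
have E : (fun z => a z *: b z) = (fun p : R^o * W => B p.1 p.2) \o (fun z => (a z, b z)) by [].
apply: DiffDef.
  by rewrite E; apply: differentiable_comp => //; exact: differentiable_bilin.
rewrite E diff_comp //; last exact: differentiable_bilin.
by rewrite diff_bilin // diff_pair.
Qed.
End Scale.

Lemma derive_scale V W (a : V -> R^o) (b : V -> W) x v : differentiable a x ->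
  differentiable b x ->
  'D_v (fun z => a z *: b z) x = a x *: 'D_v b x + 'D_v a x *: b x.
Proof.
move=> da db; have [D E] := is_diff_scale da db.
by rewrite !deriveE // E.
Qed.

Lemma Ck_on_scale V W k (U : set V) (a : V -> R^o) (b : V -> W) : open U ->
  Ck_on k U a -> Ck_on k U b -> Ck_on k U (fun x => a x *: b x).
Proof.
move=> oU; elim: k a b => [|k IH] a b.
  move=> ca cb x Ux; exact: (@cvgZ R^o _ _ _ _ _ _ _ _ (ca x Ux) (cb x Ux)).
move=> Ha Hb; have [[da Da] [db Db]] := (Ha, Hb); split => [x Ux|v].
  by have [] := is_diff_scale (da x Ux) (db x Ux).
apply: Ck_on_eq (Ck_onD oU (IH _ _ (Ck_onW Ha) (Db v))
   (IH _ _ (Da v) (Ck_onW Hb))) => // x Ux.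
by rewrite derive_scale //; [exact: da|exact: db].
Qed.

End Smoothness.

(** * Smooth maps between finite-dimensional spaces *)
Section Coordinates.
Context {R : realType}.
Implicit Types V W : normedModType R.

(** Finite dimension as a continuous coordinate system. The index is an
    arbitrary finite type, so that a product is indexed by a disjoint sum. *)
Definition finite_coords W := exists (I : finType) (e : I -> W)
  (l : I -> {linear W -> R^o}), (forall i, continuous (l i)) /\
  forall w, w = \sum_i l i w *: e i.

Definition row_coord n (i : 'I_n) (w : 'rV[R]_n) : R^o := w 0 i.

Lemma row_coord_linear n (i : 'I_n) : linear (row_coord i).
Proof. by move=> a u v; rewrite /row_coord !mxE. Qed.
HB.instance Definition _ n (i : 'I_n) :=
  GRing.isLinear.Build R 'rV[R]_n R^o _ (row_coord i) (row_coord_linear i).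

Lemma row_coord_continuous n (i : 'I_n) : continuous (row_coord i).
Proof. exact: coord_continuous. Qed.

Lemma finite_coords_rV n : finite_coords 'rV[R]_n.
Proof.
exists 'I_n, (fun i => delta_mx 0 i), (fun i => row_coord i : {linear _ -> _}).
by split; [exact: row_coord_continuous|move=> w; exact: row_sum_delta].
Qed.

Lemma finite_coords_R : finite_coords R^o.
Proof.
exists unit, (fun=> 1), (fun=> idfun); split => [_ x|w]; first exact: cvg_id.
by rewrite (big_pred1 tt) /= => [|[]//]; rewrite -[RHS]/(w * 1) mulr1.
Qed.

Lemma linear_finite_continuous V W (L : {linear V -> W}) : finite_coords V ->
  continuous L.
Proof.
move=> [I [b [l [cl le]]]].
have -> : (L : V -> W) = \sum_i (fun v => l i v *: L (b i)).
  apply/funext => v; rewrite {1}(le v) linear_sum fct_sumE.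
  by apply: eq_bigr => i _; rewrite linearZ.
elim/big_rec: _ => [v|i f _ cf v]; first exact: cst_continuous.
apply: (@continuousD _ _ _ (fun v => l i v *: L (b i)) f); last exact: cf.
by apply: cvgZr_tmp; exact: cl.
Qed.

Section Pairs.
Variables V W : normedModType R.

Definition inl_pair (v : V) : V * W := (v, 0).
Definition inr_pair (w : W) : V * W := (0, w).
Definition fst_pair (p : V * W) : V := p.1.
Definition snd_pair (p : V * W) : W := p.2.

Lemma inl_pair_linear : linear inl_pair.
Proof. by move=> a u v; rewrite /inl_pair /inr_pair; congr pair; rewrite /= scaler0 addr0. Qed.
Lemma inr_pair_linear : linear inr_pair.
Proof. by move=> a u v; rewrite /inl_pair /inr_pair; congr pair; rewrite /= scaler0 addr0. Qed.
Lemma fst_pair_linear : linear fst_pair. Proof. by []. Qed.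
Lemma snd_pair_linear : linear snd_pair. Proof. by []. Qed.
HB.instance Definition _ :=
  GRing.isLinear.Build R V (V * W)%type _ inl_pair inl_pair_linear.
HB.instance Definition _ :=
  GRing.isLinear.Build R W (V * W)%type _ inr_pair inr_pair_linear.
HB.instance Definition _ :=
  GRing.isLinear.Build R (V * W)%type V _ fst_pair fst_pair_linear.
HB.instance Definition _ :=
  GRing.isLinear.Build R (V * W)%type W _ snd_pair snd_pair_linear.

Lemma inl_pair_continuous : continuous inl_pair.
Proof. by move=> v; apply: cvg_pair; [exact: cvg_id|exact: cvg_cst]. Qed.
Lemma inr_pair_continuous : continuous inr_pair.
Proof. by move=> v; apply: cvg_pair; [exact: cvg_cst|exact: cvg_id]. Qed.
Lemma fst_pair_continuous : continuous fst_pair.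
Proof. by move=> v; exact: cvg_fst. Qed.
Lemma snd_pair_continuous : continuous snd_pair.
Proof. by move=> v; exact: cvg_snd. Qed.

Lemma finite_coords_prod : finite_coords V -> finite_coords W ->
  finite_coords (V * W)%type.
Proof.
move=> [I [e [l [cl le]]]] [J [e' [l' [cl' le']]]].
pose L (k : I + J) : {linear (V * W)%type -> R^o} := match k with
  | inl i => l i \o fst_pair | inr j => l' j \o snd_pair end.
exists (I + J)%type, (fun k => match k with
  | inl i => inl_pair (e i) | inr j => inr_pair (e' j) end), L; split.
- move=> [i|j] p; apply: continuous_comp;
    [exact: fst_pair_continuous|exact: cl|exact: snd_pair_continuous|exact: cl'].
- move=> [v w]; rewrite big_sumType /= .
  under eq_bigr do rewrite -linearZ.
  under [X in _ + X]eq_bigr do rewrite -linearZ.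
  rewrite -!linear_sum /= -le -le' /inl_pair /inr_pair.
  by congr pair; rewrite /= ?addr0 ?add0r.
Qed.

End Pairs.

End Coordinates.

Section Composition.
Context {R : realType}.
Implicit Types V W : normedModType R.

(** Coordinates on the middle space are needed because [Ck_on] controls a
    derivative only in fixed directions: the chain rule is used in the form
    D_v (f o g) = sum_i l_i (D_v g) * (D_(e_i) f o g), to which induction
    applies. *)
Lemma Ck_on_comp V W' W k (U : set V) (U' : set W') (g : V -> W') (f : W' -> W) :
  finite_coords W' -> open U -> (forall x, U x -> U' (g x)) ->
  Ck_on k U g -> Ck_on k U' f -> Ck_on k U (fun x => f (g x)).
Proof.
move=> [I [e [l [cl le]]]] oU UU'; elim: k g f UU' => [|k IH] g f UU'.
  move=> cg cf x Ux; apply: (@continuous_comp _ _ _ g f); first exact: cg.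
  by apply: cf; exact: UU'.
move=> Hg Hf; have [[dg Dg] [df Df]] := (Hg, Hf); split => [x Ux|v].
  apply: (@differentiable_comp _ _ _ _ g f); first exact: dg.
  by apply: df; exact: UU'.
have H : Ck_on k U (fun x => \sum_i l i ('D_v g x) *: 'D_(e i) f (g x)).
  apply: Ck_on_sum => // i; apply: Ck_on_scale => //.
    exact: (@Ck_on_lin _ _ _ _ _ _ (l i) _ oU (cl i) (Dg v)).
  by apply: IH (Ck_onW Hg) (Df (e i)).
apply: Ck_on_eq H => // x Ux.
have dgx := dg x Ux; have dfx := df _ (UU' x Ux).
rewrite (deriveE _ dgx) -[RHS]/('D_v (f \o g) x) deriveE; last first.
  exact: differentiable_comp.
rewrite (@diff_comp _ _ _ _ g f) //= [in RHS](le ('d g x v)) linear_sum /=.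
by apply: eq_bigr => i _; rewrite deriveE // linearZ.
Qed.

Lemma smooth_near_eq V W (f g : V -> W) x : {near x, f =1 g} ->
  smooth_near f x -> smooth_near g x.
Proof.
move=> fg [U [oU Ux] sf]; exists (U `&` [set y | f y = g y]°).
  by split; [apply: openI => //; exact: open_interior|split].
move=> k; have oI := openI oU (@open_interior _ [set y | f y = g y]).
apply: (Ck_on_eq oI (f := f)) => [y [_ /interior_subset]//|].
by apply: Ck_on_subset (sf k) => y [].
Qed.

Lemma smooth_near_near V W (f : V -> W) x : smooth_near f x ->
  \forall y \near x, smooth_near f y.
Proof.
move=> [U Ux sf]; apply: filterS (open_nbhs_nbhs Ux) => y Uy.
by exists U => //; split => //; case: Ux.
Qed.

Lemma smooth_near_diff V W (f : V -> W) x : smooth_near f x -> differentiable f x.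
Proof. by move=> [U [_ Ux] /(_ 1%N) [df _]]; exact: df. Qed.

Lemma smooth_near_continuous V W (f : V -> W) x : smooth_near f x ->
  f @ x --> f x.
Proof. by move=> /smooth_near_diff /differentiable_continuous. Qed.

Lemma smooth_near_derive V W (f : V -> W) x v : smooth_near f x ->
  smooth_near (fun y => 'D_v f y) x.
Proof. by move=> [U Ux sf]; exists U => // k; have [_] := sf k.+1; exact. Qed.

Lemma smooth_near_comp V W' W (g : V -> W') (f : W' -> W) x : finite_coords W' ->
  smooth_near g x -> smooth_near f (g x) -> smooth_near (fun y => f (g y)) x.
Proof.
move=> cW sg [U' [oU' U'x] sf]; have cg := smooth_near_continuous sg.
have [U [oU Ux] sgU] := sg.
have oI := openI oU (@open_interior _ (g @^-1` U')).
exists (U `&` (g @^-1` U')°).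
  by split => //; split => //; apply: cg; exact: open_nbhs_nbhs.
move=> k; apply: (Ck_on_comp cW oI (U' := U')) => //.
  by move=> y [_ /interior_subset].
by apply: Ck_on_subset (sgU k) => y [].
Qed.

Lemma smooth_near_cst V W (w : W) (x : V) : smooth_near (fun _ : V => w) x.
Proof. by exists setT; [split => //; exact: openT|move=> k; exact: Ck_on_cst]. Qed.

Lemma Ck_on_id V k (U : set V) : Ck_on k U (fun x => x).
Proof.
case: k => [|k]; first by move=> x _; exact: cvg_id.
split => [x _|v]; first exact: ex_diff.
have -> : (fun x : V => 'D_v (fun x : V => x) x) = (fun=> v).
  by apply/funext => x; exact: derive_id.
exact: Ck_on_cst.
Qed.

Lemma smooth_near_id V (x : V) : smooth_near (fun x : V => x) x.
Proof. by exists setT; [split => //; exact: openT|move=> k; exact: Ck_on_id]. Qed.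

Lemma smooth_near_lin V W W' (L : {linear W -> W'}) (f : V -> W) x :
  continuous L -> smooth_near f x -> smooth_near (fun y => L (f y)) x.
Proof.
move=> cL [U Ux sf]; exists U => // k.
by apply: (Ck_on_lin (L := L) (f := f)) => //; case: Ux.
Qed.

Lemma smooth_near2 V W1 W2 W (op : (V -> W1) -> (V -> W2) -> V -> W) f g x :
  (forall k U f g, open U -> Ck_on k U f -> Ck_on k U g -> Ck_on k U (op f g)) ->
  smooth_near f x -> smooth_near g x -> smooth_near (op f g) x.
Proof.
move=> H [U [oU Ux] sf] [U' [oU' U'x] sg]; exists (U `&` U').
  by split => //; exact: openI.
move=> k; apply: H; first exact: openI.
  by apply: Ck_on_subset (sf k) => y [].
by apply: Ck_on_subset (sg k) => y [].
Qed.

Lemma smooth_nearD V W (f g : V -> W) x :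
  smooth_near f x -> smooth_near g x -> smooth_near (fun y => f y + g y) x.
Proof.
move=> sf sg; apply: (@smooth_near2 _ _ _ _ (fun f g y => f y + g y)) sf sg.
by move=> *; exact: Ck_onD.
Qed.

Lemma smooth_near_scale V W (a : V -> R^o) (f : V -> W) x :
  smooth_near a x -> smooth_near f x -> smooth_near (fun y => a y *: f y) x.
Proof.
move=> sf sg; apply: (@smooth_near2 V R^o W W (fun a f y => a y *: f y)) sf sg.
by move=> *; exact: Ck_on_scale.
Qed.

Lemma smooth_near_sum V W (I : finType) (f : I -> V -> W) x :
  (forall i, smooth_near (f i) x) -> smooth_near (fun y => \sum_i f i y) x.
Proof.
move=> Hf; elim: (index_enum I) => [|i s IH].
  by under eq_fun do rewrite big_nil; exact: smooth_near_cst.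
by under eq_fun do rewrite big_cons; exact: smooth_nearD.
Qed.

Lemma smooth_near_pair V W1 W2 (f : V -> W1) (g : V -> W2) x :
  smooth_near f x -> smooth_near g x -> smooth_near (fun y => (f y, g y)) x.
Proof.
move=> sf sg.
have -> : (fun y => (f y, g y)) = (fun y => inl_pair W2 (f y) + inr_pair W1 (g y)).
  by apply/funext => y; congr pair; rewrite /= ?addr0 ?add0r.
apply: smooth_nearD; apply: smooth_near_lin => //.
  exact: inl_pair_continuous.
exact: inr_pair_continuous.
Qed.

Lemma smooth_near_row V n (f : 'I_n -> V -> R^o) x :
  (forall i, smooth_near (f i) x) -> smooth_near (fun y => \row_i f i y) x.
Proof.
move=> Hf.
have -> : (fun y => \row_i f i y) =
    (fun y => \sum_i f i y *: (delta_mx 0 i : 'rV[R]_n)).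
  apply/funext => y; rewrite [LHS]row_sum_delta.
  by apply: eq_bigr => i _; rewrite mxE.
apply: smooth_near_sum => i; apply: smooth_near_scale => //.
exact: smooth_near_cst.
Qed.

Lemma derive_comp V W' W (g : V -> W') (f : W' -> W) x v :
  differentiable g x -> differentiable f (g x) ->
  'D_v (fun y => f (g y)) x = 'D_('D_v g x) f (g x).
Proof.
move=> dg df; rewrite -[LHS]/('D_v (f \o g) x) deriveE; last exact: differentiable_comp.
by rewrite (@diff_comp _ _ _ _ g f) //= !deriveE.
Qed.

Lemma derive_lin V W W' (L : {linear W -> W'}) (f : V -> W) x v :
  continuous L -> differentiable f x ->
  'D_v (fun y => L (f y)) x = L ('D_v f x).
Proof.
move=> cL df; rewrite derive_comp //; last exact: linear_differentiable.
by rewrite deriveE; [rewrite diff_lin|exact: linear_differentiable].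
Qed.

Lemma derive_pair V W1 W2 (f : V -> W1) (g : V -> W2) x v :
  differentiable f x -> differentiable g x ->
  'D_v (fun y => (f y, g y)) x = ('D_v f x, 'D_v g x).
Proof.
move=> df dg; rewrite deriveE; last exact: differentiable_pair.
by rewrite diff_pair // !deriveE.
Qed.

End Composition.

(** * Mean values and the symmetry of second derivatives *)
Section MeanValue.
Context {R : realType}.
Implicit Types V W : normedModType R.

Lemma is_derive_line V W (f : V -> W) (x h : V) (s : R) :
  differentiable f (x + s *: h) ->
  is_derive s (1 : R) (fun s : R => f (x + s *: h)) ('D_h f (x + s *: h)).
Proof.
move=> df.
have da : is_diff s (fun s : R => x + s *: h) (fun a : R => a *: h).
  have H := is_diffD (is_diff_cst x s) (is_diff_scalel s h).
  apply: (is_diff_eq H); exact: add0r.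
have [D E] : is_diff s (f \o (fun s : R => x + s *: h))
    ('d f (x + s *: h) \o (fun a : R => a *: h)).
  have dfP := differentiableP df; exact: is_diff_comp.
split; first exact: diff_derivable.
by rewrite deriveE // E /= scale1r deriveE.
Qed.

Lemma mean_value_line V (f : V -> R^o) (x h : V) :
  (forall s : R, 0 <= s <= 1 -> differentiable f (x + s *: h)) ->
  exists2 s : R, 0 <= s <= 1 & f (x + h) - f x = 'D_h f (x + s *: h).
Proof.
move=> df.
pose g (s : R) : R := f (x + s *: h).
pose g' (s : R) : R := 'D_h f (x + s *: h).
have H (s : R) : s \in `[0, 1] -> is_derive s 1 g (g' s).
  by rewrite in_itv /= => s01; apply: is_derive_line; exact: df.
have H' (s : R) : s \in `]0, 1[ -> is_derive s 1 g (g' s).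
  by rewrite in_itv /= => /andP[a b]; apply: H; rewrite in_itv /= !ltW.
have cg : {within `[0, 1], continuous g}.
  by apply: derivable_within_continuous => s /H [].
have [s] := MVT ltr01 H' cg.
rewrite in_itv /= /g /g' scale1r scale0r addr0 subr0 mulr1 => /andP[s0 s1] E.
by exists s => //; rewrite !ltW.
Qed.

(** Continuity of the finitely many partial derivatives at [x] gives a bound
    uniform in the direction [h], by expanding [h] in coordinates. *)
Lemma derive_near_uniform V (f : V -> R^o) (x : V) : finite_coords V ->
  smooth_near f x -> forall e : R, 0 < e ->
  exists2 r : R, 0 < r & forall z, `|z - x| < r ->
    forall h, `|'D_h f z - 'D_h f x| <= e * `|h|.
Proof.
move=> [I [b [l [cl le]]]] sf e e0.
have lip i : exists2 k : R, 0 < k & forall h, `|l i h| <= k * `|h|.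
  exact: linear_lipschitz.
pose K i := projT1 (cid2 (lip i)).
have K0 i : 0 < K i by rewrite /K; case: cid2.
have KP i h : `|l i h| <= K i * `|h| by rewrite /K; case: cid2.
pose S := \sum_i K i.
have S0 : 0 <= S by apply: sumr_ge0 => i _; exact: ltW.
pose eta := e / (S + 1).
have eta0 : 0 < eta by rewrite divr_gt0 // ltr_wpDl.
have near_i : \forall z \near x, smooth_near f z /\
    forall i, `|'D_(b i) f z - 'D_(b i) f x| <= eta.
  near=> z; split; first by near: z; exact: smooth_near_near.
  near: z; apply: filter_forall => i.
  have := smooth_near_continuous (smooth_near_derive (b i) sf).
  by move/cvgr_distC_le; exact.
move/nbhs_normP: near_i => [r r0 rP]; exists r => // z zx h.
have [sz Hz] : smooth_near f z /\ forall i, `|'D_(b i) f z - 'D_(b i) f x| <= eta.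
  by apply: rP; rewrite /= distrC.
have dE y : smooth_near f y -> 'D_h f y = \sum_i l i h * 'D_(b i) f y.
  move=> sy; have dy := smooth_near_diff sy.
  rewrite deriveE // [in LHS](le h) linear_sum; apply: eq_bigr => i _.
  by rewrite linearZ deriveE.
rewrite !dE // -sumrB.
apply: le_trans (ler_norm_sum _ _ _) _.
apply: (@le_trans _ _ (\sum_i (K i * `|h|) * eta)).
  apply: ler_sum => i _; rewrite -mulrBr normrM; apply: ler_pM => //.
rewrite -mulr_suml -mulr_suml -/S /eta.
rewrite [S * _]mulrC -mulrA mulrC; apply: ler_wpM2r => //.
by rewrite mulrCA ler_piMr ?(ltW e0) // ler_pdivrMr ?mul1r ?lerDl // ltr_wpDl.
Unshelve. all: by end_near. Qed.

(** The base point and the increment vary independently; this uniformity, from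
    the mean value theorem on the segment [y, y + h], is what differentiation
    under the integral sign and the compactness argument on the quotient
    need. *)
Lemma strictly_differentiable V (f : V -> R^o) (x : V) : finite_coords V ->
  smooth_near f x -> forall e : R, 0 < e ->
  exists2 r : R, 0 < r & forall y h, `|y - x| < r -> `|h| < r ->
    `|f (y + h) - f y - 'D_h f y| <= e * `|h|.
Proof.
move=> cV sf e e0; have e20 : 0 < e / 2 by rewrite divr_gt0.
have [r r0 rP] := derive_near_uniform cV sf e20.
move/nbhs_normP: (smooth_near_near sf) => [r' r'0 r'P].
pose d := Num.min r r' / 2; have m0 : 0 < Num.min r r' by rewrite lt_min r0 r'0.
exists d; first by rewrite divr_gt0.
move=> y h yx hd.
have seg (s : R) : 0 <= s <= 1 -> `|y + s *: h - x| < Num.min r r'.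
  move=> /andP[s0 s1]; rewrite addrAC; apply: le_lt_trans (ler_normD _ _) _.
  rewrite [ltRHS]splitr; apply: ltrD => //; apply: le_lt_trans hd.
  by rewrite normrZ ger0_norm // ler_piMl.
have [s s01 ->] : exists2 s : R, 0 <= s <= 1 & f (y + h) - f y = 'D_h f (y + s *: h).
  apply: mean_value_line => s /seg; rewrite lt_min => /andP[_ H].
  by apply: smooth_near_diff; apply: r'P; rewrite /= distrC.
have -> : 'D_h f (y + s *: h) - 'D_h f y =
   ('D_h f (y + s *: h) - 'D_h f x) - ('D_h f y - 'D_h f x) by ring.
apply: le_trans (ler_normB _ _) _; rewrite [in leRHS](splitr e) mulrDl.
apply: lerD; apply: rP; first by have := seg s s01; rewrite lt_min => /andP[].
have := seg 0; rewrite scale0r addr0 lexx ler01 => /(_ isT).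
by rewrite lt_min => /andP[].
Qed.

Lemma derive_scale_dir V W (f : V -> W) (x : V) (t : R) v : differentiable f x ->
  'D_(t *: v) f x = t *: 'D_v f x.
Proof. by move=> df; rewrite !deriveE // linearZ. Qed.

(** The left-hand second difference is symmetric in [u] and [v], while two
    applications of the mean value theorem, first along [v] and then along [u],
    compare it with D_u D_v f; hence the two mixed derivatives agree. *)
Lemma second_difference V (f : V -> R^o) (x u v : V) : smooth_near f x ->
  forall e : R, 0 < e -> exists2 d : R, 0 < d & forall t, 0 < t -> t < d ->
   `|f (x + (t *: u + t *: v)) - f (x + t *: u) - f (x + t *: v) + f x
     - t ^+ 2 * 'D_u (fun y => 'D_v f y) x| <= e * t ^+ 2.
Proof.
move=> sf e e0.
have H : \forall y \near x, smooth_near f y /\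
   `|'D_u (fun y => 'D_v f y) y - 'D_u (fun y => 'D_v f y) x| <= e.
  near=> y; split; first by near: y; exact: smooth_near_near.
  near: y; have := smooth_near_continuous (smooth_near_derive u (smooth_near_derive v sf)).
  by move/cvgr_distC_le; exact.
move/nbhs_normP: H => [r r0 rP].
pose N := `|u| + `|v| + 1; have N0 : 0 < N by rewrite ltr_wpDl // addr_ge0.
exists (r / N); first by rewrite divr_gt0.
move=> t t0; rewrite ltr_pdivlMr // => tN.
have inr (a b : R) : 0 <= a <= 1 -> 0 <= b <= 1 ->
    `|x - (x + (a * t) *: u + (b * t) *: v)| < r.
  move=> /andP[a0 a1] /andP[b0 b1].
  rewrite -addrA opprD addrA subrr add0r normrN; apply: le_lt_trans (ler_normD _ _) _.
  apply: le_lt_trans tN; rewrite !normrZ (ger0_norm a0) (ger0_norm b0).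
  rewrite (gtr0_norm t0) /N !mulrDr mulr1 -!mulrA.
  apply: (@le_trans _ _ (t * `|u| + t * `|v|)); last by rewrite lerDl ltW.
  by apply: lerD; rewrite ler_piMl // mulr_ge0 // ltW.
have sm (a b : R) : 0 <= a <= 1 -> 0 <= b <= 1 ->
    smooth_near f (x + (a * t) *: u + (b * t) *: v).
  by move=> ha hb; have [] := rP _ (inr a b ha hb).
have I0 : 0 <= (0 : R) <= 1 by rewrite lexx ler01.
have I1 : 0 <= (1 : R) <= 1 by rewrite lexx ler01.
(* the second difference is the increment of g along t *: v *)
pose g (y : V) : R^o := f (y + t *: u) - f y.
have dg (s : R) : 0 <= s <= 1 -> is_diff (x + s *: (t *: v)) g
    (fun h => 'd f (x + s *: (t *: v) + t *: u) h - 'd f (x + s *: (t *: v)) h).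
  move=> hs.
  have s1 : differentiable f (x + s *: (t *: v) + t *: u).
    have := sm 1 s I1 hs; rewrite mul1r scalerA addrAC; exact: smooth_near_diff.
  have s0 : differentiable f (x + s *: (t *: v)).
    have := sm 0 s I0 hs; rewrite mul0r scale0r addr0 scalerA; exact: smooth_near_diff.
  apply: is_diffB; last exact: differentiableP.
  have Hs : is_diff (x + s *: (t *: v)) (fun y => y + t *: u) (fun h => h).
    have H := is_diffD (is_diff_id (x + s *: (t *: v)))
      (is_diff_cst (t *: u) (x + s *: (t *: v))).
    apply: (is_diff_eq H); exact: addr0.
  have Hf := differentiableP s1.
  exact: (@is_diff_comp _ _ _ _ _ _ _ _ _ Hs Hf).
have [s s01 E1] : exists2 s : R, 0 <= s <= 1 &
    g (x + t *: v) - g x = 'D_(t *: v) g (x + s *: (t *: v)).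
  by apply: (@mean_value_line _ g) => s /dg [].
have [a a01 E2] : exists2 a : R, 0 <= a <= 1 &
   'D_v f (x + s *: (t *: v) + t *: u) - 'D_v f (x + s *: (t *: v)) =
   'D_(t *: u) (fun y => 'D_v f y) (x + s *: (t *: v) + a *: (t *: u)).
  apply: (@mean_value_line _ (fun y => 'D_v f y : R^o)) => a ha.
  apply: smooth_near_diff; apply: smooth_near_derive.
  by rewrite !scalerA addrAC; exact: sm.
have -> : f (x + (t *: u + t *: v)) - f (x + t *: u) - f (x + t *: v) + f x =
    g (x + t *: v) - g x.
  by rewrite /g addrA [x + t *: u + _]addrAC; ring.
rewrite E1; have [dgs dgE] := dg s s01.
rewrite derive_scale_dir // deriveE // dgE -!deriveE; last 2 first.
- have := sm 0 s I0 s01; rewrite mul0r scale0r addr0 scalerA; exact: smooth_near_diff.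
- have := sm 1 s I1 s01; rewrite mul1r scalerA addrAC; exact: smooth_near_diff.
rewrite E2.
have sma := sm a s a01 s01.
rewrite scalerA [in a *: _]scalerA addrAC.
rewrite derive_scale_dir; last by apply: smooth_near_diff; exact: smooth_near_derive.
rewrite scalerA -expr2 -[_ *: _]/(t ^+ 2 * _) -mulrBr normrM.
rewrite ger0_norm ?exprn_ge0 ?(ltW t0) // mulrC ler_wpM2r ?exprn_ge0 ?(ltW t0) //.
by have [] := rP _ (inr a s a01 s01).
Unshelve. all: by end_near. Qed.

Lemma schwarz_real V (f : V -> R^o) (x u v : V) : smooth_near f x ->
  'D_u (fun y => 'D_v f y) x = 'D_v (fun y => 'D_u f y) x.
Proof.
move=> sf; apply/eqP; rewrite -subr_eq0 -normr_le0; apply/ler_addgt0Pl => e e0.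
rewrite addr0; have e20 : 0 < e / 2 by rewrite divr_gt0.
have [d d0 dP] := second_difference u v sf e20.
have [d' d'0 d'P] := second_difference v u sf e20.
pose t := Num.min d d' / 2.
have m0 : 0 < Num.min d d' by rewrite lt_min d0 d'0.
have t0 : 0 < t by rewrite divr_gt0.
have : t < Num.min d d' by rewrite ltr_pdivrMr // mulr_natr mulr2n ltrDl.
rewrite lt_min => /andP[/(dP t t0) H /(d'P t t0)].
rewrite [t *: v + _]addrC [f _ - f _ - f _]addrAC => H'.
have t20 : 0 < t ^+ 2 by rewrite exprn_gt0.
set D1 : R := 'D_u _ x in H *; set D2 : R := 'D_v _ x in H' *.
set D : R := f _ - _ - _ + _ in H H'.
rewrite -(ler_pM2r t20).
have -> : `|D1 - D2| * t ^+ 2 = `|(D - t ^+ 2 * D2) - (D - t ^+ 2 * D1)|.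
  rewrite -{1}(gtr0_norm t20) -normrM; congr `|_|; ring.
apply: le_trans (ler_normB _ _) _.
move: H H'; move: D1 D2 D => D1 D2 D H H'.
have -> : e * t ^+ 2 = e / 2 * t ^+ 2 + e / 2 * t ^+ 2 by rewrite -mulrDl -splitr.
by apply: lerD; [exact: H'|exact: H].
Qed.

Lemma schwarz V W (f : V -> W) (x u v : V) : finite_coords W -> smooth_near f x ->
  'D_u (fun y => 'D_v f y) x = 'D_v (fun y => 'D_u f y) x.
Proof.
move=> [I [b [l [cl le]]]] sf.
rewrite [LHS]le [RHS]le; apply: eq_bigr => i _; congr (_ *: _).
have E a c : l i ('D_a (fun y => 'D_c f y) x) = 'D_a (fun y => 'D_c (fun y => l i (f y)) y) x.
  rewrite -derive_lin //; last by apply/smooth_near_diff/smooth_near_derive.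
  apply: near_eq_derive; near=> y; rewrite derive_lin //.
  by apply: smooth_near_diff; near: y; exact: smooth_near_near.
rewrite !E schwarz_real //; exact: smooth_near_lin.
Unshelve. all: by end_near. Qed.

Lemma constant_on_ball V (f : V -> R^o) (x : V) (r : R) :
  (forall y, `|y - x| < r -> differentiable f y /\ forall h, 'D_h f y = 0) ->
  forall y, `|y - x| < r -> f y = f x.
Proof.
move=> H y yx; apply/eqP; rewrite -subr_eq0 -[y](subrKC x).
have seg (s : R) : 0 <= s <= 1 -> `|x + s *: (y - x) - x| < r.
  move=> /andP[s0 s1]; rewrite addrAC subrr add0r normrZ ger0_norm //.
  by apply: le_lt_trans yx; rewrite ler_piMl.
have [s /seg /H [_ ->] ->] // : exists2 s : R, 0 <= s <= 1 &
    f (x + (y - x)) - f x = 'D_(y - x) f (x + s *: (y - x)).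
by apply: mean_value_line => s /seg /H[].
Qed.

End MeanValue.

(** * Integration over the unit interval *)
Section UnitIntegral.
Context {R : realType}.
Implicit Types f g : R -> R.

(** Continuity is required at every point of [0, 1] as a point of the line: the
    integrands below are continuous on a neighbourhood of the interval. *)
Definition cont01 f := forall t : R, 0 <= t <= 1 -> {for t, continuous f}.
Definition int01 f : R := \int[lebesgue_measure]_(t in `[0, 1]) f t.

Lemma cont01_within f : cont01 f -> {within `[0, 1], continuous f}.
Proof.
move=> cf; apply: continuous_in_subspaceT => t.
by rewrite inE /= in_itv /=; exact: cf.
Qed.

Lemma cont01_integrable f : cont01 f ->
  lebesgue_measure.-integrable `[0, 1] (EFin \o f).
Proof.
move=> cf; apply: continuous_compact_integrable; first exact: segment_compact.
exact: cont01_within.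
Qed.

Lemma int01_lin f g (a : R) : cont01 f -> cont01 g ->
  int01 (fun t => a * f t + g t) = a * int01 f + int01 g.
Proof.
move=> cf cg; have If := cont01_integrable cf; have Ig := cont01_integrable cg.
have caf : cont01 (fun t => a * f t).
  by move=> t t01; apply: (@cvgM R); [exact: cvg_cst|exact: cf].
rewrite /int01 RintegralD //; first by rewrite RintegralZl.
exact: cont01_integrable.
Qed.

Lemma int01_eq f g : (forall t, 0 <= t <= 1 -> f t = g t) -> int01 f = int01 g.
Proof. by move=> fg; apply: eq_Rintegral => t; rewrite inE /= in_itv /=; exact: fg. Qed.

Lemma int01_bound f (M : R) : cont01 f -> (forall t, 0 <= t <= 1 -> `|f t| <= M) ->
  `|int01 f| <= M.
Proof.
move=> cf fM; apply: le_trans (le_normr_Rintegral _ _) _ => //.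
  exact: cont01_integrable.
have cnf : cont01 (fun t => `|f t|).
  move=> t /cf ct; apply: (@continuous_comp _ _ _ f (fun y => `|y|)) => //.
  exact: norm_continuous.
have cM : cont01 (fun=> M) by move=> t _; exact: cst_continuous.
apply: (@le_trans _ _ (\int[lebesgue_measure]_(t in `[0, 1]) (cst M t))).
  apply: le_Rintegral.
  - exact: measurable_itv.
  - exact: cont01_integrable.
  - exact: cont01_integrable.
  - by move=> t /=; rewrite in_itv /=; exact: fM.
rewrite Rintegral_cst /=; last exact: measurable_itv.
by rewrite lebesgue_measure_itv /= lte_fin ltr01 -EFinB /= subr0 mulr1.
Qed.

Lemma int01_ftc f f' : cont01 f' -> (forall t : R, 0 <= t <= 1 -> is_derive t 1 f (f' t)) ->
  int01 f' = f 1 - f 0.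
Proof.
move=> cf' df.
have cf (t : R) : 0 <= t <= 1 -> f @ t --> f t.
  move=> /df [H _]; have : differentiable f t by apply/derivable1_diffP.
  exact: differentiable_continuous.
rewrite /int01 /Rintegral (@continuous_FTC2 _ f' f 0 1) //.
- exact: cont01_within.
- split.
  + by move=> t; rewrite in_itv /= => /andP[a b]; have [] := df t; rewrite ?ltW.
  + by apply: cvg_at_right_filter; apply: cf; rewrite lexx ler01.
  + by apply: cvg_at_left_filter; apply: cf; rewrite lexx ler01.
- move=> t; rewrite in_itv /= => /andP[a b]; rewrite derive1E.
  by have [] := df t; rewrite ?ltW.
Qed.

End UnitIntegral.

(** * Hadamard's lemma *)
Section Hadamard.
Context {R : realType} {V : normedModType R} (coordsV : finite_coords V).
Variables (x0 : V) (r : R).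

Definition smooth_on_ball (F : V -> R^o) :=
  forall z, `|z - x0| < r -> smooth_near F z.

Definition ray (x : V) (t : R) : V := x0 + t *: (x - x0).

Lemma ray_in_ball x t : `|x - x0| < r -> 0 <= t <= 1 -> `|ray x t - x0| < r.
Proof.
move=> xr /andP[t0 t1]; rewrite /ray addrAC subrr add0r normrZ ger0_norm //.
by apply: le_lt_trans xr; rewrite ler_piMl.
Qed.

Lemma ray_continuous x : continuous (ray x).
Proof.
move=> t; apply: cvgD; first exact: cvg_cst.
by apply: cvgZr_tmp; exact: cvg_id.
Qed.

(** The factor t ^ k makes the family stable: differentiating
    t ^ k * F (x0 + t (x - x0)) in the variable x brings out a factor t, so the
    derivative of a moment of [F] is the next moment of a derivative of [F]. *)
Definition ray_moment (k : nat) (F : V -> R^o) (x : V) : R^o :=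
  int01 (fun t => t ^+ k * F (ray x t)).

Lemma ray_moment_cont k F x : smooth_on_ball F -> `|x - x0| < r ->
  cont01 (fun t => t ^+ k * F (ray x t)).
Proof.
move=> sF xr t t01; apply: (@cvgM R); first exact: exprn_continuous.
apply: (@continuous_comp _ _ _ (ray x) F); first exact: ray_continuous.
by apply: smooth_near_continuous; apply: sF; exact: ray_in_ball.
Qed.

Lemma smooth_on_ball_derive F v : smooth_on_ball F -> smooth_on_ball (fun y => 'D_v F y).
Proof. by move=> sF z /sF; exact: smooth_near_derive. Qed.

Lemma ray_moment_lin k F x : smooth_on_ball F -> `|x - x0| < r ->
  linear (fun v => ray_moment k (fun y => 'D_v F y) x).
Proof.
move=> sF xr a u v; rewrite /ray_moment.
rewrite -[a *: int01 _]/(a * int01 _) -int01_lin; last 2 first.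
- exact: (@ray_moment_cont k _ _ (smooth_on_ball_derive u sF) xr).
- exact: (@ray_moment_cont k _ _ (smooth_on_ball_derive v sF) xr).
apply: int01_eq => t t01.
have dF := smooth_near_diff (sF _ (ray_in_ball xr t01)).
by rewrite !deriveE // linearP /= [LHS]mulrDr mulrCA.
Qed.

(** Strict differentiability at each point of the compact segment from [x0] to
    [x], made uniform in the parameter [t] by compactness. *)
Lemma ray_uniform F x : smooth_on_ball F -> `|x - x0| < r ->
  forall e : R, 0 < e -> \forall h \near (0 : V), forall t : R, 0 <= t <= 1 ->
    `|F (ray (x + h) t) - F (ray x t) - t * 'D_h F (ray x t)| <= e * `|h|.
Proof.
move=> sF xr e e0.
have /compact_near_coveringP C := @segment_compact R 0 1.
have := C V (nbhs (0 : V)) (fun h t =>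
    `|F (ray (x + h) t) - F (ray x t) - t * 'D_h F (ray x t)| <= e * `|h|) _ _.
move=> H; apply: filterS (H _ _).
- by move=> h Hh t t01; apply: Hh; rewrite /= in_itv.
move=> s /=; rewrite in_itv /= => s01.
have e20 : 0 < e / 2 by rewrite divr_gt0.
have sFs := sF _ (ray_in_ball xr s01).
have [d d0 dP] := strictly_differentiable coordsV sFs e20.
have N : \forall t \near s, [/\ `|ray x t - ray x s| < d, `|t| <= 2 &
    smooth_near F (ray x t)].
  near=> t; split.
  - by near: t; have := @ray_continuous x s; move/cvgr_distC_lt; exact.
  - have : `|t - s| < 1 by near: t; exact: cvgr_distC_lt.
    move=> ts; have -> : t = (t - s) + s by ring.
    apply: le_trans (ler_normD _ _) _; rewrite -[2]/(1 + 1 : R).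
    by apply: lerD; [exact: ltW|rewrite ger0_norm; case/andP: s01].
  - by near: t; exact: (@ray_continuous x s _ (smooth_near_near sFs)).
have M : \forall h \near (0 : V), `|h| < d / 2.
  by apply: nbhs0_lt; rewrite divr_gt0.
exists ([set t : R | [/\ `|ray x t - ray x s| < d, `|t| <= 2 &
    smooth_near F (ray x t)]],
        [set h : V | `|h| < d / 2]) => // -[t h] /= [[td t2 st] hd].
have th2 : `|t *: h| <= 2 * `|h| by rewrite normrZ ler_wpM2r.
have th : `|t *: h| < d.
  by apply: le_lt_trans th2 _; rewrite mulrC -ltr_pdivlMr.
have := dP _ _ td th; rewrite (derive_scale_dir _ _ (smooth_near_diff st)).
have -> : ray x t + t *: h = ray (x + h) t.
  by rewrite /ray -addrA -scalerDr addrAC.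
move=> /le_trans; apply; apply: le_trans (ler_wpM2l (ltW e20) th2) _.
by rewrite mulrA divfK.
Unshelve. all: by end_near. Qed.

Lemma ray_moment_derive k F x : smooth_on_ball F -> `|x - x0| < r ->
  differentiable (ray_moment k F) x /\
  forall v, 'D_v (ray_moment k F) x = ray_moment k.+1 (fun y => 'D_v F y) x.
Proof.
move=> sF xr.
pose L v := ray_moment k.+1 (fun y => 'D_v F y) x.
have linL : linear L := @ray_moment_lin k.+1 F x sF xr.
pose LM := GRing.isLinear.Build R V R^o _ L linL.
pose L' : {linear V -> R^o} := HB.pack L LM.
have cL : continuous L' := linear_finite_continuous coordsV.
suff H : is_diff x (ray_moment k F) L'.
  have [D E] := H; split => // v; by rewrite deriveE // E.
apply: is_diff_eps => // e e0.
have nb : \forall h \near (0 : V), `|x + h - x0| < r.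
  have : (fun h : V => x + h - x0) @ (0 : V) --> x - x0.
    rewrite -[X in _ --> X - _]addr0; apply: cvgB; last exact: cvg_cst.
    by apply: cvgD; [exact: cvg_cst|exact: cvg_id].
  by move/cvgr_norm_lt; exact.
near=> h.
have hr : `|x + h - x0| < r by near: h.
have U : forall t : R, 0 <= t <= 1 ->
    `|F (ray (x + h) t) - F (ray x t) - t * 'D_h F (ray x t)| <= e * `|h|.
  by near: h; exact: ray_uniform.
have c1 := @ray_moment_cont k F _ sF hr.
have c2 := @ray_moment_cont k F _ sF xr.
have c3 := @ray_moment_cont k.+1 _ _ (smooth_on_ball_derive h sF) xr.
rewrite [h + x]addrC -[L' h]/(L h) /L /ray_moment.
have c12 : cont01 (fun t => -1 * (t ^+ k * F (ray x t)) + t ^+ k * F (ray (x + h) t)).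
  by move=> t t01; apply: (@cvgD R); [apply: (@cvgM R); [exact: cvg_cst|exact: c2]|exact: c1].
have -> : int01 (fun t => t ^+ k * F (ray (x + h) t)) - int01 (fun t => t ^+ k * F (ray x t))
   - int01 (fun t => t ^+ k.+1 * 'D_h F (ray x t)) =
   int01 (fun t => -1 * (t ^+ k.+1 * 'D_h F (ray x t)) +
     (-1 * (t ^+ k * F (ray x t)) + t ^+ k * F (ray (x + h) t))).
  by rewrite !int01_lin //; ring.
apply: int01_bound.
  by move=> t t01; apply: (@cvgD R); [apply: (@cvgM R); [exact: cvg_cst|exact: c3]|exact: c12].
move=> t t01.
have -> : -1 * (t ^+ k.+1 * 'D_h F (ray x t)) +
     (-1 * (t ^+ k * F (ray x t)) + t ^+ k * F (ray (x + h) t)) =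
  t ^+ k * (F (ray (x + h) t) - F (ray x t) - t * 'D_h F (ray x t)).
  by rewrite exprS; ring.
have /andP[t0 t1] := t01.
rewrite normrM ger0_norm ?exprn_ge0 //; apply: le_trans (U t t01).
by rewrite ler_piMl // exprn_ile1.
Unshelve. all: by end_near. Qed.

Lemma open_norm_ball : open [set z : V | `|z - x0| < r].
Proof.
have -> : [set z : V | `|z - x0| < r] = (fun z => `|z - x0|) @^-1` [set y | y < r] by [].
apply: open_comp; last exact: open_lt.
move=> z _; apply: (@continuous_comp _ _ _ (fun z => z - x0) (fun z => `|z|)).
  by apply: cvgB; [exact: cvg_id|exact: cvg_cst].
exact: norm_continuous.
Qed.

(** Induction on the order, for all moments and all [F] at once. *)
Lemma ray_moment_smooth k F : smooth_on_ball F ->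
  forall j, Ck_on j [set z | `|z - x0| < r] (ray_moment k F).
Proof.
move=> sF j; have oB := open_norm_ball.
elim: j k F sF => [|j IH] k F sF.
  by move=> x xr; apply: differentiable_continuous; have [] := ray_moment_derive k sF xr.
split => [x xr|v]; first by have [] := ray_moment_derive k sF xr.
apply: Ck_on_eq (IH k.+1 _ (smooth_on_ball_derive v sF)) => // x xr.
by have [_ ->] := ray_moment_derive k sF xr.
Qed.

Lemma ray_moment_ftc F x : smooth_on_ball F -> `|x - x0| < r ->
  F x - F x0 = ray_moment 0 (fun y => 'D_(x - x0) F y) x.
Proof.
move=> sF xr; rewrite /ray_moment.
have c : cont01 (fun t => t ^+ 0 * 'D_(x - x0) F (ray x t)) :=
  @ray_moment_cont 0 _ _ (smooth_on_ball_derive (x - x0) sF) xr.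
have d (t : R) : 0 <= t <= 1 -> is_derive t 1 (fun t => F (ray x t) : R)
    (t ^+ 0 * 'D_(x - x0) F (ray x t)).
  move=> t01; rewrite expr0 mul1r; apply: is_derive_line.
  by apply: smooth_near_diff; apply: sF; exact: ray_in_ball.
rewrite (int01_ftc c d).
by rewrite /ray scale1r scale0r addr0 [x0 + _]addrC subrK.
Qed.

End Hadamard.

(** F x - F x0 is the integral of the derivative of [F] along the segment from
    [x0] to [x], and g i is the integral of the i-th partial derivative. This is
    the step where C^infinity is essential: it forces every derivation of germs
    to be a directional derivative. *)
Lemma hadamard (R : realType) n (F : 'rV[R]_n -> R^o) (x0 : 'rV[R]_n) :
  smooth_near F x0 ->
  exists2 g : 'I_n -> 'rV[R]_n -> R^o, forall i, smooth_near (g i) x0 &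
    \forall x \near x0, F x = F x0 + \sum_i (x 0 i - x0 0 i) * g i x.
Proof.
move=> sF; have /nbhs_normP[r /= r0 rP] := smooth_near_near sF.
have sB : smooth_on_ball x0 r F by move=> z zr; apply: rP; rewrite /= distrC.
have cV := finite_coords_rV (R := R) n.
pose g (i : 'I_n) := ray_moment x0 0 (fun y => 'D_(delta_mx 0 i) F y).
exists g => [i|].
  exists [set z | `|z - x0| < r].
    split; last by rewrite /= subrr normr0.
    exact: open_norm_ball.
  by move=> k; exact: (ray_moment_smooth cV 0 (smooth_on_ball_derive (delta_mx 0 i) sB) k).
have nx : \forall x \near x0, `|x - x0| < r.
  by apply/nbhs_normP; exists r => // x; rewrite /= distrC.
near=> x; have xr : `|x - x0| < r by near: x.
apply/eqP; rewrite addrC -subr_eq; apply/eqP.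
rewrite (ray_moment_ftc sB xr).
pose LM := GRing.isLinear.Build R _ R^o _ _ (@ray_moment_lin _ _ x0 r 0 F x sB xr).
pose L : {linear 'rV[R]_n -> R^o} := HB.pack (fun v => ray_moment x0 0 (fun y => 'D_v F y) x) LM.
rewrite -[LHS]/(L (x - x0)) (row_sum_delta (x - x0)) linear_sum.
by apply: eq_bigr => i _; rewrite linearZ /= !mxE.
Unshelve. all: by end_near. Qed.

(** * Smooth maps into a Lie group *)
Section GroupValuedMaps.
Context {R : realType} {n : nat} {G : lieGroupType R n}.
Local Notation E := 'rV[R]_n.
Implicit Types (V W : normedModType R) (p q : G) (d : chart R n G).

Lemma mulg_cvg (T : Type) (F : set_system T) (FF : Filter F) (f g : T -> G) p q :
  f @ F --> p -> g @ F --> q -> (fun t => f t * g t)%g @ F --> (p * q)%g.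
Proof.
move=> fp gq.
have := @cvg_comp _ _ _ (fun t => (f t, g t)) (fun pq : G * G => (pq.1 * pq.2)%g)
  F _ _ (cvg_pair fp gq) (@lie_mul_cts R n G (p, q)).
exact.
Qed.

Lemma invg_cvg (T : Type) (F : set_system T) (FF : Filter F) (f : T -> G) p :
  f @ F --> p -> (fun t => (f t)^-1)%g @ F --> (p^-1)%g.
Proof. by move=> fp; apply: (cvg_comp _ _ fp); exact: lie_inv_cts. Qed.

Lemma chart_dom_near d p : chart_dom d p -> \forall q \near p, chart_dom d q.
Proof. by move=> dp; exact: open_nbhs_nbhs (conj (open_chart_dom d) dp). Qed.

Lemma chart_invK_near d p : chart_dom d p ->
  \forall y \near d p, chart_dom d (chart_inv d y) /\ d (chart_inv d y) = y.
Proof.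
move=> dp; have H : nbhs (d p) (d @` chart_dom d).
  by apply: open_nbhs_nbhs; split; [exact: open_chart_img|exists p].
by apply: filterS H => y [q dq <-]; rewrite chart_mapK.
Qed.

Lemma chart_inv_cvg d p : chart_dom d p -> chart_inv d y @[y --> d p] --> p.
Proof. by move=> dp; have := chart_inv_cts dp; rewrite /prop_for /continuous_at chart_mapK. Qed.

Lemma chart_map_cvg d p : chart_dom d p -> d q @[q --> p] --> d p.
Proof. by move=> dp; exact: chart_map_cts. Qed.

(** Continuity is asked for separately, because a chart is a total function
    whose values outside its domain are arbitrary. *)
Definition smooth_map V (F : V -> G) (x : V) : Prop :=
  F y @[y --> x] --> F x /\
  forall d, atlas d -> chart_dom d (F x) -> smooth_near (fun y => d (F y)) x.

Lemma smooth_map_cst V p (x : V) : smooth_map (fun=> p) x.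
Proof. by split=> [|d _ _]; [exact: cvg_cst|exact: smooth_near_cst]. Qed.

Lemma smooth_map_comp V W (g : V -> W) (F : W -> G) x : finite_coords W ->
  smooth_near g x -> smooth_map F (g x) -> smooth_map (fun y => F (g y)) x.
Proof.
move=> cW sg [cF sF]; split.
  exact: (cvg_comp _ _ (smooth_near_continuous sg) cF).
move=> d ad dF; apply: (smooth_near_comp cW sg (f := fun y => d (F y))).
exact: sF.
Qed.

Lemma smooth_map_chart_inv d p : atlas d -> chart_dom d p ->
  smooth_map (chart_inv d) (d p).
Proof.
move=> ad dp; split; first by rewrite chart_mapK //; exact: chart_inv_cvg.
move=> d' ad'; rewrite chart_mapK // => dp'; exact: atlas_compat.
Qed.

Lemma smooth_map_mul V (F H : V -> G) x : smooth_map F x -> smooth_map H x ->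
  smooth_map (fun y => F y * H y)%g x.
Proof.
move=> [cF sF] [cH sH]; split; first exact: mulg_cvg.
move=> d ad dFH.
have [d1 ad1 d1F] := atlas_cover (F x).
have [d2 ad2 d2H] := atlas_cover (H x).
have sm := lie_mul_smooth _ _ _ _ _ ad1 ad2 ad d1F d2H dFH.
have sp := smooth_near_pair (sF _ ad1 d1F) (sH _ ad2 d2H).
have cEE := finite_coords_prod (finite_coords_rV (R := R) n) (finite_coords_rV (R := R) n).
apply: smooth_near_eq (smooth_near_comp cEE sp sm).
have N1 := cF _ (chart_dom_near d1F); have N2 := cH _ (chart_dom_near d2H).
near=> y => /=; rewrite !chart_mapK //; first by near: y; exact: N2.
by near: y; exact: N1.
Unshelve. all: by end_near. Qed.

Lemma smooth_map_inv V (F : V -> G) x : smooth_map F x ->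
  smooth_map (fun y => (F y)^-1)%g x.
Proof.
move=> [cF sF]; split; first exact: invg_cvg.
move=> d ad dF; have [d1 ad1 d1F] := atlas_cover (F x).
have sm := lie_inv_smooth _ _ _ ad1 ad d1F dF.
have cE := finite_coords_rV (R := R) n.
apply: smooth_near_eq (smooth_near_comp cE (sF _ ad1 d1F) sm).
have N1 := cF _ (chart_dom_near d1F).
by near=> y => /=; rewrite !chart_mapK //; near: y; exact: N1.
Unshelve. all: by end_near. Qed.

Lemma smooth_map_fun V (F : V -> G) (f : G -> R) x : smooth_map F x ->
  lie_smooth f (F x) -> smooth_near (fun y => f (F y) : R^o) x.
Proof.
move=> [cF sF] sf; have [d ad dF] := atlas_cover (F x).
have cE := finite_coords_rV (R := R) n.
apply: smooth_near_eq (smooth_near_comp cE (sF _ ad dF) (sf d ad dF)).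
have N1 := cF _ (chart_dom_near dF).
by near=> y => /=; rewrite !chart_mapK //; near: y; exact: N1.
Unshelve. all: by end_near. Qed.

End GroupValuedMaps.

(** * Partial derivatives and derivations of germs *)
Section PartialDerivatives.
Context {R : realType}.
Implicit Types V W : normedModType R.

Lemma derive_slice2 V1 V2 W (F : V1 * V2 -> W) a b v : differentiable F (a, b) ->
  'D_v (fun y => F (a, y)) b = 'D_((0, v) : V1 * V2) F (a, b).
Proof.
move=> dF; have H : differentiable (fun y : V2 => (a, y)) b.
  by apply: differentiable_pair.
have E : 'D_v (fun=> a) b = 0 by exact: derive_cst.
by rewrite (derive_comp _ H) // derive_pair // derive_id E.
Qed.

Lemma derive_slice1 V1 V2 W (F : V1 * V2 -> W) a b v : differentiable F (a, b) ->
  'D_v (fun x => F (x, b)) a = 'D_((v, 0) : V1 * V2) F (a, b).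
Proof.
move=> dF; have H : differentiable (fun x : V1 => (x, b)) a.
  by apply: differentiable_pair.
have E : 'D_v (fun=> b) a = 0 by exact: derive_cst.
by rewrite (derive_comp _ H) // derive_pair // derive_id E.
Qed.

(** The product rule in the form used on groups: a variable that occurs twice
    in a product is differentiated in one occurrence at a time. *)
Lemma derive_diagonal V W (F : V * V -> W) a v : differentiable F (a, a) ->
  'D_v (fun x => F (x, x)) a = 'D_v (fun x => F (x, a)) a + 'D_v (fun y => F (a, y)) a.
Proof.
move=> dF; have H : differentiable (fun x : V => (x, x)) a.
  by apply: differentiable_pair.
rewrite derive_slice1 // derive_slice2 // (derive_comp _ H) // derive_pair // derive_id.
rewrite !deriveE // -linearD; congr ('d F _ _).
by rewrite /= ; congr pair; rewrite /= ?addr0 ?add0r.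
Qed.

Lemma smooth_near_slice2 V1 V2 W (F : V1 * V2 -> W) a b v :
  finite_coords V1 -> finite_coords V2 -> smooth_near F (a, b) ->
  smooth_near (fun x => 'D_v (fun y => F (x, y)) b) a.
Proof.
move=> c1 c2 sF; have sp : smooth_near (fun x : V1 => (x, b)) a.
  exact: (smooth_near_pair (smooth_near_id a) (smooth_near_cst b a)).
have := smooth_near_comp (finite_coords_prod c1 c2) sp (smooth_near_derive (0, v) sF).
apply: smooth_near_eq.
have N : \forall x \near a, smooth_near F (x, b).
  exact: (smooth_near_continuous sp (smooth_near_near sF)).
apply: filterS N => x sx; rewrite derive_slice2 //; exact: smooth_near_diff.
Qed.

End PartialDerivatives.

Section Derivations.
Context {R : realType} {n : nat} {G : lieGroupType R n}.
Local Notation E := 'rV[R]_n.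
Local Notation S := (@lie_smooth R n G).
Implicit Types (p q g : G) (f h : G -> R) (u v w : E).

Lemma lie_smooth_one d f p : atlas d -> chart_dom d p ->
  smooth_near (fun x => f (chart_inv d x) : R^o) (d p) -> S f p.
Proof.
move=> ad dp sf d' ad' dp'.
have sm := atlas_compat _ _ _ ad' ad dp' dp.
have cE := finite_coords_rV (R := R) n.
have sf' : smooth_near (fun x => f (chart_inv d x) : R^o) (d (chart_inv d' (d' p))).
  by rewrite (chart_mapK dp').
apply: smooth_near_eq (smooth_near_comp cE sm sf').
have N : \forall x \near d' p, chart_dom d (chart_inv d' x).
  exact: (chart_inv_cvg dp' (chart_dom_near dp)).
by apply: filterS N => x dx; rewrite /= chart_mapK.
Qed.

Lemma lie_smooth_near f p : S f p -> \forall q \near p, S f q.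
Proof.
move=> sf; have [d ad dp] := atlas_cover p.
have H : \forall q \near p, smooth_near (fun x => f (chart_inv d x) : R^o) (d q).
  exact: (chart_map_cvg dp (smooth_near_near (sf d ad dp))).
near=> q; apply: (lie_smooth_one ad).
  by near: q; exact: chart_dom_near.
by near: q; exact: H.
Unshelve. all: by end_near. Qed.

Lemma lie_smooth_eq f h p : {near p, f =1 h} -> S f p -> S h p.
Proof.
move=> fh sf d ad dp; apply: smooth_near_eq (sf d ad dp).
have N : \forall x \near d p, f (chart_inv d x) = h (chart_inv d x).
  exact: (chart_inv_cvg dp fh).
by apply: filterS N.
Qed.

Lemma lie_smooth_cst (a : R) p : S (fun=> a) p.
Proof. by move=> d ad dp; exact: smooth_near_cst. Qed.
Arguments lie_smooth_cst : clear implicits.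

Lemma lie_smoothD f h p : S f p -> S h p -> S (fun x => f x + h x) p.
Proof.
move=> sf sh d ad dp.
exact: (smooth_nearD (f := fun x => f (chart_inv d x) : R^o) (sf d ad dp) (sh d ad dp)).
Qed.

Lemma lie_smoothM f h p : S f p -> S h p -> S (fun x => f x * h x) p.
Proof.
move=> sf sh d ad dp.
exact: (smooth_near_scale (f := fun x => h (chart_inv d x) : R^o) (sf d ad dp) (sh d ad dp)).
Qed.

Lemma lie_smoothZD (a : R) f h p : S f p -> S h p -> S (fun x => a * f x + h x) p.
Proof.
by move=> sf sh; exact: (lie_smoothD (lie_smoothM (lie_smooth_cst a p) sf) sh).
Qed.

Lemma lie_smooth_sum (I : Type) (s : seq I) (f : I -> G -> R) p :
  (forall i, S (f i) p) -> S (fun x => \sum_(i <- s) f i x) p.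
Proof.
move=> sf; elim: s => [|i s IH].
  by under eq_fun do rewrite big_nil; exact: lie_smooth_cst.
under eq_fun do rewrite big_cons; exact: (lie_smoothD (sf i) IH).
Qed.

(** The algebraic part of [tangent], without the normalization on functions
    that are not smooth; the functionals that are differentiated below satisfy
    only this part. *)
Definition derivation_at p (D : (G -> R) -> R) : Prop :=
  (forall (a : R) f h, S f p -> S h p ->
     D (fun x => a * f x + h x) = a * D f + D h) /\
  (forall f h, S f p -> S h p ->
     D (fun x => f x * h x) = D f * h p + f p * D h).

Lemma derivation_cst p D (a : R) : derivation_at p D -> D (fun=> a) = 0.
Proof.
move=> [lD mD]; have s1 := lie_smooth_cst 1 p.
have D1 : D (fun=> 1) = 0.
  have := mD _ _ s1 s1; under eq_fun do rewrite mul1r.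
  by rewrite mulr1 mul1r => /eqP; rewrite -subr_eq subrr => /eqP.
(* the constant a is (a - 1) * 1 + 1 *)
have := lD (a - 1) _ _ s1 s1; rewrite D1 mulr0 addr0 => <-.
by congr (D _); apply/funext => x; rewrite mulr1 subrK.
Qed.

Lemma derivationD p D f h : derivation_at p D -> S f p -> S h p ->
  D (fun x => f x + h x) = D f + D h.
Proof.
move=> dD sf sh; have := dD.1 1 f h sf sh; rewrite mul1r => <-.
by congr (D _); apply/funext => x; rewrite mul1r.
Qed.

(** The indicator function [chi] of the set where [f] and [h] agree is smooth
    near [p] and idempotent, so the Leibniz rule gives D chi = 0 and
    D f = D (chi f) = D (chi h) = D h. *)
Lemma derivation_local p D f h : derivation_at p D -> {near p, f =1 h} ->
  S f p -> D f = D h.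
Proof.
move=> dD fh sf; have sh := lie_smooth_eq fh sf.
pose chi q : R := if `[< f q = h q >] then 1 else 0.
have nchi : {near p, (fun=> 1) =1 chi}.
  by apply: filterS fh => q fhq; rewrite /chi asboolT.
have s1 := lie_smooth_cst 1 p; have schi := lie_smooth_eq nchi s1.
have chip : chi p = 1 by rewrite -(nbhs_singleton nchi).
have Dchi : D chi = 0.
  have := dD.2 _ _ schi schi; rewrite chip mulr1 mul1r.
  have -> : (fun x => chi x * chi x) = chi.
    by apply/funext => x; rewrite /chi; case: ifP => _; rewrite ?mulr1 ?mulr0.
  by move=> /eqP; rewrite -subr_eq subrr => /eqP.
have := dD.2 _ _ schi sf; have := dD.2 _ _ schi sh.
rewrite Dchi chip !mul0r !mul1r !add0r => <- <-; congr (D _).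
apply/funext => x; rewrite /chi; case: asboolP => [->//|_]; by rewrite !mul0r.
Qed.

Lemma derivation_sum p D (I : Type) (s : seq I) (f : I -> G -> R) :
  derivation_at p D -> (forall i, S (f i) p) ->
  D (fun x => \sum_(i <- s) f i x) = \sum_(i <- s) D (f i).
Proof.
move=> dD sf; elim: s => [|i s IH].
  by under eq_fun do rewrite big_nil; rewrite big_nil (derivation_cst 0 dD).
under eq_fun do rewrite big_cons.
by rewrite big_cons -IH (derivationD dD) //; exact: lie_smooth_sum.
Qed.

Lemma derivation_velocity (V : normedModType R) (F : V -> G) (x v : V) : smooth_map F x ->
  derivation_at (F x) (fun f => 'D_v (fun y => f (F y) : R^o) x).
Proof.
move=> sF; split => [a f h sf sh|f h sf sh];
  have df := smooth_near_diff (smooth_map_fun sF sf);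
  have dh := smooth_near_diff (smooth_map_fun sF sh).
  rewrite -[LHS]/('D_v (a *: (fun y => f (F y) : R^o) + (fun y => h (F y) : R^o)) x).
  rewrite deriveD; [|exact/derivableZ/diff_derivable|exact: diff_derivable].
  by rewrite deriveZ //; exact: diff_derivable.
rewrite -[LHS]/('D_v (fun y => (f (F y) : R^o) *: (h (F y) : R^o)) x).
by rewrite (derive_scale _ df dh) addrC.
Qed.

End Derivations.

(** * Left-invariant vector fields *)

(** The left-invariant field with value [v] at the identity, as a differential
    operator, in the translates by [p] of one fixed chart [c] at the identity.
    It is sealed, so that equations between such operators are not compared
    by unfolding limits. *)
HB.lock Definition inv_field (R : realType) (n : nat) (G : lieGroupType R n)
    (c : chart R n G) (v : 'rV[R]_n) (p : G) (f : G -> R) : R :=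
  'D_v (fun x => f (p * chart_inv c x)%g : R^o) (c 1%g).

Section InvariantFields.
Context {R : realType} {n : nat} {G : lieGroupType R n}.
Variables (c : chart R n G).
Hypotheses (ac : atlas c) (c1 : chart_dom c 1%g).
Local Notation E := 'rV[R]_n.
Local Notation S := (@lie_smooth R n G).
Local Notation phi := (chart_inv c).
Local Notation x0 := (c 1%g).
Implicit Types (p q g : G) (f h : G -> R) (u v w : E).

Let cE : finite_coords E := finite_coords_rV (R := R) n.
Let cEE : finite_coords (E * E)%type := finite_coords_prod cE cE.

Lemma chart_inv1 : phi x0 = 1%g.
Proof. exact: chart_mapK. Qed.

Lemma smooth_map_phi_near : \forall x \near x0, smooth_map phi x.
Proof.
apply: filterS (chart_invK_near c1) => x [dx cx].
by have := smooth_map_chart_inv ac dx; rewrite cx.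
Qed.

Lemma smooth_map_phi : smooth_map phi x0.
Proof. exact: nbhs_singleton smooth_map_phi_near. Qed.

Lemma smooth_map_translate p x : smooth_map phi x -> smooth_map (fun x => p * phi x)%g x.
Proof. by move=> sx; apply: smooth_map_mul => //; exact: smooth_map_cst. Qed.

Lemma smooth_map_translate0 p : smooth_map (fun x => p * phi x)%g x0.
Proof. exact/smooth_map_translate/smooth_map_phi. Qed.

Lemma smooth_map_chart (V : normedModType R) (F : V -> G) x : smooth_map F x ->
  F x = 1%g -> smooth_near (fun y => c (F y)) x.
Proof. by move=> [_ sF] F1; apply: sF => //; rewrite F1. Qed.

(** The translates of one chart at the identity may replace the atlas; this is
    where the smoothness of the multiplication enters. *)
Lemma lie_smoothP f p : S f p <-> smooth_near (fun x => f (p * phi x)%g : R^o) x0.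
Proof.
split=> sf.
  apply: (smooth_map_fun (smooth_map_translate0 p)).
  by rewrite chart_inv1 mulg1.
have [d ad dp] := atlas_cover p; apply: (lie_smooth_one ad dp).
pose F y := (p^-1 * chart_inv d y)%g.
have sF : smooth_map F (d p).
  by apply: smooth_map_mul; [exact: smooth_map_cst|exact: smooth_map_chart_inv].
have F1 : F (d p) = 1%g by rewrite /F chart_mapK // mulVg.
have sg := smooth_map_chart sF F1.
have sf' : smooth_near (fun x => f (p * phi x)%g : R^o) (c (F (d p))) by rewrite F1.
apply: smooth_near_eq (smooth_near_comp cE sg sf').
have N : \forall y \near d p, chart_dom c (F y).
  by case: sF => + _; rewrite F1; apply; exact: chart_dom_near.
by apply: filterS N => y dy; rewrite chart_mapK // mulVKg.
Qed.

Lemma lie_smooth_translate g f p : S f (g * p)%g <-> S (fun q => f (g * q)%g) p.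
Proof.
by rewrite !lie_smoothP; under [X in _ <-> smooth_near X _]eq_fun do rewrite mulgA.
Qed.

Lemma lie_smooth_comp (F : G -> G) f p : smooth_map (fun x => F (p * phi x)%g) x0 ->
  S f (F p) -> S (fun q => f (F q)) p.
Proof.
move=> sF sf; apply/lie_smoothP; apply: (smooth_map_fun sF).
by rewrite chart_inv1 mulg1.
Qed.

Local Notation inv_field := (inv_field c).

Lemma inv_fieldE v p f : inv_field v p f = 'D_v (fun x => f (p * phi x)%g : R^o) x0.
Proof. by rewrite unlock. Qed.

Lemma inv_field_derivation v p : derivation_at p (inv_field v p).
Proof.
have := derivation_velocity v (smooth_map_translate0 p).
rewrite /= chart_inv1 mulg1; congr derivation_at.
by apply/funext => f; rewrite inv_fieldE.
Qed.

Lemma inv_field_lin (a : R) u v p f : S f p ->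
  inv_field (a *: u + v) p f = a * inv_field u p f + inv_field v p f.
Proof.
move=> /lie_smoothP sf; have df := smooth_near_diff sf.
by rewrite !inv_fieldE !deriveE // linearP.
Qed.

Lemma inv_field_translate g v p f :
  inv_field v (g * p)%g f = inv_field v p (fun q => f (g * q)%g).
Proof. by rewrite !inv_fieldE; under eq_fun do rewrite -mulgA. Qed.

Definition coord_at p (i : 'I_n) q : R := c (p^-1 * q)%g 0 i.

Lemma coord_at_smooth p i : S (coord_at p i) p.
Proof.
apply/lie_smoothP; have := smooth_near_lin (row_coord_continuous (i := i)) (smooth_near_id x0).
apply: smooth_near_eq; apply: filterS (chart_invK_near c1) => x [_ cx].
by rewrite /coord_at mulKg cx.
Qed.

Lemma coord_at_self p i : coord_at p i p = x0 0 i.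
Proof. by rewrite /coord_at mulVg. Qed.

Lemma inv_field_coord v p i : inv_field v p (coord_at p i) = v 0 i.
Proof.
rewrite inv_fieldE (@near_eq_derive _ _ _ _ (row_coord i : E -> R^o)); last first.
  apply: filterS (chart_invK_near c1) => x [_ cx].
  by rewrite /coord_at mulKg cx.
have d0 := smooth_near_diff (smooth_near_id x0).
by rewrite (derive_lin v (row_coord_continuous (i := i)) d0) derive_id.
Qed.

Definition components p (D : (G -> R) -> R) : E := \row_i D (coord_at p i).

Lemma components_inv_field v p : components p (inv_field v p) = v.
Proof. by apply/rowP => i; rewrite mxE inv_field_coord. Qed.

(** Hadamard's lemma, transported to the group. *)
Lemma taylor_at f p : S f p ->
  exists2 k : 'I_n -> G -> R, forall i, S (k i) p &
    {near p, f =1 fun q => f p + \sum_i (coord_at p i q - x0 0 i) * k i q}.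
Proof.
move=> /lie_smoothP sf; have [k sk fE] := hadamard sf.
exists (fun i q => k i (c (p^-1 * q)%g)) => [i|].
  apply/lie_smoothP; apply: smooth_near_eq (sk i).
  by apply: filterS (chart_invK_near c1) => x [_ cx]; rewrite mulKg cx.
have tp : (fun q => p^-1 * q)%g @ p --> (1%g : G).
  by rewrite -(mulVg p); apply: mulg_cvg; [exact: cvg_cst|exact: cvg_id].
have N1 : \forall q \near p, chart_dom c (p^-1 * q)%g.
  exact: (tp _ (chart_dom_near c1)).
have N2 : \forall q \near p, f (p * phi (c (p^-1 * q)))%g =
    f (p * phi x0)%g + \sum_i (coord_at p i q - x0 0 i) * k i (c (p^-1 * q)%g).
  exact: (cvg_comp _ _ tp (chart_map_cvg c1) _ fE).
near=> q.
have dq : chart_dom c (p^-1 * q)%g by near: q; exact: N1.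
have : f (p * phi (c (p^-1 * q)))%g =
    f (p * phi x0)%g + \sum_i (coord_at p i q - x0 0 i) * k i (c (p^-1 * q)%g).
  by near: q; exact: N2.
by rewrite chart_mapK // mulVKg chart_inv1 mulg1.
Unshelve. all: by end_near. Qed.

(** By [taylor_at] and locality a derivation at [p] is determined by its values
    on the coordinate functions, hence is the value of a unique left-invariant
    field: the tangent spaces are identified with R^n. *)
Lemma derivation_components p D f : derivation_at p D -> S f p ->
  D f = inv_field (components p D) p f.
Proof.
move=> dD sf; have [k sk fE] := taylor_at sf.
have sc i : S (fun q => coord_at p i q - x0 0 i) p.
  by apply: lie_smoothD; [exact: coord_at_smooth|exact: lie_smooth_cst].
have sck i : S (fun q => (coord_at p i q - x0 0 i) * k i q) p.
  exact: (lie_smoothM (sc i) (sk i)).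
have H D' : derivation_at p D' ->
    D' f = \sum_i D' (coord_at p i) * k i p.
  move=> dD'; rewrite (derivation_local dD' fE sf).
  rewrite (derivationD dD' (@lie_smooth_cst _ _ _ (f p) p)); last exact: lie_smooth_sum.
  rewrite (derivation_cst _ dD') add0r (derivation_sum _ dD' sck).
  apply: eq_bigr => i _; rewrite dD'.2 // coord_at_self subrr mul0r addr0.
  rewrite (derivationD dD' (@coord_at_smooth p i) (@lie_smooth_cst _ _ _ _ p)).
  by rewrite (derivation_cst _ dD') addr0.
rewrite (H _ dD) (H _ (inv_field_derivation _ p)).
by apply: eq_bigr => i _; rewrite inv_field_coord mxE.
Qed.

Lemma inv_field_inj u v p : (forall f, S f p -> inv_field u p f = inv_field v p f) ->
  u = v.
Proof.
move=> H; apply/rowP => i.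
by rewrite -(inv_field_coord u p i) -(inv_field_coord v p i); apply: H; exact: coord_at_smooth.
Qed.

Lemma inv_field_smooth v f p : S f p -> S (fun q => inv_field v q f) p.
Proof.
move=> sf; apply/lie_smoothP.
have sF : smooth_map (fun z : E * E => (p * phi z.1) * phi z.2)%g (x0, x0).
  have s1 := smooth_near_lin (@fst_pair_continuous R E E) (smooth_near_id (x0, x0)).
  have s2 := smooth_near_lin (@snd_pair_continuous R E E) (smooth_near_id (x0, x0)).
  apply: smooth_map_mul.
    exact: (smooth_map_comp cE s1 (smooth_map_translate0 p)).
  exact: (smooth_map_comp cE s2 smooth_map_phi).
have sfF : smooth_near (fun z : E * E => f ((p * phi z.1) * phi z.2)%g : R^o) (x0, x0).
  by apply: smooth_map_fun sF _; rewrite /= chart_inv1 !mulg1.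
under eq_fun do rewrite inv_fieldE.
exact: (smooth_near_slice2 v cE cE sfF).
Qed.

End InvariantFields.

(** * The Lie algebra *)
Section MixedPartials.
Context {R : realType}.

Lemma schwarz_slices (V1 V2 W : normedModType R) (F : V1 * V2 -> W) a b u v :
  finite_coords V1 -> finite_coords V2 -> finite_coords W -> smooth_near F (a, b) ->
  'D_u (fun x => 'D_v (fun y => F (x, y)) b) a =
  'D_v (fun y => 'D_u (fun x => F (x, y)) a) b.
Proof.
move=> cV1 cV2 cW sF.
have N1 : \forall x \near a, smooth_near F (x, b).
  have sp := smooth_near_pair (smooth_near_id a) (smooth_near_cst b a).
  exact: (smooth_near_continuous sp (smooth_near_near sF)).
have N2 : \forall y \near b, smooth_near F (a, y).
  have sp := smooth_near_pair (smooth_near_cst a b) (smooth_near_id b).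
  exact: (smooth_near_continuous sp (smooth_near_near sF)).
rewrite (@near_eq_derive _ _ _ _ (fun x => 'D_((0, v) : V1 * V2) F (x, b))); last first.
  by apply: filterS N1 => x sx; rewrite derive_slice2 //; exact: smooth_near_diff.
rewrite [RHS](@near_eq_derive _ _ _ _ (fun y => 'D_((u, 0) : V1 * V2) F (a, y))); last first.
  by apply: filterS N2 => x sx; rewrite derive_slice1 //; exact: smooth_near_diff.
rewrite (@derive_slice1 _ V1 V2 W (fun z => 'D_((0, v) : V1 * V2) F z)); last first.
  exact/smooth_near_diff/smooth_near_derive.
rewrite (@derive_slice2 _ V1 V2 W (fun z => 'D_((u, 0) : V1 * V2) F z)); last first.
  exact/smooth_near_diff/smooth_near_derive.
exact: schwarz.
Qed.

End MixedPartials.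

Section LieAlgebra.
Context {R : realType} {n : nat} {G : lieGroupType R n}.
Variables (c : chart R n G).
Hypotheses (ac : atlas c) (c1 : chart_dom c 1%g).
Local Notation E := 'rV[R]_n.
Local Notation S := (@lie_smooth R n G).
Local Notation phi := (chart_inv c).
Local Notation x0 := (c 1%g).
Local Notation X := (inv_field c).
Implicit Types (p q g : G) (f h : G -> R) (u v w : E).

Let cE : finite_coords E := finite_coords_rV (R := R) n.
Let cEE : finite_coords (E * E)%type := finite_coords_prod cE cE.

Let X_deriv v p : derivation_at p (X v p) := inv_field_derivation ac c1 v p.

Let X_smooth v f p : S f p -> S (fun q => X v q f) p.
Proof. exact: inv_field_smooth. Qed.

Lemma X_nearZD v (a : R) f h p : S f p -> S h p ->
  {near p, (fun q => X v q (fun x => a * f x + h x)) =1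
           (fun q => a * X v q f + X v q h)}.
Proof.
move=> sf sh; near=> q; apply: (X_deriv v q).1; near: q; exact: lie_smooth_near.
Unshelve. all: by end_near. Qed.

Lemma X_nearM v f h p : S f p -> S h p ->
  {near p, (fun q => X v q (fun x => f x * h x)) =1
           (fun q => X v q f * h q + f q * X v q h)}.
Proof.
move=> sf sh; near=> q; apply: (X_deriv v q).2; near: q; exact: lie_smooth_near.
Unshelve. all: by end_near. Qed.

Lemma X2_ZD u v (a : R) f h p : S f p -> S h p ->
  X u p (fun q => X v q (fun x => a * f x + h x)) =
  a * X u p (fun q => X v q f) + X u p (fun q => X v q h).
Proof.
move=> sf sh.
rewrite (derivation_local (X_deriv u p) (X_nearZD v a sf sh)).
  by rewrite (X_deriv u p).1 //; exact: X_smooth.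
exact/X_smooth/lie_smoothZD.
Qed.

(** The two mixed products of first derivatives are exchanged with [u] and [v],
    so they cancel in a commutator. *)
Lemma X2_M u v f h p : S f p -> S h p ->
  X u p (fun q => X v q (fun x => f x * h x)) =
  X u p (fun q => X v q f) * h p + X v p f * X u p h +
  (X u p f * X v p h + f p * X u p (fun q => X v q h)).
Proof.
move=> sf sh.
rewrite (derivation_local (X_deriv u p) (X_nearM v sf sh)); last first.
  exact/X_smooth/lie_smoothM.
have s1 := lie_smoothM (X_smooth v sf) sh; have s2 := lie_smoothM sf (X_smooth v sh).
rewrite (derivationD (X_deriv u p) s1 s2).
by rewrite !(X_deriv u p).2 //; exact: X_smooth.
Qed.

Definition field_commutator u v f : R :=
  X u 1%g (fun q => X v q f) - X v 1%g (fun q => X u q f).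

Lemma field_commutator_derivation u v : derivation_at 1%g (field_commutator u v).
Proof.
split=> [a f h sf sh|f h sf sh]; rewrite /field_commutator.
  by rewrite (X2_ZD u v a sf sh) (X2_ZD v u a sf sh); ring.
by rewrite (X2_M u v sf sh) (X2_M v u sf sh); ring.
Qed.

(** A commutator of derivations of functions is a derivation at the identity,
    so it has components; no symmetry of second derivatives is involved. *)
Definition bracket u v : E := components c 1%g (field_commutator u v).

Lemma bracketE u v f p : S f p ->
  X u p (fun q => X v q f) - X v p (fun q => X u q f) = X (bracket u v) p f.
Proof.
have H1 h : S h 1%g ->
    X u 1%g (fun q => X v q h) - X v 1%g (fun q => X u q h) = X (bracket u v) 1%g h.
  by move=> sh; rewrite -(derivation_components ac c1 (field_commutator_derivation u v) sh).
rewrite -{1}(mulg1 p) => sf.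
have sfp : S (fun q => f (p * q)%g) 1%g by apply/(lie_smooth_translate ac c1).
rewrite -(mulg1 p) !inv_field_translate -H1 //.
by congr (X _ _ _ - X _ _ _); apply/funext => q; rewrite inv_field_translate.
Qed.

Lemma bracketDZl (a : R) u v w : bracket (a *: u + v) w = a *: bracket u w + bracket v w.
Proof.
apply: (inv_field_inj ac c1 (p := 1%g)) => f sf.
rewrite inv_field_lin // -!bracketE // inv_field_lin //; last exact: X_smooth.
have N : {near 1%g, (fun q => X (a *: u + v) q f) =1 (fun q => a * X u q f + X v q f)}.
  by apply: filterS (lie_smooth_near sf) => q sq; exact: inv_field_lin.
rewrite (derivation_local (X_deriv w 1%g) N); last exact: X_smooth.
by rewrite (X_deriv w 1%g).1; [ring|exact: X_smooth|exact: X_smooth].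
Qed.

Lemma bracketN u v : bracket u v = - bracket v u.
Proof.
apply: (inv_field_inj ac c1 (p := 1%g)) => f sf.
have := inv_field_lin ac c1 (-1) (bracket v u) 0 sf.
rewrite scaleN1r addr0 => ->.
have := inv_field_lin ac c1 (-1) 0 0 sf; rewrite scaler0 addr0 => /eqP.
rewrite -subr_eq0 => /eqP E0.
rewrite -!bracketE //; lra.
Qed.

(** Both sides are tested on a function; each double bracket becomes four
    third-order derivatives and the twelve terms cancel. *)
Lemma jacobi u v w :
  bracket u (bracket v w) + bracket v (bracket w u) + bracket w (bracket u v) = 0.
Proof.
have H a b d f : S f 1%g -> X (bracket a (bracket b d)) 1%g f =
    (X a 1%g (fun q => X b q (fun r => X d r f)) - X a 1%g (fun q => X d q (fun r => X b r f)))
  - (X b 1%g (fun q => X d q (fun r => X a r f))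
     - X d 1%g (fun q => X b q (fun r => X a r f))).
  move=> sf; rewrite -bracketE // -(bracketE b d); last exact: X_smooth.
  congr (_ - _).
  have N : {near 1%g, (fun q => X b q (fun r => X d r f) - X d q (fun r => X b r f))
      =1 (fun q => X (bracket b d) q f)}.
    by apply: filterS (lie_smooth_near sf) => q sq; exact: bracketE.
  have s1 : S (fun q => X b q (fun r => X d r f)) 1%g by apply/X_smooth/X_smooth.
  have s2 : S (fun q => X d q (fun r => X b r f)) 1%g by apply/X_smooth/X_smooth.
  (* a difference is put in the shape a * f + h of [derivation_at] *)
have N' : {near 1%g, (fun q => -1 * X d q (fun r => X b r f) + X b q (fun r => X d r f))
      =1 (fun q => X (bracket b d) q f)}.
    by apply: filterS N => q <-; rewrite mulN1r addrC.
  rewrite -(derivation_local (X_deriv a 1%g) N'); last exact: lie_smoothZD.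
  by rewrite (X_deriv a 1%g).1 // mulN1r addrC.
apply: (inv_field_inj ac c1 (p := 1%g)) => f sf.
have D0 : X 0 1%g f = 0.
  have := inv_field_lin ac c1 (-1) 0 0 sf; rewrite scaler0 addr0; lra.
have XD a b : X (a + b) 1%g f = X a 1%g f + X b 1%g f.
  by rewrite -{1}(scale1r a) inv_field_lin // mul1r.
rewrite D0 !XD !H //; ring.
Qed.

End LieAlgebra.

(** * The adjoint action *)
Section Adjoint.
Context {R : realType} {n : nat} {G : lieGroupType R n}.
Variables (c : chart R n G).
Hypotheses (ac : atlas c) (c1 : chart_dom c 1%g).
Local Notation E := 'rV[R]_n.
Local Notation S := (@lie_smooth R n G).
Local Notation phi := (chart_inv c).
Local Notation x0 := (c 1%g).
Local Notation X := (inv_field c).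
Local Notation brk := (bracket c).
Implicit Types (p q g : G) (f h : G -> R) (u v w : E).

Let cE : finite_coords E := finite_coords_rV (R := R) n.
Let cEE : finite_coords (E * E)%type := finite_coords_prod cE cE.

Lemma smooth_map_phi_fst x y : smooth_map phi x ->
  smooth_map (fun z : E * E => phi z.1) (x, y).
Proof.
move=> sx; have s1 := smooth_near_lin (@fst_pair_continuous R E E) (smooth_near_id (x, y)).
exact: (smooth_map_comp cE s1 sx).
Qed.

Lemma smooth_map_phi_snd x y : smooth_map phi y ->
  smooth_map (fun z : E * E => phi z.2) (x, y).
Proof.
move=> sx; have s1 := smooth_near_lin (@snd_pair_continuous R E E) (smooth_near_id (x, y)).
exact: (smooth_map_comp cE s1 sx).
Qed.

(** The differential at the identity of q |-> g^-1 q g. With this convention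
    [Ad] reverses products. *)
Definition Ad g v : E := components c 1%g (fun f => X v 1%g (fun q => f (q ^ g)%g)).

Lemma conj_smooth f g : S f 1%g -> S (fun q => f (q ^ g)%g) 1%g.
Proof.
move=> sf; apply: (lie_smooth_comp ac c1); last by rewrite conj1g.
apply: smooth_map_mul; first exact: smooth_map_cst.
apply: smooth_map_mul; last exact: smooth_map_cst.
exact: smooth_map_translate0.
Qed.

Lemma AdE g v f : S f 1%g -> X (Ad g v) 1%g f = X v 1%g (fun q => f (q ^ g)%g).
Proof.
move=> sf; rewrite /Ad -(derivation_components ac c1 _ sf) //.
have dX := inv_field_derivation ac c1 v 1%g.
split=> [a f1 f2 s1 s2|f1 f2 s1 s2].
  exact: (dX.1 a _ _ (conj_smooth g s1) (conj_smooth g s2)).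
by rewrite (dX.2 _ _ (conj_smooth g s1) (conj_smooth g s2)) conj1g.
Qed.

Lemma Ad_lin g (a : R) u v : Ad g (a *: u + v) = a *: Ad g u + Ad g v.
Proof.
apply: (inv_field_inj ac c1 (p := 1%g)) => f sf.
rewrite AdE // !inv_field_lin // ?AdE //; exact: conj_smooth.
Qed.

Lemma AdM g g' v : Ad (g * g')%g v = Ad g' (Ad g v).
Proof.
apply: (inv_field_inj ac c1 (p := 1%g)) => f sf.
rewrite AdE // AdE // AdE; last exact: conj_smooth.
by congr (X _ _ _); apply/funext => q; rewrite conjgM.
Qed.

Lemma Ad1 v : Ad 1%g v = v.
Proof.
apply: (inv_field_inj ac c1 (p := 1%g)) => f sf.
by rewrite AdE //; congr (X _ _ _); apply/funext => q; rewrite conjg1.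
Qed.

Lemma inv_field1E v f : X v 1%g f = 'D_v (fun y => f (phi y) : R^o) x0.
Proof. by rewrite inv_fieldE; under eq_fun do rewrite mul1g. Qed.

Let sphi : smooth_map phi x0 := smooth_map_phi ac c1.

Lemma smooth_Ad v : smooth_near (fun x => Ad (phi x) v) x0.
Proof.
apply: smooth_near_row => i.
under eq_fun do rewrite inv_field1E.
have sF : smooth_map (fun z : E * E => (phi z.2 ^ phi z.1)%g) (x0, x0).
  have s1 := smooth_map_phi_fst x0 sphi; have s2 := smooth_map_phi_snd x0 sphi.
  apply: smooth_map_mul; first exact: smooth_map_inv.
  exact: smooth_map_mul.
have sf : S (coord_at c 1%g i) (phi x0 ^ phi x0)%g.
  by rewrite chart_inv1 // conj1g; exact: coord_at_smooth.
exact: (smooth_near_slice2 v cE cE (smooth_map_fun sF sf)).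
Qed.

Lemma derive_inverse (V : normedModType R) (F : V -> G) (x u : V) h :
  finite_coords V -> smooth_map F x -> F x = 1%g -> S h 1%g ->
  'D_u (fun y => h (F y)^-1%g : R^o) x = - 'D_u (fun y => h (F y) : R^o) x.
Proof.
move=> cV sF F1 sh; pose K (z : V * V) : R^o := h (F z.1 * (F z.2)^-1)%g.
have sK : smooth_near K (x, x).
  apply: (smooth_map_fun (F := fun z : V * V => (F z.1 * (F z.2)^-1)%g)).
    have s1 := smooth_near_lin (@fst_pair_continuous R V V) (smooth_near_id (x, x)).
    have s2 := smooth_near_lin (@snd_pair_continuous R V V) (smooth_near_id (x, x)).
    apply: smooth_map_mul; first exact: (smooth_map_comp cV s1 sF).
    by apply: smooth_map_inv; exact: (smooth_map_comp cV s2 sF).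
  by rewrite /= mulgV.
have := derive_diagonal u (smooth_near_diff sK).
have -> : (fun x => K (x, x)) = cst (h 1%g : R^o).
  by apply/funext => y; rewrite /K /= mulgV.
have -> : (fun y => K (y, x)) = (fun y => h (F y)).
  by apply/funext => y; rewrite /K /= F1 invg1 mulg1.
have -> : (fun y => K (x, y)) = (fun y => h (F y)^-1%g).
  by apply/funext => y; rewrite /K /= F1 mul1g.
by rewrite derive_cst => /eqP; rewrite eq_sym addr_eq0 => /eqP ->; rewrite opprK.
Qed.

(** In f (x^-1 y x) the variable x is differentiated in one occurrence at a
    time. The right one gives a mixed derivative of f (y x), where Schwarz'
    theorem exchanges the two fields; the left one contributes with a minus
    sign because of the inverse. *)
Lemma derive_Ad u v : 'D_u (fun x => Ad (phi x) v) x0 = - brk u v.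
Proof.
apply/rowP => i; rewrite -[LHS]/(row_coord i _) -derive_lin; last 2 first.
- exact: row_coord_continuous.
- exact: smooth_near_diff (smooth_Ad v).
pose f := coord_at c 1%g i; have sf : S f 1%g by exact: coord_at_smooth.
rewrite /row_coord.
have -> : (- brk u v) 0 i = X v 1%g (fun q => X u q f) - X u 1%g (fun q => X v q f).
  by rewrite mxE -[in LHS](inv_field_coord c1 (brk u v) 1%g i) -bracketE // opprB.
have AdC y : Ad (phi y) v 0 i = X v 1%g (fun q => f (q ^ phi y)%g).
  by rewrite /Ad mxE.
have -> : (fun y => (Ad (phi y) v) 0 i : R^o) =
  (fun y => X v 1%g (fun q => f (q ^ phi y)%g)) by apply/funext => y; exact: AdC.
clearbody f; clear AdC; have E1 : phi x0 = 1%g by exact: chart_inv1.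
pose Th (z : E * E) : R^o := 'D_v (fun y => f ((phi z.1)^-1 * phi y * phi z.2)%g : R^o) x0.
have sTh : smooth_near Th (x0, x0).
  apply: (smooth_near_slice2 (F := fun z : (E * E) * E =>
    f ((phi z.1.1)^-1 * phi z.2 * phi z.1.2)%g : R^o)) => //.
  apply: (smooth_map_fun (F := fun z : (E * E) * E =>
    ((phi z.1.1)^-1 * phi z.2 * phi z.1.2)%g)); last first.
    by rewrite /= E1 !mulg1 invg1.
  have s1 := smooth_near_lin (@fst_pair_continuous R (E * E)%type E) (smooth_near_id (x0, x0, x0)).
  have s2 := smooth_near_lin (@snd_pair_continuous R (E * E)%type E) (smooth_near_id (x0, x0, x0)).
  have m1 := smooth_map_comp cEE s1 (smooth_map_phi_fst x0 sphi).
  have m2 := smooth_map_comp cEE s1 (smooth_map_phi_snd x0 sphi).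
  have m3 := smooth_map_comp cE s2 sphi.
  by apply: smooth_map_mul => //; apply: smooth_map_mul => //; exact: smooth_map_inv.
have -> : (fun y => X v 1%g (fun q => f (q ^ phi y)%g) : R^o) = (fun x => Th (x, x)).
  apply/funext => y; rewrite inv_field1E /Th.
  have -> : (fun z => f (phi z ^ phi y)%g : R^o) =
    (fun z => f ((phi (y, y).1)^-1 * phi z * phi (y, y).2)%g).
    by apply/funext => z; rewrite conjgE mulgA.
  by [].
rewrite (derive_diagonal u (smooth_near_diff sTh)) addrC; congr (_ + _).
  have sF : smooth_near (fun z : E * E => f (phi z.1 * phi z.2)%g : R^o) (x0, x0).
    apply: (smooth_map_fun (F := fun z : E * E => (phi z.1 * phi z.2)%g)).
      by apply: smooth_map_mul; [exact: smooth_map_phi_fst|exact: smooth_map_phi_snd].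
    by rewrite /= E1 mulg1.
  have := schwarz_slices v u cE cE (finite_coords_R (R := R)) sF => /= H.
  have -> : (fun x => Th (x0, x)) = (fun z => 'D_v (fun y => f (phi y * phi z)%g : R^o) x0).
    apply/funext => z; rewrite /Th /=.
    have -> // : (fun y => f ((phi x0)^-1 * phi y * phi z)%g : R^o) =
      (fun y => f (phi y * phi z)%g).
    by apply/funext => y; rewrite E1 invg1 mul1g.
  rewrite -H inv_field1E.
  have E2 : (fun x => 'D_u (fun y => f (phi x * phi y)%g : R^o) x0) =
    (fun y => X u (phi y) f : R^o) by apply/funext => y; rewrite inv_fieldE.
  exact: (congr1 (fun k : E -> R^o => 'D_v k x0) E2).
have -> : (fun x => Th (x, x0)) = (fun x => X v (phi x)^-1%g f : R^o).
  apply/funext => z; rewrite /Th /= inv_fieldE.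
  have -> // : (fun y => f ((phi z)^-1 * phi y * phi x0)%g : R^o) =
    (fun y => f ((phi z)^-1 * phi y)%g).
  by apply/funext => y; rewrite E1 mulg1.
rewrite inv_field1E; exact: (derive_inverse u cE sphi E1 (inv_field_smooth ac c1 v sf)).
Qed.

End Adjoint.

(** * From the nilpotent group to its nilpotent Lie algebra *)
Section GroupVersusAlgebra.
Context {R : realType} {n : nat} {G : lieGroupType R n}.
Variables (c : chart R n G).
Hypotheses (ac : atlas c) (c1 : chart_dom c 1%g).
Local Notation E := 'rV[R]_n.
Local Notation S := (@lie_smooth R n G).
Local Notation phi := (chart_inv c).
Local Notation x0 := (c 1%g).
Local Notation X := (inv_field c).
Local Notation brk := (bracket c).
Local Notation Ad := (Ad c).
Implicit Types (p q g : G) (f h : G -> R) (u v w : E).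

Let cE : finite_coords E := finite_coords_rV (R := R) n.

Definition velocity (F : E -> G) v : E :=
  components c 1%g (fun f => 'D_v (fun y => f (F y) : R^o) x0).

Lemma velocityE (F : E -> G) v f : smooth_map F x0 -> F x0 = 1%g -> S f 1%g ->
  'D_v (fun y => f (F y) : R^o) x0 = X (velocity F v) 1%g f.
Proof.
move=> sF F1 sf; have := derivation_velocity v sF; rewrite F1 => dF.
exact: (derivation_components ac c1 dF sf).
Qed.

Lemma velocity_phi v : velocity phi v = v.
Proof.
rewrite -[RHS](components_inv_field c1 v 1%g); apply/rowP => i; rewrite !mxE.
by rewrite inv_field1E.
Qed.

Lemma velocity_cst v : velocity (fun=> 1%g) v = 0.
Proof. by apply/rowP => i; rewrite !mxE; exact: derive_cst. Qed.

Lemma smooth_map_commg (F : E -> G) g x : smooth_map F x ->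
  smooth_map (fun y => [~ F y, g])%g x.
Proof.
move=> sF; apply: smooth_map_mul; first exact: smooth_map_inv.
apply: smooth_map_mul; first exact: smooth_map_cst.
by apply: smooth_map_mul => //; exact: smooth_map_cst.
Qed.

(** [~ x, g] = x^-1 * x ^ g: the two occurrences of x contribute - 1 and
    [Ad g]. *)
Lemma velocity_commg (F : E -> G) g v : smooth_map F x0 -> F x0 = 1%g ->
  velocity (fun y => [~ F y, g])%g v = Ad g (velocity F v) - velocity F v.
Proof.
move=> sF F1; apply: (inv_field_inj ac c1 (p := 1%g)) => f sf.
rewrite -velocityE //; last 2 first.
- exact: smooth_map_commg.
- by rewrite F1 comm1g.
have -> : Ad g (velocity F v) - velocity F v =
    -1 *: velocity F v + Ad g (velocity F v) by rewrite scaleN1r addrC.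
rewrite inv_field_lin // AdE // mulN1r.
rewrite -(velocityE v sF F1 sf) -(velocityE v sF F1 (conj_smooth ac c1 g sf)).
pose K (z : E * E) : R^o := f ((F z.1)^-1 * F z.2 ^ g)%g.
have sK : smooth_near K (x0, x0).
  apply: (smooth_map_fun (F := fun z : E * E => ((F z.1)^-1 * F z.2 ^ g)%g)).
    have s1 := smooth_near_lin (@fst_pair_continuous R E E) (smooth_near_id (x0, x0)).
    have s2 := smooth_near_lin (@snd_pair_continuous R E E) (smooth_near_id (x0, x0)).
    have m1 := smooth_map_comp cE s1 sF; have m2 := smooth_map_comp cE s2 sF.
    apply: smooth_map_mul; first exact: smooth_map_inv.
    apply: smooth_map_mul; first exact: smooth_map_cst.
    by apply: smooth_map_mul => //; exact: smooth_map_cst.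
  by rewrite /= F1 conj1g invg1 mulg1.
rewrite -[LHS]/('D_v (fun x => K (x, x)) x0) (derive_diagonal v (smooth_near_diff sK)).
have -> : (fun y => K (y, x0)) = (fun y => f (F y)^-1%g).
  by apply/funext => y; rewrite /K /= F1 conj1g mulg1.
have -> : (fun y => K (x0, y)) = (fun y => f (F y ^ g)%g).
  by apply/funext => y; rewrite /K /= F1 invg1 mul1g.
by rewrite (derive_inverse _ cE sF F1 sf).
Qed.

Definition iter_commg q (gs : seq G) : G := foldl (fun a g => [~ a, g]%g) q gs.

Lemma upper_central_iter_commg k q : upper_central k q ->
  forall gs, size gs = k -> iter_commg q gs = 1%g.
Proof.
elim: k q => [|k IH] q /=; first by move=> -> [].
by move=> Hq [|g gs] // [sgs]; exact: (IH _ (Hq g) gs sgs).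
Qed.

Definition dcommg g v : E := Ad g v - v.

Lemma velocity_iter_commg (F : E -> G) gs v : smooth_map F x0 -> F x0 = 1%g ->
  velocity (fun y => iter_commg (F y) gs) v = foldl (fun w g => dcommg g w) (velocity F v) gs.
Proof.
elim: gs F => [//|g gs IH] F sF F1 /=.
rewrite (IH (fun y => [~ F y, g]%g)); last 2 first.
- exact: smooth_map_commg.
- by rewrite F1 comm1g.
by rewrite velocity_commg.
Qed.

Lemma dcommg_lin g : linear (dcommg g).
Proof. by move=> a u v; rewrite /dcommg Ad_lin // scalerBr opprD addrACA. Qed.

Lemma iter_dcommg_lin gs : linear (foldl (fun w g => dcommg g w) ^~ gs : E -> E).
Proof.
elim: gs => [//|g gs IH] a u v /=; by rewrite dcommg_lin IH.
Qed.

(** The iterated commutator with k elements is constant, so the composite of the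
    linear maps [dcommg g] for k elements g vanishes identically. As
    dcommg g = Ad g - 1 vanishes at g = 1 and has derivative - [u, _] there,
    differentiating this identity in one element after another replaces every
    [dcommg g] by a bracket. *)
Lemma nilpotent_bracket k : upper_central k = [set: G] ->
  forall us, size us = k -> forall v, foldl (fun w u => brk u w) v us = 0.
Proof.
move=> Zk.
suff H m us gs v : size us = m -> (size us + size gs = k)%N ->
    foldl (fun w g => dcommg g w) (foldl (fun w u => brk u w) v us) gs = 0.
  by move=> us sus v; apply: (H k us [::] v) => //; rewrite addn0.
elim: m us gs => [|m IH] us gs sus sk.
  move: us sus sk => [|//] _ /= sk.
  rewrite -{1}(velocity_phi v) -velocity_iter_commg //; last first.
  - exact: chart_inv1.
  - exact: smooth_map_phi.
  have -> : (fun y => iter_commg (phi y) gs) = (fun=> 1%g).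
    apply/funext => y; apply: (@upper_central_iter_commg k) => //.
    by rewrite Zk.
  exact: velocity_cst.
(* the element phi x, at the head of gs, is differentiated at x0 along u *)
case/lastP: us sus sk => [//|us u]; rewrite !size_rcons => -[sus] sk.
rewrite foldl_rcons; set w := foldl _ v us.
have Hx x : foldl (fun w g => dcommg g w) (dcommg (phi x) w) gs = 0.
  by apply: (IH us (phi x :: gs)) => //=; rewrite addnS.
pose LM := GRing.isLinear.Build R E E _ _ (iter_dcommg_lin gs).
pose L : {linear E -> E} := HB.pack (fun v : E => foldl (fun w g => dcommg g w) v gs) LM.
have cL : continuous L := linear_finite_continuous cE.
have sA := smooth_near_diff (smooth_Ad ac c1 w).
have dd : differentiable (fun x => dcommg (phi x) w) x0.
  by apply: (differentiableB sA); exact: differentiable_cst.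
have := derive_lin u cL dd.
have -> : (fun y => L (dcommg (phi y) w)) = cst 0 by apply/funext => x; exact: Hx.
rewrite derive_cst => /esym.
have -> : 'D_u (fun x => dcommg (phi x) w) x0 = - brk u w.
  rewrite -[LHS]/('D_u ((fun x => Ad (phi x) w) - cst w) x0) deriveB.
  - by rewrite derive_cst subr0 derive_Ad.
  - exact: diff_derivable.
  - exact: derivable_cst.
by rewrite linearN => /eqP; rewrite oppr_eq0 => /eqP.
Qed.

End GroupVersusAlgebra.

(** * A zero bracket forces a commutative group *)
Section Abelian.
Context {R : realType} {n : nat} {G : lieGroupType R n}.
Variables (c : chart R n G).
Hypotheses (ac : atlas c) (c1 : chart_dom c 1%g).
Local Notation E := 'rV[R]_n.
Local Notation S := (@lie_smooth R n G).
Local Notation phi := (chart_inv c).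
Local Notation x0 := (c 1%g).
Local Notation X := (inv_field c).
Local Notation brk := (bracket c).
Local Notation Ad := (Ad c).
Implicit Types (p q g : G) (f h : G -> R) (u v w : E).

Let cE : finite_coords E := finite_coords_rV (R := R) n.

Lemma near_translate p (P : G -> Prop) :
  (\forall x \near x0, P (p * phi x)%g) -> \forall q \near p, P q.
Proof.
move=> HP.
have tp : (fun q => p^-1 * q)%g @ p --> (1%g : G).
  by rewrite -(mulVg p); apply: mulg_cvg; [exact: cvg_cst|exact: cvg_id].
have N1 : \forall q \near p, chart_dom c (p^-1 * q)%g.
  exact: (tp _ (chart_dom_near c1)).
have N2 : \forall q \near p, P (p * phi (c (p^-1 * q)))%g.
  exact: (cvg_comp _ _ tp (chart_map_cvg c1) _ HP).
near=> q.
have dq : chart_dom c (p^-1 * q)%g by near: q; exact: N1.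
have : P (p * phi (c (p^-1 * q)))%g by near: q; exact: N2.
by rewrite chart_mapK // mulVKg.
Unshelve. all: by end_near. Qed.

Lemma translate_cvg p : (p * phi x)%g @[x --> x0] --> p.
Proof.
have := @mulg_cvg _ _ G _ _ (nbhs_filter x0) (fun=> p) phi p 1%g.
rewrite mulg1; apply; first exact: cvg_cst.
exact: chart_inv_cvg.
Qed.

Lemma locally_constant_connected (T : Type) (w : G -> T) : connected [set: G] ->
  (forall p, \forall q \near p, w q = w p) -> forall p q, w q = w p.
Proof.
move=> cG lw p q.
have op (A : set T) : open [set r | A (w r)].
  rewrite openE => r /= Ar; apply: filterS (lw r) => s /= ->; exact: Ar.
pose B := [set r | w r = w p].
have BT : B = setT.
  apply: cG; first by exists p.
    by exists B; [exact: (op [set t | t = w p])|rewrite setTI].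
  exists B; last by rewrite setTI.
  rewrite -[B]setCK; apply: open_closedC; exact: (op [set t | t <> w p]).
by have : B q by rewrite BT.
Qed.

(** At a point [p * phi x] near [p] the derivative of [h] in any direction is
    the value at [h] of a derivation, hence of some left-invariant field. *)
Lemma flat_locally_constant h p : S h p ->
  (\forall q \near p, forall v, X v q h = 0) -> \forall q \near p, h q = h p.
Proof.
move=> sh flat; apply: near_translate.
have N1 : \forall x \near x0, S h (p * phi x)%g.
  exact: (translate_cvg (lie_smooth_near sh)).
have N2 : \forall x \near x0, forall v, X v (p * phi x)%g h = 0.
  exact: (translate_cvg flat).
have N : \forall x \near x0, differentiable (fun x => h (p * phi x)%g : R^o) x /\
    forall u, 'D_u (fun x => h (p * phi x)%g : R^o) x = 0.
  near=> x.
  have sx : smooth_map (fun x => p * phi x)%g x.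
    apply: smooth_map_translate; near: x; exact: smooth_map_phi_near.
  have shx : S h (p * phi x)%g by near: x; exact: N1.
  have fx : forall v, X v (p * phi x)%g h = 0 by near: x; exact: N2.
  split; first exact: smooth_near_diff (smooth_map_fun sx shx).
  move=> u; have := derivation_components ac c1 (derivation_velocity u sx) shx.
  by rewrite fx.
move/nbhs_normP: N => [r /= r0 rP].
apply/nbhs_normP; exists r => // x xr.
have -> : h p = h (p * phi x0)%g by rewrite chart_inv1 // mulg1.
apply: (@constant_on_ball _ _ (fun x => h (p * phi x)%g : R^o) x0 r).
  by move=> y yr; apply: rP; rewrite /= distrC.
by rewrite distrC.
Unshelve. all: by end_near. Qed.

(** By [derive_Ad] the derivative of [Ad] along every left-invariant field is
    given by brackets, so [Ad] is locally constant. *)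
Lemma Ad_trivial : connected [set: G] -> (forall u v, brk u v = 0) ->
  forall g v, Ad g v = v.
Proof.
move=> cG b0 g v; apply/rowP => i.
rewrite -[in RHS](Ad1 ac c1 v).
apply: (@locally_constant_connected _ (fun g => Ad g v 0 i) cG) => {}g.
have AdT q x : Ad (q * phi x)%g v = Ad (phi x) (Ad q v) by rewrite AdM.
have AdTi q : (fun x => Ad (q * phi x)%g v 0 i : R^o) =
    (fun x => row_coord i (Ad (phi x) (Ad q v))).
  by apply/funext => x; rewrite AdT.
have sA q : S (fun q => Ad q v 0 i) q.
  apply/(lie_smoothP ac c1); rewrite AdTi.
  exact: (smooth_near_lin (row_coord_continuous (i := i)) (smooth_Ad ac c1 (Ad q v))).
apply: (flat_locally_constant (h := fun q => Ad q v 0 i)) => //.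
near=> q => w; rewrite inv_fieldE AdTi.
rewrite derive_lin; [|exact: row_coord_continuous|exact: smooth_near_diff (smooth_Ad ac c1 _)].
by rewrite derive_Ad // b0 oppr0 linear0.
Unshelve. all: by end_near. Qed.

(** Moving q to q x turns W = [~ q, g] into x^-1 W x ^ g = W (x^-1) ^ W x ^ g;
    the two occurrences of x cancel when the adjoint action is trivial. *)
Lemma derive_commg_eq0 g q v f : S f [~ q, g]%g -> 
  (forall g v, Ad g v = v) -> X v q (fun q => f [~ q, g]%g) = 0.
Proof.
move=> sf Ad1; pose W := [~ q, g]%g.
have sphi : smooth_map phi x0 := smooth_map_phi ac c1.
have E1 : phi x0 = 1%g by exact: chart_inv1.
pose K (z : E * E) : R^o := f ((phi z.1)^-1 * (W * phi z.2 ^ g))%g.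
have sK : smooth_near K (x0, x0).
  apply: (smooth_map_fun (F := fun z : E * E => ((phi z.1)^-1 * (W * phi z.2 ^ g))%g)).
    have m1 := smooth_map_phi_fst x0 sphi; have m2 := smooth_map_phi_snd x0 sphi.
    apply: smooth_map_mul; first exact: smooth_map_inv.
    apply: smooth_map_mul; first exact: smooth_map_cst.
    apply: smooth_map_mul; first exact: smooth_map_cst.
    by apply: smooth_map_mul => //; exact: smooth_map_cst.
  by rewrite /= E1 conj1g invg1 mulg1 mul1g.
rewrite inv_fieldE.
have -> : (fun x => f [~ q * phi x, g]%g : R^o) = (fun x => K (x, x)).
  by apply/funext => x; rewrite /K /= /W !commgEl invgM conjMg !mulgA.
rewrite (derive_diagonal v (smooth_near_diff sK)).
have sfW : S (fun r => f (W * r)%g) 1%g.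
  by apply/(lie_smooth_translate ac c1); rewrite mulg1.
have -> : (fun y => K (x0, y)) = (fun y => (fun r => f (W * r ^ g)%g) (phi y)).
  by apply/funext => y; rewrite /K /= E1 invg1 mul1g.
have -> : (fun y => K (y, x0)) = (fun y => (fun r => f (W * r ^ W)%g) (phi y)^-1%g).
  by apply/funext => y; rewrite /K /= E1 conj1g mulg1 conjgE !mulgA mulgV mul1g.
have sc k := conj_smooth ac c1 k sfW.
rewrite (derive_inverse v cE sphi E1 (sc W)).
rewrite -[X in _ + X](inv_field1E c v (fun r => f (W * r ^ g)%g)).
rewrite -[X in - X](inv_field1E c v (fun r => f (W * r ^ W)%g)).
by rewrite -(AdE ac c1 g v sfW) -(AdE ac c1 W v sfW) !Ad1 addNr.
Qed.

Lemma abelian_of_bracket0 : connected [set: G] -> (forall u v, brk u v = 0) ->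
  forall g q, (q * g = g * q)%g.
Proof.
move=> cG b0 g q; apply/commgP/eqP.
rewrite -[RHS](comm1g g).
apply: (@locally_constant_connected _ (fun q => [~ q, g]%g) cG) => {}q.
have A1 := Ad_trivial cG b0.
pose f i := coord_at c [~ q, g]%g i.
have sf i : S (f i) [~ q, g]%g by exact: coord_at_smooth.
have sm : smooth_map (fun x => [~ q * phi x, g]%g) x0.
  by apply: smooth_map_commg; exact: smooth_map_translate0.
have cq : (fun r => [~ r, g]%g) @ q --> [~ q, g]%g.
  apply: mulg_cvg; first by apply: invg_cvg; exact: cvg_id.
  apply: mulg_cvg; first exact: cvg_cst.
  by apply: mulg_cvg; [exact: cvg_id|exact: cvg_cst].
have N i : \forall r \near q, f i [~ r, g]%g = f i [~ q, g]%g.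
  apply: (flat_locally_constant (h := fun r => f i [~ r, g]%g)).
    by apply: (lie_smooth_comp ac c1).
  have Nf : \forall r \near q, S (f i) [~ r, g]%g.
    exact: (cq _ (lie_smooth_near (sf i))).
  by apply: filterS Nf => r sr v; exact: derive_commg_eq0.
have Nall : \forall r \near q, forall i, f i [~ r, g]%g = f i [~ q, g]%g.
  by apply: filter_forall => i; exact: N.
have tp : (fun r => [~ q, g]^-1 * [~ r, g])%g @ q --> (1%g : G).
  by rewrite -(mulVg [~ q, g]%g); apply: mulg_cvg => //; exact: cvg_cst.
have Nd : \forall r \near q, chart_dom c ([~ q, g]^-1 * [~ r, g])%g.
  exact: (tp _ (chart_dom_near c1)).
near=> r.
have dr : chart_dom c ([~ q, g]^-1 * [~ r, g])%g by near: r; exact: Nd.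
have fr : forall i, f i [~ r, g]%g = f i [~ q, g]%g by near: r; exact: Nall.
have : c ([~ q, g]^-1 * [~ r, g])%g = c 1%g.
  apply/rowP => i; have := fr i; rewrite /f coord_at_self; exact.
move=> /(congr1 phi); rewrite chart_mapK // (chart_inv1 c1).
by move=> /(congr1 (fun z => [~ q, g] * z)%g); rewrite mulVKg mulg1.
Unshelve. all: by end_near. Qed.

End Abelian.

(** * Averaging over a nilpotent group *)
Section UpperCentral.
Context {G : groupType}.
Implicit Types (x y g h : G).
Local Open Scope group_scope.

Lemma upper_centralJ k x g : upper_central k x -> upper_central k (x ^ g).
Proof.
elim: k x => [|k IH] x /=; first by move=> ->; rewrite conj1g.
by move=> Hx y; rewrite -[y](conjgKV g) -conjRg; exact/IH/Hx.
Qed.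

Lemma upper_centralM k x y :
  upper_central k x -> upper_central k y -> upper_central k (x * y).
Proof.
elim: k x y => [|k IH] x y /=; first by move=> -> ->; rewrite mulg1.
move=> Hx Hy z.
have -> : [~ x * y, z] = [~ x, z] ^ y * [~ y, z].
  by rewrite !commgEl invgM conjMg [_ ^ y]conjgE !mulgA !mulgK.
by apply: IH => //; exact: upper_centralJ.
Qed.

Lemma upper_central1 k : upper_central k (1 : G).
Proof. by elim: k => [//|k IH] /= y; rewrite comm1g. Qed.

Lemma upper_centralX k x n : upper_central k x -> upper_central k (x ^+ n).
Proof.
move=> Hx; elim: n => [|n IH]; first by rewrite expg0; exact: upper_central1.
by rewrite expgS; exact: upper_centralM.
Qed.

End UpperCentral.

Section Averaging.
Context {R : realType} {G : groupType}.
Implicit Types (g h p : G) (F f : G -> R) (H : set G).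

Definition bounded F := exists M : R, forall p, `|F p| <= M.

(** Sums of differences of right translates of bounded functions. An invariant
    mean would vanish on them; the conclusion that they are not bounded below by
    a positive constant is proved without constructing the mean. *)
Inductive coboundary H : (G -> R) -> Prop :=
| coboundary0 : coboundary H (fun=> 0)
| coboundaryS g F f : H g -> bounded F -> coboundary H f ->
    coboundary H (fun p => F (p * g)%g - F p + f p).

Lemma boundedZ F (a : R) : bounded F -> bounded (fun p => a * F p).
Proof.
move=> [M HM]; exists (`|a| * M) => p; rewrite normrM; exact: ler_wpM2l.
Qed.

Lemma bounded_translate F g : bounded F -> bounded (fun p => F (p * g)%g).
Proof. by move=> [M HM]; exists M => p. Qed.

Lemma bounded_sum (I : finType) (F : I -> G -> R) : (forall i, bounded (F i)) ->
  bounded (fun p => \sum_i F i p).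
Proof.
move=> bF; pose M i := sval (cid (bF i)); exists (\sum_i M i) => p.
apply: le_trans (ler_norm_sum _ _ _) _; apply: ler_sum => i _.
exact: (svalP (cid (bF i))).
Qed.

Lemma coboundaryD H f f' : coboundary H f -> coboundary H f' ->
  coboundary H (fun p => f p + f' p).
Proof.
move=> + Hf'; elim => [|g F f1 Hg bF _ IH].
  by under eq_fun do rewrite add0r.
by under eq_fun do rewrite -addrA; exact: coboundaryS.
Qed.

Lemma coboundary1 H g F : H g -> bounded F ->
  coboundary H (fun p => F (p * g)%g - F p).
Proof.
move=> Hg bF; have := coboundaryS Hg bF (coboundary0 H).
by under eq_fun do rewrite addr0.
Qed.

Lemma coboundaryZ H (a : R) f : coboundary H f -> coboundary H (fun p => a * f p).
Proof.
elim => [|g F f1 Hg bF _ IH]; first by under eq_fun do rewrite mulr0; exact: coboundary0.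
under eq_fun do rewrite mulrDr mulrBr.
exact: (coboundaryS (F := fun p => a * F p) Hg (boundedZ a bF) IH).
Qed.

Lemma coboundary_sum H (I : finType) (f : I -> G -> R) :
  (forall i, coboundary H (f i)) -> coboundary H (fun p => \sum_i f i p).
Proof.
move=> Hf; elim: (index_enum I) => [|i s IH].
  by under eq_fun do rewrite big_nil; exact: coboundary0.
by under eq_fun do rewrite big_cons; exact: coboundaryD.
Qed.

Lemma coboundary_translate H f g : (forall h y, H h -> H (h ^ y)%g) ->
  coboundary H f -> coboundary H (fun p => f (p * g)%g).
Proof.
move=> HJ; elim => [|h F f1 Hh bF _ IH]; first exact: coboundary0.
have := coboundaryS (HJ h g^-1%g Hh) (bounded_translate g bF) IH.
congr coboundary; apply/funext => p; congr (F _ - _ + _).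
by rewrite conjgE invgK !mulgA mulgVK.
Qed.

(** Coboundaries over the (k+1)-st term of the upper central series in which
    only [m] differences use elements outside the k-th term: the measure on
    which these differences are removed one at a time. *)
Fixpoint coboundary_over k m f : Prop :=
  if m is m'.+1 then exists g F f', [/\ upper_central k.+1 g, bounded F,
    coboundary_over k m' f' & f = (fun p => F (p * g)%g - F p + f' p)]
  else coboundary (upper_central k) f.

Lemma coboundary_overD k m f f0 : coboundary_over k m f ->
  coboundary (upper_central k) f0 -> coboundary_over k m (fun p => f p + f0 p).
Proof.
move=> + Hf0; elim: m f => [|m IH] f /=; first by move=> Hf; exact: coboundaryD.
move=> [g [F [f' [Zg bF Hf' ->]]]]; exists g, F, (fun p => f' p + f0 p); split => //.
  exact: IH.
by apply/funext => p; rewrite addrA.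
Qed.

Definition translate_avg N g f : G -> R :=
  fun p => N%:R^-1 * \sum_(j < N) f (p * g ^+ j)%g.

Lemma bounded_translate_avg N g F : bounded F -> bounded (translate_avg N g F).
Proof. by move=> bF; apply: boundedZ; apply: bounded_sum => j; exact: bounded_translate. Qed.

(** Averaging a difference by h over the right translations by powers of g
    gives the difference by h of the averaged function, up to differences by
    conjugates of commutators [~ g ^+ j, h], which lie one step lower in the
    upper central series. *)
Lemma coboundary_over_avg k m N g f : upper_central k.+1 g ->
  coboundary_over k m f -> coboundary_over k m (translate_avg N g f).
Proof.
move=> Zg; elim: m f => [|m IH] f /=.
  move=> Hf; apply: coboundaryZ; apply: coboundary_sum => j.
  by apply: coboundary_translate Hf => h y; exact: upper_centralJ.
move=> [h [F [f' [Zh bF Hf' ->]]]].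
pose K (j : 'I_N) p : R := F (p * (h * g ^+ j))%g.
pose c (j : 'I_N) : G := ([~ g ^+ j, h] ^ (h * g ^+ j)^-1)%g.
pose f0 p := N%:R^-1 * \sum_(j < N) (K j (p * c j)%g - K j p).
exists h, (translate_avg N g F), (fun p => translate_avg N g f' p + f0 p); split => //.
- exact: bounded_translate_avg.
- apply: coboundary_overD; first exact: IH.
  apply: coboundaryZ; apply: coboundary_sum => j; apply: coboundary1.
    by apply: upper_centralJ; exact: (upper_centralX j Zg).
  exact: bounded_translate.
apply/funext => p; rewrite /translate_avg /f0 -mulrBr -!mulrDr; congr (_ * _).
rewrite -sumrB -!big_split /=; apply: eq_bigr => j _.
have -> : K j (p * c j)%g = F (p * g ^+ j * h)%g.
  have E (b x : G) : (x ^ b^-1 * b = b * x)%g.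
    by rewrite conjgE invgK -!mulgA mulVg mulg1.
  by rewrite /K /c -mulgA E -[in RHS]mulgA (commgC (g ^+ j)%g h).
rewrite /K !mulgA; ring.
Qed.

Lemma coboundary_over_intro k f : coboundary (upper_central k.+1) f ->
  exists m, coboundary_over k m f.
Proof.
elim => [|g F f1 Hg bF _ [m IH]]; first by exists 0%N; exact: coboundary0.
by exists m.+1; exists g, F, f1.
Qed.

(** Averaging over the powers g ^+ j, j < N, of the element of one difference
    makes that difference telescope to a term of size 2 M / N and does not
    increase the number of the remaining ones. *)
Lemma coboundary_not_bounded_below k f : coboundary (upper_central k) f ->
  forall e : R, 0 < e -> ~ forall p, e <= f p.
Proof.
elim: k f => [|k IHk] f.
  move=> Hf e e0 /(_ 1%g); suff -> : f 1%g = 0 by rewrite leNgt e0.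
  by elim: Hf => [//|g F f1 -> _ _ ->]; rewrite mulg1 subrr addr0.
move=> /coboundary_over_intro [m]; elim: m f => [|m IH] f /=; first exact: IHk.
move=> [g [F [f' [Zg [M HM] Hf' ->]]]] e e0 He.
(* with this N the telescoped difference is at most e / 2 *)
pose N := (Num.bound (4 * M / e)).+1.
have N0 : 0 < N%:R :> R by rewrite ltr0n.
have M0 : 0 <= M by apply: le_trans (HM 1%g).
have e2 : 0 < e / 2 by rewrite divr_gt0.
have NM : 2 * M <= N%:R * (e / 2).
  have x0 : 0 <= 4 * M / e by rewrite divr_ge0 ?mulr_ge0 // ltW.
  have : 4 * M / e < N%:R.
    by apply: lt_trans (archi_boundP x0) _; rewrite ltr_nat ltnS.
  rewrite ltr_pdivrMr // => /ltW; lra.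
clearbody N; apply: (IH _ (coboundary_over_avg N Zg Hf') _ e2) => p.
rewrite /translate_avg -(ler_pM2l N0) mulVKf ?gt_eqF //.
have T : \sum_(j < N) (F (p * g ^+ j * g)%g - F (p * g ^+ j)%g) = F (p * g ^+ N)%g - F p.
  elim: (N) => [|K IHK]; first by rewrite big_ord0 expg0 mulg1 subrr.
  by rewrite big_ord_recr /= IHK expgSr mulgA; ring.
have := HM (p * g ^+ N)%g; have := HM p; rewrite !ler_norml => /andP[a1 a2] /andP[a3 a4].
have : \sum_(j < N) e <=
    \sum_(j < N) (F (p * g ^+ j * g)%g - F (p * g ^+ j)%g + f' (p * g ^+ j)%g).
  by apply: ler_sum => j _; exact: He.
rewrite big_split /= T sumr_const card_ord -(mulr_natl e N).
have -> : N%:R * e = N%:R * (e / 2) + N%:R * (e / 2) by rewrite -mulrDr -splitr.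
lra.
Qed.

Lemma nilpotent_no_drift (I : finType) (g : I -> G) (F : I -> G -> R) (e : R) :
  nilpotent_group G -> (forall i, bounded (F i)) -> 0 < e ->
  ~ forall p, e <= \sum_i (F i (p * g i)%g - F i p).
Proof.
move=> [k Zk] bF e0; apply: (@coboundary_not_bounded_below k) => //.
apply: coboundary_sum => i; apply: coboundary1 => //.
by rewrite Zk.
Qed.

End Averaging.

(** * Nilpotent Lie algebras with a complex structure in dimension six *)
Section LinearDependence.
Context {R : fieldType} {d : nat}.

Lemma dependent_family m (e : 'I_m -> 'rV[R]_d) : (d < m)%N ->
  exists2 x : 'rV[R]_m, x != 0 & \sum_i x 0 i *: e i = 0.
Proof.
move=> dm; pose M := \matrix_i e i.
have : kermx M != 0.
  rewrite kermx_eq0 /row_free neq_ltn; apply/orP; left.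
  exact: leq_ltn_trans (rank_leq_col M) dm.
move=> /rowV0Pn [x /sub_kermxP xM x0]; exists x => //.
move: xM; rewrite mulmx_sum_row => xM; rewrite -[RHS]xM.
by apply: eq_bigr => i _; rewrite rowK.
Qed.

Lemma spanning_family (e : 'I_d -> 'rV[R]_d) :
  (forall x : 'rV[R]_d, \sum_i x 0 i *: e i = 0 -> x = 0) ->
  forall w, exists x : 'rV[R]_d, w = \sum_i x 0 i *: e i.
Proof.
move=> free w; pose M := \matrix_i e i.
have E (x : 'rV[R]_d) : x *m M = \sum_i x 0 i *: e i.
  by rewrite mulmx_sum_row; apply: eq_bigr => i _; rewrite rowK.
have fM : row_free M.
  rewrite -kermx_eq0; apply/negP => /negP /rowV0Pn [x /sub_kermxP].
  by rewrite E => /free ->; rewrite eqxx.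
exists (w *m invmx M); rewrite -E mulmxKV //.
by rewrite -row_free_unit.
Qed.

End LinearDependence.

(** Multiplication by a + i b for the complex structure [J]; sealed so that it
    is not mistaken for a real linear combination. *)
HB.lock Definition cscale (R : realFieldType) (J : 'rV[R]_6 -> 'rV[R]_6)
  (a b : R) (u : 'rV[R]_6) : 'rV[R]_6 := a *: u + b *: J u.

Section NilpotentComplexLieAlgebra.
Context {R : realFieldType}.
Local Notation E := 'rV[R]_6.
Variables (brk : E -> E -> E) (J : E -> E).
Hypotheses (brkl : forall a u v w, brk (a *: u + v) w = a *: brk u w + brk v w)
  (brkN : forall u v, brk u v = - brk v u)
  (brkJ : forall u v w, brk u (brk v w) + brk v (brk w u) + brk w (brk u v) = 0)
  (Jl : forall a u v, J (a *: u + v) = a *: J u + J v)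
  (JJ : forall u, J (J u) = - u)
  (nij : forall u v, brk (J u) (J v) - J (brk (J u) v) - J (brk u (J v)) - brk u v = 0).
Variable k : nat.
Hypothesis nilp : forall us, size us = k -> forall v, foldl (fun w u => brk u w) v us = 0.
Implicit Types (u v w x y z : E) (a b : R).

Let J0 : J 0 = 0.
Proof. by have := Jl (-1) 0 0; rewrite !scaler0 addr0 scaleN1r addNr. Qed.
Let JD u v : J (u + v) = J u + J v.
Proof. by rewrite -{1}(scale1r u) Jl scale1r. Qed.
Let JZ a u : J (a *: u) = a *: J u.
Proof. by rewrite -[a *: u]addr0 Jl J0 addr0. Qed.
Let JN u : J (- u) = - J u.
Proof. by rewrite -scaleN1r JZ scaleN1r. Qed.
Let brk0l w : brk 0 w = 0.
Proof. by have := brkl (-1) 0 0 w; rewrite !scaler0 addr0 scaleN1r addNr. Qed.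
Let brkDl u v w : brk (u + v) w = brk u w + brk v w.
Proof. by rewrite -{1}(scale1r u) brkl scale1r. Qed.
Let brkZl a u w : brk (a *: u) w = a *: brk u w.
Proof. by rewrite -[a *: u]addr0 brkl brk0l addr0. Qed.
Let brk0r w : brk w 0 = 0. Proof. by rewrite brkN brk0l oppr0. Qed.
Let brkDr u v w : brk w (u + v) = brk w u + brk w v.
Proof. by rewrite brkN brkDl opprD -!brkN. Qed.
Let brkZr a u w : brk w (a *: u) = a *: brk w u.
Proof. by rewrite brkN brkZl -scalerN -brkN. Qed.
Let brkNr u w : brk w (- u) = - brk w u.
Proof. by rewrite -scaleN1r brkZr scaleN1r. Qed.
Let brkxx u : brk u u = 0.
Proof.
have /eqP := brkN u u; rewrite -addr_eq0 -mulr2n -scaler_nat scaler_eq0.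
by rewrite pnatr_eq0 => /eqP.
Qed.

Let derivation u v w : brk u (brk v w) = brk (brk u v) w + brk v (brk u w).
Proof.
have /eqP := brkJ u v w; rewrite -addrA addr_eq0 => /eqP ->.
by rewrite opprD addrC (brkN w) opprK (brkN w u) brkNr opprK.
Qed.

Local Notation cscale := (cscale J).

Lemma cscaleE a b u : cscale a b u = a *: u + b *: J u.
Proof. by rewrite unlock. Qed.

Lemma cscale_eq0 a b u : cscale a b u = 0 -> u <> 0 -> a = 0 /\ b = 0.
Proof.
move=> H u0.
have : (a ^+ 2 + b ^+ 2) *: u = 0.
  have <- : cscale a (- b) (cscale a b u) = 0.
    by rewrite H !cscaleE J0 !scaler0 addr0.
  rewrite !cscaleE JD !JZ JJ !scalerDr !scalerA scalerDl.
  by apply/rowP => i; rewrite !mxE; ring.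
move=> /eqP; rewrite scaler_eq0 => /orP[|/eqP//].
by rewrite paddr_eq0 ?sqr_ge0 // !sqrf_eq0 => /andP[/eqP -> /eqP ->].
Qed.

Lemma cscale0 u : cscale 0 0 u = 0.
Proof. by rewrite !cscaleE !scale0r addr0. Qed.

Lemma four_dependent w0 w1 w2 w3 :
  (forall a0 b0 a1 b1 a2 b2 a3 b3,
     cscale a0 b0 w0 + cscale a1 b1 w1 + cscale a2 b2 w2 + cscale a3 b3 w3 = 0 ->
     [/\ a0 = 0 /\ b0 = 0, a1 = 0 /\ b1 = 0, a2 = 0 /\ b2 = 0 & a3 = 0 /\ b3 = 0]) ->
  False.
Proof.
move=> free.
pose s : seq E := [:: w0; J w0; w1; J w1; w2; J w2; w3; J w3].
have [x x0] := @dependent_family R 6 8 (fun i => s`_i) isT.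
pose y (j : nat) := x 0 (inord j : 'I_8).
have -> : \sum_i x 0 i *: s`_i = \sum_(0 <= j < 8) y j *: s`_j.
  by rewrite big_mkord; apply: eq_bigr => i _; rewrite /y inord_val.
rewrite unlock /= addr0 !addrA => H.
have := free (y 0%N) (y 1%N) (y 2%N) (y 3%N) (y 4%N) (y 5%N) (y 6%N) (y 7%N).
rewrite !cscaleE !addrA => /(_ H) [[e0 e1] [e2 e3] [e4 e5] [e6 e7]].
move/eqP: x0; apply; apply/rowP => i; rewrite mxE -(inord_val i) -/(y i).
by case: i => [[|[|[|[|[|[|[|[|//]]]]]]]]].
Qed.

Lemma three_span w0 w1 w2 :
  (forall a0 b0 a1 b1 a2 b2,
     cscale a0 b0 w0 + cscale a1 b1 w1 + cscale a2 b2 w2 = 0 ->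
     [/\ a0 = 0 /\ b0 = 0, a1 = 0 /\ b1 = 0 & a2 = 0 /\ b2 = 0]) ->
  forall w, exists a0 b0 a1 b1 a2 b2,
     w = cscale a0 b0 w0 + cscale a1 b1 w1 + cscale a2 b2 w2.
Proof.
move=> free.
pose s : seq E := [:: w0; J w0; w1; J w1; w2; J w2].
have SE (x : 'rV[R]_6) : \sum_i x 0 i *: s`_i = let y j := x 0 (inord j : 'I_6) in
  cscale (y 0%N) (y 1%N) w0 + cscale (y 2%N) (y 3%N) w1 + cscale (y 4%N) (y 5%N) w2.
  pose y (j : nat) := x 0 (inord j : 'I_6).
  have -> : \sum_i x 0 i *: s`_i = \sum_(0 <= j < 6) y j *: s`_j.
    by rewrite big_mkord; apply: eq_bigr => i _; rewrite /y inord_val.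
  by rewrite unlock /= addr0 !cscaleE !addrA.
have fr (x : 'rV[R]_6) : \sum_i x 0 i *: s`_i = 0 -> x = 0.
  rewrite SE => /free [[e0 e1] [e2 e3] [e4 e5]].
  apply/rowP => i; rewrite mxE -(inord_val i).
  by case: i => [[|[|[|[|[|[|//]]]]]]].
move=> w; have [x ->] := spanning_family fr w.
rewrite SE; by do 6! eexists.
Qed.

(** ad x acts nilpotently on the quotient by the invariant subspace [P], so the
    class of [w] there is not an eigenvector for the nonzero eigenvalue [a]. *)
Lemma invariant_subspace_eigen (P : E -> Prop) x w a :
  (forall b u v, P u -> P v -> P (b *: u + v)) ->
  P 0 -> (forall s, P s -> P (brk x s)) -> a <> 0 -> P (brk x w - a *: w) -> P w.
Proof.
move=> Pl P0 Px a0 Pw.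
have H m : P (iter m (brk x) w - a ^+ m *: w).
  elim: m => [|m IH]; first by rewrite expr0 scale1r subrr.
  have := Pl (a ^+ m) _ _ Pw (Px _ IH).
  rewrite /= brkDr brkNr brkZr scalerBr scalerA -exprSr.
  by rewrite addrC addrA subrK.
have := H k; have -> : iter k (brk x) w = 0.
  have itE m w0 : foldl (fun w u => brk u w) w0 (nseq m x) = iter m (brk x) w0.
    by elim: m w0 => [//|m IH] w0; rewrite iterSr -IH.
  by rewrite -itE nilp // size_nseq.
rewrite sub0r => /(Pl (- (a ^+ k)^-1) _ 0) /(_ P0).
rewrite addr0 scalerN scaleNr opprK scalerA mulVf ?scale1r //.
by rewrite expf_neq0 //; apply/eqP.
Qed.

(** A nonzero iterated bracket of maximal length. *)
Lemma exists_central_bracket : (exists u v, brk u v <> 0) ->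
  exists y w, brk y w <> 0 /\ forall u, brk u (brk y w) = 0.
Proof.
move=> [u0 [v0 uv0]]; move: nilp; elim: (k) => [|m IH] nilm.
  by case: uv0; exact: (nilm [::] erefl (brk u0 v0)).
have [H|] := pselect (forall us, size us = m -> forall v,
  foldl (fun w u => brk u w) v us = 0); first exact: IH.
move=> /existsNP [us] /not_implyP [sus] /existsNP [v vne].
case/lastP: us sus vne => [|us y] sus vne.
  by case: uv0; have := nilm [:: u0]; rewrite -sus => /(_ erefl v0).
exists y, (foldl (fun w u => brk u w) v us).
rewrite foldl_rcons in vne; split => // u.
have := nilm (rcons (rcons us y) u); rewrite size_rcons sus => /(_ erefl v).
by rewrite !foldl_rcons.
Qed.

(** Let z = [y, w] be nonzero and central. Integrability of [J] makes
    A = ad (J z) complex linear. If A is not zero, then z is not in its image: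
    from A u = z one gets [J u, J z] = - J z, against nilpotency. In complex
    dimension 3 this leaves room only for A o A = 0, with complex basis u, A u,
    z, where t = J z. The point is then that A [u, J u] = 0. Otherwise
    [u, J u] has a nonzero component on the complex line of u, and a suitable
    complex multiple u' of u is an eigenvector of ad (J u') modulo ker A. *)
Lemma complex_nilpotent_dichotomy : (exists u v, brk u v <> 0) ->
  (exists y w, [/\ brk y w <> 0, forall u, brk (brk y w) u = 0 &
                   forall u, brk (J (brk y w)) u = 0]) \/
  (exists t u v, [/\ v <> 0, brk t u = v /\ brk t (J u) = J v,
                     brk t v = 0 /\ brk t (J v) = 0 &
                     brk v (J u) + brk u (J v) = 0]).
Proof.
move=> /exists_central_bracket [y [w [z0 zc']]].
set z := brk y w in z0 zc'.
have zc u : brk z u = 0 by rewrite brkN zc' oppr0.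
pose A u := brk (J z) u.
have AJ u : A (J u) = J (A u).
  have := nij z u; rewrite !zc J0 subr0 subr0 => /eqP; rewrite subr_eq0 => /eqP.
  exact.
have [A0|] := pselect (forall u, A u = 0).
  by left; exists y, w.
move=> /existsNP [u1 Au1]; right.
have AD u v : A (u + v) = A u + A v by exact: brkDr.
have AZ a u : A (a *: u) = a *: A u by exact: brkZr.
have AC a b u : A (cscale a b u) = cscale a b (A u) by rewrite !cscaleE AD !AZ AJ.
have Az : A z = 0 by rewrite /A zc'.
have A00 : A 0 = 0 by exact: brk0r.
have C0 a b : cscale a b 0 = 0 by rewrite !cscaleE J0 !scaler0 addr0.
have AA u v : A (brk u v) = brk (A u) v + brk u (A v) by exact: derivation.
have AJz : A (J z) = 0 by exact: brkxx.
have AE u : A u = brk (J z) u by [].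
clearbody A.
have zA u : A u <> z.
  move=> Auz; have AJu : brk (J u) (J z) = - J z.
    by rewrite brkN -AE AJ Auz.
  have Jz0 : J z = 0.
    apply: (@invariant_subspace_eigen (fun v => v = 0) (J u) (J z) (-1)) => //.
    - by move=> b u' v' -> ->; rewrite scaler0 addr0.
    - by move=> s ->; rewrite brk0r.
    - by apply/eqP; rewrite oppr_eq0 oner_eq0.
    by rewrite AJu scaleN1r subrr.
  by apply: z0; have := JJ z; rewrite Jz0 J0 => /esym/eqP; rewrite oppr_eq0 => /eqP.
have zAC a b a' b' u : cscale a b (A u) + cscale a' b' z = 0 -> a' = 0 /\ b' = 0.
  move=> H; pose s := a' ^+ 2 + b' ^+ 2.
  have [s0|s0] := eqVneq s 0.
    move: s0 => /eqP; rewrite /s paddr_eq0 ?sqr_ge0 // !sqrf_eq0.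
    by move=> /andP[/eqP -> /eqP ->].
  have E : z = A (cscale (- a' / s) (b' / s) (cscale a b u)).
    rewrite !AC; move/eqP: H; rewrite addr_eq0 => /eqP ->.
    rewrite !cscaleE JN JD !JZ JJ.
    apply/rowP => i; rewrite !mxE; move: s0; rewrite /s.
    by move=> s0; field.
  by case: (zA _ (esym E)).
(* u, A u, A (A u), z would be four independent vectors in dimension three *)
have indep u : A (A (A u)) = 0 -> A (A u) <> 0 -> False.
  move=> A3 A2; apply: (@four_dependent u (A u) (A (A u)) z) => a0 b0 a1 b1 a2 b2 a3 b3 H.
  have h2 : cscale a0 b0 (A (A u)) = 0.
    have := congr1 (fun y => A (A y)) H.
    by rewrite !AD !AC A3 Az !A00 !C0 !addr0.
  have [p0 q0] := cscale_eq0 h2 A2.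
  have h1 : cscale a1 b1 (A (A u)) = 0.
    have := congr1 A H.
    by rewrite !AD !AC A3 Az A00 !C0 !addr0 p0 q0 cscale0 add0r.
  have [p1 q1] := cscale_eq0 h1 A2.
  move: H; rewrite p0 q0 p1 q1 !cscale0 !add0r => H.
  have [p3 q3] := zAC _ _ _ _ _ H; subst; move: H; rewrite cscale0 addr0 => h3.
  by have [-> ->] := cscale_eq0 h3 A2.
have AA0 u : A (A u) = 0.
  apply: contrapT => AAu.
  have itA m : iter m A u = foldl (fun w u => brk u w) u (nseq m (J z)).
    by elim: m (u) => [//|m IH] w0; rewrite iterSr IH AE.
  have Ak : iter k A u = 0 by rewrite itA nilp // size_nseq.
  have [m A0m] : exists m, iter m.+3 A u = 0 /\ iter m.+2 A u <> 0.
    have H : exists m, iter m.+2 A u == 0.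
      by exists k; rewrite /= Ak !A00.
    case: (ex_minnP H) => [[|m]] /eqP Hm mmin; first by case: AAu.
    exists m; split => // /eqP /mmin; by rewrite ltnn.
  by apply: (@indep (iter m A u)); case: A0m.
have [v Auv] : exists v, A u1 = v by exists (A u1).
rewrite Auv in Au1; move: u1 Auv Au1 => u Auv v0.
have Av : A v = 0 by rewrite -Auv AA0.
have free a0 b0 a1 b1 a2 b2 :
    cscale a0 b0 u + cscale a1 b1 v + cscale a2 b2 z = 0 ->
    [/\ a0 = 0 /\ b0 = 0, a1 = 0 /\ b1 = 0 & a2 = 0 /\ b2 = 0].
  move=> H; have h2 : cscale a0 b0 v = 0.
    have := congr1 A H.
    by rewrite !AD !AC Auv Av Az A00 !C0 !addr0.
  have [p0 q0] := cscale_eq0 h2 v0.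
  move: H; rewrite p0 q0 cscale0 add0r -Auv => H.
  have [p3 q3] := zAC _ _ _ _ _ H; move: H.
  rewrite Auv p3 q3 cscale0 addr0 => h3.
  by have [-> ->] := cscale_eq0 h3 v0.
have span := three_span free.
have AJu : A (J u) = J v by rewrite AJ Auv.
have AJv : A (J v) = 0 by rewrite AJ Av J0.
(* A is a derivation of square zero, so 0 = A (A [u, J u]) = 2 [v, J v] *)
have vJv : brk v (J v) = 0.
  have := AA0 (brk u (J u)).
  rewrite AA Auv AJu AD !AA Av AJu AJv Auv brk0l brk0r add0r addr0.
  rewrite -mulr2n -scaler_nat => /eqP.
  by rewrite scaler_eq0 pnatr_eq0 => /eqP.
have kerA s : A s = 0 -> exists a1 b1 a2 b2, s = cscale a1 b1 v + cscale a2 b2 z.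
  have [a0 [b0 [a1 [b1 [a2 [b2 ->]]]]]] := span s.
  rewrite !AD !AC Auv Av Az !C0 !addr0 => h0; have [-> ->] := cscale_eq0 h0 v0.
  by exists a1, b1, a2, b2; rewrite cscale0 add0r.
have brkv s : A s = 0 -> brk v s = 0 /\ brk (J v) s = 0.
  move=> /kerA [a1 [b1 [a2 [b2 ->]]]].
  have vz : brk v (J z) = 0 by rewrite brkN -AE Av oppr0.
  have Jvz : brk (J v) (J z) = 0 by rewrite brkN -AE AJv oppr0.
  rewrite !cscaleE !brkDr !brkZr !brkxx !zc' vJv vz Jvz (brkN (J v) v) vJv.
  by rewrite oppr0 !scaler0 !addr0.
have key : A (brk u (J u)) = 0.
  have [a [b [a1 [b1 [a2 [b2 uE]]]]]] := span (brk u (J u)).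
  have AuE : A (brk u (J u)) = cscale a b v.
    by rewrite uE !AD !AC Auv Av Az !C0 !addr0.
  pose s := a ^+ 2 + b ^+ 2.
  have [s0|s0] := eqVneq s 0.
    move: s0 => /eqP; rewrite AuE /s paddr_eq0 ?sqr_ge0 // !sqrf_eq0.
    by move=> /andP[/eqP -> /eqP ->]; rewrite cscale0.
  (* the component a u + b J u of [u, J u] itself is the right multiple of u *)
  pose u' := cscale a b u; pose t := J u'.
  have tu : brk t u' = - s *: brk u (J u).
    rewrite /t /u' !cscaleE JD !JZ JJ !brkDl !brkDr !brkZl !brkZr.
    rewrite -scaleN1r !brkZl !brkxx (brkN (J u) u) !scaler0 /s.
    by apply/rowP => i; rewrite !mxE; ring.
  have At : A t = cscale (- b) a v.
    rewrite /t AJ /u' AC Auv !cscaleE JD !JZ JJ.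
    by apply/rowP => i; rewrite !mxE; ring.
  have Au' : A u' = 0.
    apply: (@invariant_subspace_eigen (fun y => A y = 0) t u' (- s)).
    - by move=> c x x' Ax Ay; rewrite AD AZ Ax Ay scaler0 addr0.
    - exact: A00.
    - move=> x Ax; rewrite AA Ax brk0r addr0 At !cscaleE brkDl !brkZl.
      by have [-> ->] := brkv _ Ax; rewrite !scaler0 addr0.
    - by apply/eqP; rewrite oppr_eq0.
    rewrite tu -scalerBr AZ AD -scaleN1r AZ AuE /u' AC Auv.
    by rewrite scaleN1r subrr scaler0.
  by rewrite AuE -Auv -AC -/u' Au'.
exists (J z), u, v; split => //; rewrite -?AE //.
by move: key; rewrite AA Auv AJu.
Qed.

End NilpotentComplexLieAlgebra.

Local Open Scope quotient_scope.

(** * Functions on the compact quotient *)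
Section CompactQuotient.
Context {R : realType} {n : nat} {G : lieGroupType R n}.
Variables (Gam : subgroup G).
Local Notation pr := (lq_proj Gam).

Lemma lq_projP (p q : G) : pr p = pr q <-> exists2 g, subgroup_set Gam g & q = (g * p)%g.
Proof.
split.
  move=> /eqmodP /asboolP H; exists (q * p^-1)%g => //; by rewrite mulgVK.
by move=> [g Gg ->]; apply/eqmodP/asboolP; rewrite mulgK.
Qed.

Lemma open_saturation (A : set G) : open A -> open [set q | exists2 a, A a & pr q = pr a].
Proof.
move=> oA; rewrite openE => q [a Aa /lq_projP [g Gg ag]].
have H : (fun q => g * q)%g @ q --> a.
  by rewrite ag; apply: mulg_cvg; [exact: cvg_cst|exact: cvg_id].
have N : \forall r \near q, A (g * r)%g by apply: H; exact: open_nbhs_nbhs.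
apply: filterS N => r Ar; exists (g * r)%g => //.
by apply/lq_projP; exists g.
Qed.

(** The projection to the quotient is open, since translations are
    homeomorphisms; so local estimates on the group that are invariant under
    the subgroup become uniform. *)
Lemma cocompact_uniform (I : Type) (F : set_system I) (P : I -> G -> Prop) :
  Filter F -> cocompact_subgroup Gam ->
  (forall i p q, pr p = pr q -> P i p -> P i q) ->
  (forall p : G, exists2 B, F B & \forall q \near p, forall i, B i -> P i q) ->
  \forall i \near F, forall q, P i q.
Proof.
move=> FF /compact_near_coveringP cc Pinv Ploc.
pose P' i (x : quotient_topology {eq_quot (orbit_equiv Gam)}) :=
  forall q, pr q = x -> P i q.
have : \forall i \near F, setT `<=` P' i.
  apply: cc => x _.
  have [p px] : exists p, pr p = x by exists (repr x); exact: reprK.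
  have [B FB HB] := Ploc p.
  pose A := [set q | forall i, B i -> P i q]°.
  pose A' : set (quotient_topology {eq_quot (orbit_equiv Gam)}) :=
    [set y | exists2 a, A a & y = pr a].
  exists (A', B); last first.
    move=> [y i] /= [[a Aa ya] Bi] q qy; apply: (Pinv i a).
      by rewrite qy ya.
    exact: (interior_subset Aa).
  split; last exact: FB.
  have oA' : open A' := open_saturation (@open_interior _ _).
  have xA' : A' x by exists p => //; rewrite /A.
  exact: (open_nbhs_nbhs (conj oA' xA')).
by apply: filterS => i H q; exact: (H (pr q)).
Qed.

End CompactQuotient.

Section Drift.
Context {R : realType} {n : nat} {G : lieGroupType R n}.
Variables (c : chart R n G).
Hypotheses (ac : atlas c) (c1 : chart_dom c 1%g).
Variables (Gam : subgroup G).
Local Notation E := 'rV[R]_n.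
Local Notation S := (@lie_smooth R n G).
Local Notation phi := (chart_inv c).
Local Notation x0 := (c 1%g).
Local Notation X := (inv_field c).
Local Notation pr := (lq_proj Gam).
Implicit Types (p q g : G) (f h : G -> R) (u v w : E).

Let cE : finite_coords E := finite_coords_rV (R := R) n.
Let cEE : finite_coords (E * E)%type := finite_coords_prod cE cE.

Lemma lie_smooth_cvg f p : S f p -> \forall q \near p, `|f q - f p| < 1.
Proof.
move=> /(lie_smoothP ac c1) sf; apply: (near_translate c1).
have := smooth_near_continuous sf; rewrite /= chart_inv1 // mulg1.
by move/cvgr_distC_lt; apply.
Qed.

Definition orbit_invariant f := forall p q, pr p = pr q -> f p = f q.

Lemma cocompact_bounded f : cocompact_subgroup Gam -> orbit_invariant f ->
  (forall p, S f p) -> bounded f.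
Proof.
move=> cc fi sf.
have H : \forall M \near +oo, forall q, `|f q| <= M.
  apply: (cocompact_uniform (Gam := Gam)) => //.
    by move=> M p q /fi ->.
  move=> p; exists [set M | `|f p| + 1 <= M]; first exact: nbhs_pinfty_ge.
  apply: filterS (lie_smooth_cvg (sf p)) => q fq M; apply: le_trans.
  have -> : f q = f p + (f q - f p) by ring.
  by apply: le_trans (ler_normD _ _) _; rewrite lerD2l ltW.
by have [M HM] := filter_ex H; exists M.
Qed.

(** The curve t |-> phi (x0 + t v) need not be a one-parameter subgroup: only
    its velocity matters to first order. *)
Lemma first_order_uniform f v (e : R) : 0 < e ->
  cocompact_subgroup Gam -> orbit_invariant f -> (forall p, S f p) ->
  \forall t \near 0^'+, forall q,
    `|f (q * phi (x0 + t *: v))%g - f q - t * X v q f| <= e * t.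
Proof.
move=> e0 cc fi sf; apply: (cocompact_uniform (Gam := Gam)) => //.
  move=> t p q /lq_projP [g Gg ->].
  have fg : (fun q => f (g * q)%g) = f.
    by apply/funext => r; apply/esym/fi/lq_projP; exists g.
  rewrite inv_field_translate fg -mulgA.
  by rewrite -[f (g * (p * _))%g]/((fun q => f (g * q)%g) _)
    -[f (g * p)%g]/((fun q => f (g * q)%g) p) fg.
move=> p.
pose K (z : E * E) : R^o := f (p * phi z.1 * phi z.2)%g.
have sphi := smooth_map_phi ac c1.
have sK : smooth_near K (x0, x0).
  apply: (smooth_map_fun (F := fun z : E * E => (p * phi z.1 * phi z.2)%g)).
    apply: smooth_map_mul; last exact: smooth_map_phi_snd.
    by apply: smooth_map_mul; [exact: smooth_map_cst|exact: smooth_map_phi_fst].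
  exact: sf.
(* N is positive even if v = 0 *)
pose N := `|v| + 1; have N0 : 0 < N by rewrite ltr_wpDl.
have e'0 : 0 < e / N by rewrite divr_gt0.
have [r r0 rP] := strictly_differentiable cEE sK e'0.
exists [set t : R | 0 < t < r / N].
  near=> t; apply/andP; split; first by near: t; exact: nbhs_right_gt.
  by near: t; apply: nbhs_right_lt; rewrite divr_gt0.
apply: (near_translate c1).
have N1 : \forall x \near x0, smooth_near K (x, x0).
  have sp := smooth_near_pair (smooth_near_id x0) (smooth_near_cst x0 x0).
  exact: (smooth_near_continuous sp (smooth_near_near sK)).
have N2 : \forall x \near x0, `|x - x0| < r.
  by apply/nbhs_normP; exists r => // x; rewrite /= distrC.
near=> x => t /andP[t0 tr].
have xr : `|x - x0| < r by near: x.
have sx : smooth_near K (x, x0) by near: x.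
have tv : `|t *: v| <= t * N.
  by rewrite normrZ gtr0_norm // ler_wpM2l ?(ltW t0) // lerDl.
have H1 : `|(x, x0) - (x0, x0)| < r.
  by rewrite prod_normE /= subrr normr0 gt_max xr r0.
have H2 : `|(0, t *: v) : E * E| < r.
  rewrite prod_normE /= normr0 gt_max r0 /=.
  by apply: le_lt_trans tv _; rewrite -ltr_pdivlMr.
have := rP _ _ H1 H2.
have -> : (x, x0) + (0, t *: v) = (x, x0 + t *: v) by rewrite -[LHS]/(x + 0, x0 + t *: v) addr0.
have -> : 'D_(0, t *: v) K (x, x0) = t * X v (p * phi x)%g f.
  have -> : ((0, t *: v) : E * E) = t *: ((0, v) : E * E).
    by rewrite -[RHS]/(t *: 0, t *: v) scaler0.
  rewrite derive_scale_dir; last exact: smooth_near_diff.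
  by rewrite -derive_slice2 ?inv_fieldE //; exact: smooth_near_diff.
have -> : K (x, x0) = f (p * phi x)%g by rewrite /K /= chart_inv1 // mulg1.
move=> /le_trans; apply; rewrite prod_normE /= normr0.
have -> : Num.max 0 `|t *: v| = `|t *: v| by apply/max_idPr.
apply: le_trans (ler_wpM2l (ltW e'0) tv) _.
by rewrite mulrCA divfK ?gt_eqF // mulrC.
Unshelve. all: by end_near. Qed.

(** For a small t > 0 the sum of the t-differences of the [f i] would be
    at least t C / 2 everywhere, which averaging over the nilpotent group
    excludes. This plays the part of integrating a divergence over the
    nilmanifold. *)
Lemma no_constant_divergence (I : finType) (f : I -> G -> R) (v : I -> E) (C : R) :
  nilpotent_group G -> cocompact_subgroup Gam ->
  (forall i, orbit_invariant (f i)) -> (forall i p, S (f i) p) ->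
  0 < C -> ~ forall p, \sum_i X (v i) p (f i) = C.
Proof.
move=> nG cc fi sf C0 HC.
pose e := C / 2 / (#|I|%:R + 1).
have I0 : 0 < #|I|%:R + 1 :> R by rewrite ltr_wpDl.
have e0 : 0 < e by rewrite divr_gt0 // divr_gt0.
have N : \forall t \near (0 : R)^'+, 0 < t /\ forall i q,
    `|f i (q * phi (x0 + t *: v i))%g - f i q - t * X (v i) q (f i)| <= e * t.
  near=> t; split; first by near: t; exact: nbhs_right_gt.
  near: t; apply: filter_forall => i; exact: first_order_uniform.
have [t [t0 Ht]] := filter_ex N.
apply: (@nilpotent_no_drift R G I (fun i => phi (x0 + t *: v i)) f (t * C / 2) nG).
- by move=> i; exact: cocompact_bounded.
- by rewrite divr_gt0 // mulr_gt0.
move=> p.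
have : \sum_i (t * X (v i) p (f i) - e * t) <=
    \sum_i (f i (p * phi (x0 + t *: v i))%g - f i p).
  apply: ler_sum => i _; have := Ht i p; rewrite ler_norml => /andP[+ _].
  by lra.
apply: le_trans; rewrite sumrB -mulr_sumr HC sumr_const -mulr_natl.
have : #|I|%:R * (e * t) <= C / 2 * t.
  rewrite mulrA; apply: ler_wpM2r; first exact: ltW.
  rewrite /e mulrCA ler_piMr ?divr_ge0 ?(ltW C0) // ler_pdivrMr // mul1r.
  by rewrite lerDl.
lra.
Unshelve. all: by end_near. Qed.

End Drift.

(** * Tensors on the nilmanifold *)

Local Open Scope complex_scope.
Section InvariantTensors.
Context {R : realType} {n : nat} {G : lieGroupType R n}.
Variables (c : chart R n G).
Hypotheses (ac : atlas c) (c1 : chart_dom c 1%g).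
Variables (Gam : subgroup G).
Local Notation E := 'rV[R]_n.
Local Notation S := (@lie_smooth R n G).
Local Notation X := (inv_field c).
Local Notation brk := (bracket c).
Local Notation pr := (lq_proj Gam).
Local Notation M := (left_quotient Gam).
Local Notation SQ := (@quotient_smooth R n G Gam).
Implicit Types (p q g : G) (f : G -> R) (u v w : E).

(** [inv_field] with the normalization that [tangent] imposes on functions that
    are not smooth. *)
Definition tangent_vector p v : tvec R G := fun f => if `[< S f p >] then X v p f else 0.
Local Notation tv := tangent_vector.

Lemma tangent_vectorE p v f : S f p -> tv p v f = X v p f.
Proof. by move=> sf; rewrite /tv asboolT. Qed.

Lemma tangent_vector_tangent p v : tangent S p (tv p v).
Proof.
have [dl dm] := inv_field_derivation ac c1 v p.
split=> [f nsf|a f g sf sg|f g sf sg]; first by rewrite /tv asboolF.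
  by rewrite !tangent_vectorE //; [exact: dl|exact: lie_smoothZD].
by rewrite !tangent_vectorE //; [exact: dm|exact: lie_smoothM].
Qed.

Lemma tangent_is_vector p (u : tvec R G) : tangent S p u -> u = tv p (components c p u).
Proof.
move=> [u0 ul um]; apply/funext => f; rewrite /tv; case: asboolP => [sf|]; last exact: u0.
by apply: derivation_components.
Qed.

Lemma tangent_vector_lin p (a : R) u v : tv p (a *: u + v) = a *: tv p u + tv p v.
Proof.
apply/funext => f; rewrite -[RHS]/(a * tv p u f + tv p v f) /tv.
by case: asboolP => sf; [exact: inv_field_lin|rewrite mulr0 addr0].
Qed.

Lemma tangent_vector_inj p u v : tv p u = tv p v -> u = v.
Proof.
move=> H; apply: (inv_field_inj ac c1 (p := p)) => f sf.
by rewrite -!tangent_vectorE // H.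
Qed.

Lemma pushforward_translate g p v : Defs.pushforward (lsmul g) (tv p v) = tv (g * p)%g v.
Proof.
apply/funext => f; rewrite /Defs.pushforward /tv /lsmul inv_field_translate.
congr (if _ then _ else _); apply/asbool_equiv_eq.
exact: (iff_sym (lie_smooth_translate ac c1 g f p)).
Qed.

Lemma tangent_vector_field_smooth v f p : S f p -> S (fun q => tv q v f) p.
Proof.
move=> sf; apply: lie_smooth_eq (inv_field_smooth ac c1 v sf).
by apply: filterS (lie_smooth_near sf) => q sq; rewrite tangent_vectorE.
Qed.

Lemma tangent_vector_field v : vector_field S (fun p => tv p v).
Proof.
split; first by move=> p; exact: tangent_vector_tangent.
by move=> f p; exact: tangent_vector_field_smooth.
Qed.

Lemma lie_bracket_tangent_vector u v p :
  lie_bracket S (fun p => tv p u) (fun p => tv p v) p = tv p (brk u v).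
Proof.
apply/funext => f; rewrite /lie_bracket.
have [sf|nsf] := pselect (S f p); last by rewrite {5}/tv !asboolF.
have E a b : tv p a (fun q => tv q b f) = X a p (fun q => X b q f).
  rewrite tangent_vectorE; last exact: tangent_vector_field_smooth.
  apply: (derivation_local (inv_field_derivation ac c1 a p)); last exact: tangent_vector_field_smooth.
  by apply: filterS (lie_smooth_near sf) => q sq; rewrite tangent_vectorE.
by rewrite asboolT // !E bracketE // tangent_vectorE.
Qed.

Definition quotient_vector p v : tvec R M := Defs.pushforward pr (tv p v).
Local Notation tq := quotient_vector.

Lemma quotient_smoothP (F : M -> R) p : SQ F (pr p) <-> S (fun q => F (pr q)) p.
Proof.
split=> [|sF q]; first exact.
move=> /esym /lq_projP [g Gg ->]; apply/(lie_smooth_translate ac c1).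
have -> // : (fun q => F (pr (g * q)%g)) = (fun q => F (pr q)).
by apply/funext => r; congr F; apply/esym/lq_projP; exists g.
Qed.

Lemma quotient_vector_eq p q v : pr p = pr q -> tq p v = tq q v.
Proof.
move=> /lq_projP [g Gg ->]; rewrite /tq -pushforward_translate.
apply/funext => F; rewrite /Defs.pushforward /lsmul; congr (tv p v _).
by apply/funext => r; congr F; apply/lq_projP; exists g.
Qed.

(** A left-invariant field descends; its value does not depend on the
    representative by [quotient_vector_eq]. *)
Definition quotient_field v : M -> tvec R M := fun x => tq (repr x) v.
Local Notation YQ := quotient_field.

Lemma quotient_fieldE v p : YQ v (pr p) = tq p v.
Proof. by apply: quotient_vector_eq; exact: reprK. Qed.

Lemma quotient_vector_tangent p v : tangent SQ (pr p) (tq p v).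
Proof.
have [v0 vl vm] := tangent_vector_tangent p v.
split=> [F nsF|a F H /quotient_smoothP sF /quotient_smoothP sH
        |F H /quotient_smoothP sF /quotient_smoothP sH].
- by apply: v0 => sF; apply: nsF; apply/quotient_smoothP.
- exact: (vl a _ _ sF sH).
- exact: (vm _ _ sF sH).
Qed.

Lemma quotient_vector_lin p (a : R) u v : tq p (a *: u + v) = a *: tq p u + tq p v.
Proof. by rewrite /tq tangent_vector_lin. Qed.

Lemma quotient_field_vector_field v : vector_field SQ (YQ v).
Proof.
split; first by move=> x; rewrite -{1}(reprK x); exact: quotient_vector_tangent.
move=> F x sF p px; subst x.
have -> : (fun q => YQ v (pr q) F) = (fun q => tv q v (fun q => F (pr q))).
  by apply/funext => q; rewrite quotient_fieldE.
by apply: tangent_vector_field_smooth; apply/quotient_smoothP.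
Qed.

Lemma lie_bracket_quotient_field u v p :
  lie_bracket SQ (YQ u) (YQ v) (pr p) = tq p (brk u v).
Proof.
rewrite /tq -lie_bracket_tangent_vector; apply/funext => F.
rewrite /Defs.pushforward /lie_bracket.
have -> : `[< SQ F (pr p) >] = `[< S (fun q => F (pr q)) p >].
  by apply/asbool_equiv_eq; exact: quotient_smoothP.
case: ifP => // _; rewrite !quotient_fieldE /tq /Defs.pushforward.
by congr (tv p _ _ - tv p _ _); apply/funext => q; rewrite quotient_fieldE.
Qed.

End InvariantTensors.

(** * Complex structure and closed forms in the invariant frame *)
Section HermitianData.
Context {R : realType} {n : nat} {G : lieGroupType R n}.
Variables (c : chart R n G).
Hypotheses (ac : atlas c) (c1 : chart_dom c 1%g).
Variables (Gam : subgroup G).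
Local Notation E := 'rV[R]_n.
Local Notation S := (@lie_smooth R n G).
Local Notation X := (inv_field c).
Local Notation brk := (bracket c).
Local Notation pr := (lq_proj Gam).
Local Notation M := (left_quotient Gam).
Local Notation SQ := (@quotient_smooth R n G Gam).
Local Notation tv := (tangent_vector c).
Local Notation tq := (@quotient_vector R n G c Gam).
Local Notation YQ := (@quotient_field R n G c Gam).
Implicit Types (p q g : G) (f : G -> R) (u v w : E).

Section ComplexStructure.
Variable JG : G -> tvec R G -> tvec R G.
Hypotheses (JGc : complex_structure S JG) (JGl : left_invariant_endo JG).

Definition inv_complex v : E := components c 1%g (JG 1%g (tv 1%g v)).
Local Notation j := inv_complex.

Let tvt p v : tangent S p (tv p v) := tangent_vector_tangent ac c1 p v.

Lemma inv_complexE p v : JG p (tv p v) = tv p (j v).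
Proof.
have [[Jt _ _] _ _] := JGc.
have E1 : JG 1%g (tv 1%g v) = tv 1%g (j v).
  by apply: (tangent_is_vector ac c1); apply: Jt.
have := JGl p (tvt 1%g v).
by rewrite !pushforward_translate // E1 !pushforward_translate // mulg1.
Qed.

Lemma inv_complex_lin (a : R) u v : j (a *: u + v) = a *: j u + j v.
Proof.
have [[_ Jl _] _ _] := JGc.
apply: (tangent_vector_inj ac c1 (p := 1%g)).
by rewrite -inv_complexE !tangent_vector_lin // Jl // !inv_complexE.
Qed.

Lemma inv_complexK v : j (j v) = - v.
Proof.
have [_ JJ _] := JGc.
apply: (tangent_vector_inj ac c1 (p := 1%g)).
rewrite -!inv_complexE JJ //.
have := tangent_vector_lin ac c1 1%g (-1) v 0.
have := tangent_vector_lin ac c1 1%g (-1) 0 0.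
by rewrite !scaleN1r !addr0 oppr0 addNr => ->; rewrite addr0.
Qed.

Lemma tangent_vectorB p u v : tv p (u - v) = tv p u - tv p v.
Proof. by rewrite addrC -scaleN1r tangent_vector_lin // scaleN1r addrC. Qed.

Lemma inv_complex_nijenhuis u v :
  brk (j u) (j v) - j (brk (j u) v) - j (brk u (j v)) - brk u v = 0.
Proof.
have [_ _ N] := JGc.
have := N _ _ 1%g (tangent_vector_field ac c1 u) (tangent_vector_field ac c1 v).
rewrite /nijenhuis.
have JE w : (fun q => JG q (tv q w)) = (fun q => tv q (j w)).
  by apply/funext => q; rewrite inv_complexE.
rewrite !JE !lie_bracket_tangent_vector // !inv_complexE -!tangent_vectorB => H.
apply: (tangent_vector_inj ac c1 (p := 1%g)); rewrite H.
by rewrite -[X in _ = tv _ X](subrr (0 : E)) tangent_vectorB subrr.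
Qed.

End ComplexStructure.

Section Forms.
Variable Om : M -> tvec R M -> tvec R M -> R[i].
Hypotheses (Omf : form2 SQ Om) (Omc : closed2 SQ Om).

(** The form [Om] is not assumed left-invariant: its coefficients in the
    invariant frame are functions on the quotient. *)
Definition form_coeff u v p : R := complex.Re (Om (pr p) (YQ u (pr p)) (YQ v (pr p))).

Let tqt p v : tangent SQ (pr p) (tq p v) := quotient_vector_tangent ac c1 Gam p v.

Lemma form_coeffE u v p : form_coeff u v p = complex.Re (Om (pr p) (tq p u) (tq p v)).
Proof. by rewrite /form_coeff !quotient_fieldE. Qed.

Lemma form_coeff_lin (a : R) u v w p :
  form_coeff (a *: u + v) w p = a * form_coeff u w p + form_coeff v w p.
Proof.
have [Ol _ _] := Omf.
rewrite !form_coeffE quotient_vector_lin // Ol //.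
case: (Om _ (tq p u) _) => r1 i1; case: (Om _ (tq p v) _) => r2 i2 /=.
by rewrite mul0r subr0.
Qed.

Lemma form_coeffN u v p : form_coeff u v p = - form_coeff v u p.
Proof.
have [_ Oa _] := Omf.
by rewrite !form_coeffE Oa //; case: (Om _ _ _).
Qed.

Lemma form_coeff0 u p : form_coeff 0 u p = 0.
Proof.
have := form_coeff_lin (-1) 0 0 u p; rewrite scaler0 addr0; lra.
Qed.

Lemma form_coeff_invariant u v : orbit_invariant Gam (form_coeff u v).
Proof. by move=> p q pq; rewrite /form_coeff pq. Qed.

Lemma form_coeff_smooth u v p : S (form_coeff u v) p.
Proof.
have [_ _ Os] := Omf.
have [H _] := Os _ _ (pr p) (quotient_field_vector_field ac c1 Gam u)
  (quotient_field_vector_field ac c1 Gam v).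
exact: (H p erefl).
Qed.

(** Closedness in the invariant frame: the derivatives of the coefficients do
    not vanish, but they will disappear on averaging. *)
Lemma form_coeff_closed u v w p :
  X u p (form_coeff v w) - X v p (form_coeff u w) + X w p (form_coeff u v)
  - form_coeff (brk u v) w p + form_coeff (brk u w) v p - form_coeff (brk v w) u p = 0.
Proof.
have := Omc (pr p) (quotient_field_vector_field ac c1 Gam u)
  (quotient_field_vector_field ac c1 Gam v) (quotient_field_vector_field ac c1 Gam w).
rewrite /d2 !lie_bracket_quotient_field // !quotient_fieldE //.
move=> /(congr1 (@complex.Re R)); rewrite !form_coeffE.
have DE a b d : complex.Re (Defs.derivC (tq p a) (fun x => Om x (YQ b x) (YQ d x))) =
    X a p (form_coeff b d).
  by rewrite /Defs.derivC /= /quotient_vector /Defs.pushforward tangent_vectorE //; exact: form_coeff_smooth.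
rewrite -!DE.
case: (Defs.derivC _ _) => ? ?; case: (Defs.derivC _ _) => ? ?; case: (Defs.derivC _ _) => ? ?.
by case: (Om _ _ _) => ? ?; case: (Om _ _ _) => ? ?; case: (Om _ _ _) => ? ? /= ->.
Qed.

End Forms.

End HermitianData.

(** * The (1,1)-component and the final contradiction *)
Section TypeDecomposition.
Context {R : realType} {M : Type} {SM : smooth_structure R M}.
Variables (J : M -> tvec R M -> tvec R M) (al : M -> tvec R M -> tvec R M -> R[i]).
Hypothesis alf : form2 SM al.
Variables (p : M) (u : tvec R M).
Hypotheses (tu : tangent SM p u) (tJu : tangent SM p (J p u)).

Let alN x y : tangent SM p x -> tangent SM p y -> al p (- x) y = - al p x y.
Proof.
move=> tx ty; have [lin _ _] := alf.
(* - x = (- 2) x + x is of the shape a x + x' with x' tangent *)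
have := lin p (- 2) x x y tx tx ty.
have -> : (- 2) *: x + x = - x.
  by rewrite scaleNr scaler_nat mulr2n opprD addrNK.
move=> ->; case: (al p x y) => a b; simpc; congr (_ +i* _); ring.
Qed.

Let tN x : tangent SM p x -> tangent SM p (- x).
Proof.
move=> [x0 xl xm]; split=> [f nf|a f g sf sg|f g sf sg].
- by rewrite -[LHS]/(- x f) x0 // oppr0.
- by rewrite -[LHS]/(- x _) xl // -[RHS]/(a * (- x f) - x g); ring.
- by rewrite -[LHS]/(- x _) xm // -[RHS]/((- x f) * g p + f p * (- x g)); ring.
Qed.

Let alxx x : tangent SM p x -> al p x x = 0.
Proof.
move=> tx; have [_ anti _] := alf; have := anti p x x tx tx.
by case: (al p x x) => a b; simpc => -[h1 h2]; congr (_ +i* _); lra.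
Qed.

(** A form of type (2,0) or (0,2) vanishes on a complex line, so on pairs u, J u
    a form is determined by its (1,1)-component. *)
Lemma type20_diagonal : type20 SM J al -> al p u (J p u) = 0.
Proof.
move=> t20; have [+ _] := t20 p u u tu tu; have [_ anti _] := alf.
rewrite /extC (alxx tu) (anti p _ (- J p u)) //; last exact: tN.
rewrite (alN tJu tJu) (alxx tJu) (anti p (J p u) u) // (anti p u (- J p u)) //; last exact: tN.
rewrite (alN tJu tu) (anti p (J p u) u) //.
by case: (al p u (J p u)) => a b; simpc => -[h1 h2]; congr (_ +i* _); lra.
Qed.

Lemma type02_diagonal : type02 SM J al -> al p u (J p u) = 0.
Proof.
move=> t02; have [_ +] := t02 p u u tu tu; have [_ anti _] := alf.
rewrite /extC (alxx tu) (alN tJu tJu) (alxx tJu) (alN tJu tu) (anti p (J p u) u) //.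
by case: (al p u (J p u)) => a b; simpc => -[h1 h2]; congr (_ +i* _); lra.
Qed.

End TypeDecomposition.

Theorem proposition1p4 (R : realType) (G : lieGroupType R 6)
    (Gam : subgroup G)
    (G_connected : connected [set: G]%classic)
    (G_simply_connected : loops_contractible R G)
    (G_nilpotent : nilpotent_group G)
    (Gam_discrete : discrete_subgroup Gam)
    (Gam_cocompact : cocompact_subgroup Gam)
    (X_not_torus : ~ (forall x y : G, (x * y)%g = (y * x)%g))
    (J : left_quotient Gam -> tvec R (left_quotient Gam) ->
         tvec R (left_quotient Gam))
    (J_left_invariant : left_invariant_complex_structure J) :
  ~ exists h : left_quotient Gam -> tvec R (left_quotient Gam) ->
               tvec R (left_quotient Gam) -> R,
      left_invariant_hermitian_metric J h /\
      exists Omega : left_quotient Gam -> tvec R (left_quotient Gam) ->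
                     tvec R (left_quotient Gam) -> complex R,
        [/\ form2 (@quotient_smooth R 6 G Gam) Omega,
            closed2 (@quotient_smooth R 6 G Gam) Omega &
            is_component11 (@quotient_smooth R 6 G Gam) J Omega
              (fundamental_form J h)].
Proof.
move=> [h [[[hr hJ] [hG [hGr hGl hhG]]]]].
move=> [Om [Omf Omc [al20 [al02 [[f20 t20] [f11 t11] [f02 t02] OmE]]]]].
have [c ac c1] := atlas_cover (1%g : G).
have [Jc [JG [JGc JGl JJG]]] := J_left_invariant.
pose j := inv_complex c JG; pose brk := bracket c.
pose tv := tangent_vector c; pose tq := @quotient_vector R 6 G c Gam.
pose f := form_coeff c Om; pose X := inv_field c.
have JE p v : J (lq_proj Gam p) (tq p v) = tq p (j v).
  rewrite /tq /quotient_vector JJG; last exact: tangent_vector_tangent.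
  by rewrite (inv_complexE ac c1 JGc JGl).
pose h0 v := hG 1%g (tv 1%g v) (tv 1%g v).
have hE p v : h (lq_proj Gam p) (tq p v) (tq p v) = h0 v.
  rewrite /tq /quotient_vector hhG; [|exact: tangent_vector_tangent..].
  rewrite /h0 -(hGl p 1%g); [|exact: tangent_vector_tangent..].
  by rewrite (pushforward_translate ac c1) mulg1.
have tqt p v : tangent (@quotient_smooth R 6 G Gam) (lq_proj Gam p) (tq p v).
  exact: quotient_vector_tangent.
have h0_gt0 v : v <> 0 -> 0 < h0 v.
  move=> v0; have [_ _ hpos _] := hGr; apply: hpos.
    exact: tangent_vector_tangent.
  move=> tv0; apply: v0; apply: (tangent_vector_inj ac c1 (p := 1%g)).
  have T0 : tv 1%g 0 = 0.
    have := tangent_vector_lin ac c1 1%g (-1) 0 0.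
    by rewrite !scaleN1r addr0 oppr0 addNr.
  by rewrite -/tv tv0 T0.
have fjE v p : f v (j v) p = h0 v.
  rewrite /f form_coeffE // -/tq OmE // -JE.
  rewrite (type20_diagonal f20 (tqt p v)) //; last by rewrite JE.
  rewrite (type02_diagonal f02 (tqt p v)) //; last by rewrite JE.
  by rewrite add0r addr0 /fundamental_form /= hJ // hE.
have fcl u v w p := form_coeff_closed ac c1 Omf Omc u v w p.
have f0 u p : f 0 u p = 0 := form_coeff0 ac c1 Omf u p.
have fN u v p : f u v p = - f v u p := form_coeffN ac c1 Omf u v p.
have fD u v w p : f (u + v) w p = f u w p + f v w p.
  by have := form_coeff_lin ac c1 Omf 1 u v w p; rewrite scale1r mul1r.
have XN v p k : lie_smooth k p -> X (- v) p k = - X v p k.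
  move=> sk; have := inv_field_lin ac c1 (-2) v v sk.
  have -> : (- 2) *: v + v = - v by rewrite scaleNr scaler_nat mulr2n opprD addrNK.
  by move=> H; rewrite /X H; ring.
have fs u v p : lie_smooth (f u v) p by exact: (form_coeff_smooth ac c1 Omf).
have fi u v : orbit_invariant Gam (f u v) by exact: form_coeff_invariant.
have nab : exists u v, brk u v <> 0.
  apply: contrapT => H; apply: X_not_torus => x y.
  apply: (abelian_of_bracket0 ac c1) => // u v.
  by apply: contrapT => uv; apply: H; exists u, v.
have [k Zk] := G_nilpotent.
have nilp := nilpotent_bracket ac c1 Zk.
have := complex_nilpotent_dichotomy (bracketDZl ac c1) (bracketN ac c1) (jacobi ac c1)
  (inv_complex_lin ac c1 JGc JGl) (inv_complexK ac c1 JGc JGl)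
  (inv_complex_nijenhuis ac c1 JGc JGl) nilp nab.
rewrite -/brk -/j.
move=> [[y [w [z0 zc Jzc]]]|[t [u [v [v0 [tu tju] [tv0 tjv] vjuv]]]]].
  (* both z and J z are central: closedness on (J z, y, w) *)
  set z := brk y w in z0 zc Jzc.
  pose fs3 : seq (G -> R) := [:: f y w; f (j z) w; f (j z) y].
  pose vs3 : seq 'rV[R]_6 := [:: j z; - y; w].
  apply: (@no_constant_divergence _ _ _ c ac c1 Gam 'I_3
    (fun i => nth (f 0 0) fs3 i) (fun i => nth 0 vs3 i) (h0 z)) => //.
  - by move=> [[|[|[|//]]] i3]; exact: fi.
  - by move=> [[|[|[|//]]] i3] p; exact: fs.
  - exact: h0_gt0.
  move=> p; rewrite !big_ord_recl big_ord0 addr0 /= -/X XN //.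
  have := fcl (j z) y w p; rewrite -/brk -/f -/X !Jzc !f0 -/z fjE.
  by move=> H; lra.
(* the sum of the closedness relations on (t, v, J u) and (t, u, J v) *)
pose fs6 : seq (G -> R) := [:: f v (j u); f t (j u); f t v; f u (j v); f t (j v); f t u].
pose vs6 : seq 'rV[R]_6 := [:: t; - v; j u; t; - u; j v].
apply: (@no_constant_divergence _ _ _ c ac c1 Gam 'I_6
    (fun i => nth (f 0 0) fs6 i) (fun i => nth 0 vs6 i) (2 * h0 v)) => //.
- by move=> [[|[|[|[|[|[|//]]]]]] i3]; exact: fi.
- by move=> [[|[|[|[|[|[|//]]]]]] i3] p; exact: fs.
- by rewrite mulr_gt0 // h0_gt0.
move=> p; rewrite !big_ord_recl big_ord0 addr0 /= -/X !XN //.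
have H1 := fcl t v (j u) p; have H2 := fcl t u (j v) p.
rewrite -/brk -/f -/X tv0 tju f0 (fN (j v)) fjE in H1.
rewrite -/brk -/f -/X tu tjv f0 fjE in H2.
have := fD (brk v (j u)) (brk u (j v)) t p; rewrite vjuv f0 => H3.
lra.
Qed.
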